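(* Let $X,U$ be Banach spaces, let $A:D(A)\subset X\to X$ generate an analytic semigroup $T=(T(t))_{t\ge0}$ on $X$ satisfying $\|T(t)\|\le Me^{\lambda t}$, $t\ge0$, for certain $M\ge1$, $\lambda>0$. Assume: (i) $\alpha\in(0,1)$; (ii) $B\in L(U,X_{-1+\alpha+\varepsilon})$ for sufficiently small $\varepsilon>0$; (iii) $f\in C(X_\alpha\times U,X)$, and for each $r>0$ there is $L=L(r)>0$ such that $\|f(x_1,u)-f(x_2,u)\|_X\le L\|x_1-x_2\|_{X_\alpha}$ for all $x_1,x_2\in X_\alpha$ with $\|x_1\|_{X_\alpha},\|x_2\|_{X_\alpha}<r$ and all $u\in U$ with $\|u\|_U<r$; (iv) for all $u\in L^\infty(\mathbb{R}_+,U)$ and any $x\in C(\mathbb{R}_+,X)$ with $x((0,+\infty))\subset X_\alpha$, the map $s\mapsto f(x(s),u(s))$ is in $L^p_{loc}(\mathbb{R}_+,X)$ with a certain $p>\frac1{1-\alpha}$; (v) there are $\sigma\in\mathcal{K}_\infty$ and $c>0$ with $\|f(0,u)\|_X\le\sigma(\|u\|_U)+c$ for all $u\in U$. Then for any compact set $Q\subset X_\alpha$, any $r>0$, any bounded set $\mathcal{S}\subset U$, and any $\delta>0$ there is a time $t_1=t_1(Q,r,\mathcal{S},\delta)>0$ such that for any $w\in Q$, any $x_0\in B_{r,X_\alpha}(w)$, and any $u\in L^\infty_{loc}(\mathbb{R}_+,U)$ with $u(t)\in\mathcal{S}$ for a.e. $t\in\mathbb{R}_+$, there is a unique mild solution on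 $[0,t_1]$ of $$\dot x(t)=Ax(t)+f(x(t),u(t))+Bu(t),\qquad x(0)=x_0,$$ and it lies in the ball $B_{Mr+\delta,X_\alpha}(w)$.
   Context: $\mathcal{K}_\infty$ is the set of continuous, strictly increasing, unbounded $\gamma:\mathbb{R}_+\to\mathbb{R}_+$ with $\gamma(0)=0$. $L^p_{loc}(\mathbb{R}_+,X)$: functions whose restriction to each $[0,t]$ is in $L^p([0,t],X)$ (Bochner). Let $\omega_0(T)$ be the growth bound of $T$, and fix $\omega>\omega_0(T)$. For $\alpha\ge0$: $X_\alpha:=D((\omega I-A)^\alpha)$ with norm $\|x\|_{X_\alpha}:=\|(\omega I-A)^\alpha x\|_X$; for $\beta>0$: $X_{-\beta}$ is the completion of $X$ in the norm $x\mapsto\|(\omega I-A)^{-\beta}x\|_X$ (so $X_{-1+\alpha+\varepsilon}\subset X_{-1}$ continuously when $0<\alpha+\varepsilon<1$). $B_{\rho,X_\alpha}(w)$ is the open ball in $X_\alpha$ of radius $\rho$ around $w$. $T_{-1}$ is the unique extension of $T$ to a $C_0$-semigroup on $X_{-1}$. A mild solution on $[0,\tau]$ is a function $x\in C([0,\tau],X)$ with $x(s)\in X_\alpha$ for $s\in(0,\tau]$ such that for all $t\in[0,\tau]$ $$x(t)=T(t)x_0+\int_0^tT(t-s)f(x(s),u(s))\,ds+\int_0^tT_{-1}(t-s)Bu(s)\,ds.$$ *)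

(* Defs.v *)
From HB Require Import structures.
From mathcomp Require Export all_boot all_order all_algebra.
From mathcomp Require Export all_classical all_reals all_analysis.
From mathcomp Require Export complex.
Export Order.TTheory GRing.Theory Num.Theory numFieldNormedType.Exports.
Set Implicit Arguments.
Unset Strict Implicit.
Unset Printing Implicit Defensive.
#[export] Set Implicit Arguments.
#[export] Unset Strict Implicit.
Global Open Scope classical_set_scope.
Global Open Scope ring_scope.

(** Conventions.  Banach spaces are real ([completeNormedModType R]).  A complex
    Banach space is covered by restricting its scalars to R: none of the notions
    below changes, analyticity of a semigroup being expressed on the
    complexification.  Time-dependent functions have domain R; only their values
    on [0, +oo[ (or on the interval at hand) matter. *)

Section Bochner.
Context {R : realType} {Y : normedModType R}.
Local Notation mu := (@lebesgue_measure R).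

(* The list [:: (A1, y1); ...] stands for the function \sum_i 1_(Ai) yi. *)
Definition simple_data := seq (set R * Y).

Definition is_simple (s : simple_data) : Prop :=
  forall q, q \in s -> measurable q.1 /\ (mu q.1 < +oo)%E.

Definition simple_fun (s : simple_data) (t : R) : Y :=
  \sum_(q <- s) \1_(q.1) t *: q.2.

Definition simple_integral (D : set R) (s : simple_data) : Y :=
  \sum_(q <- s) fine (mu (q.1 `&` D)) *: q.2.

Definition approximates (D : set R) (s : nat -> simple_data) (g : R -> Y) : Prop :=
  (forall n, is_simple (s n)) /\
  {ae mu, forall t, D t -> simple_fun (s n) t @[n --> \oo] --> g t}.

Definition strongly_measurable (D : set R) (g : R -> Y) : Prop :=
  exists s, approximates D s g.

(* The integral of the norm in [is_bochner_integral], [memLp] is that of a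
   Lebesgue-measurable function, because of the almost everywhere convergence
   required in [approximates]. *)
Definition is_bochner_integral (D : set R) (g : R -> Y) (v : Y) : Prop :=
  exists s, [/\ approximates D s g,
    (\int[mu]_(t in D) (`|g t - simple_fun (s n) t|)%:E)%E @[n --> \oo] --> 0%E &
    simple_integral D (s n) @[n --> \oo] --> v].

Definition bochner_integrable (D : set R) (g : R -> Y) : Prop :=
  exists v, is_bochner_integral D g v.

(* Equal to 0 if g is not Bochner integrable. *)
Definition bochner_integral (D : set R) (g : R -> Y) : Y :=
  xget 0 [set v | is_bochner_integral D g v].

Definition memLp (p : R) (D : set R) (g : R -> Y) : Prop :=
  strongly_measurable D g /\
  (\int[mu]_(t in D) (`|g t| `^ p)%:E < +oo)%E.

Definition memLinfty (D : set R) (g : R -> Y) : Prop :=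
  strongly_measurable D g /\
  exists C : R, {ae mu, forall t, D t -> `|g t| <= C}.

Definition memLp_loc (p : R) (g : R -> Y) : Prop :=
  forall t, 0 <= t -> memLp p `[0, t] g.

Definition memLinfty_loc (g : R -> Y) : Prop :=
  forall t, 0 <= t -> memLinfty `[0, t] g.

End Bochner.

Section Semigroups.
Context {R : realType} {X : normedModType R}.

Definition C0_semigroup (T : R -> {linear X -> X}) : Prop :=
  [/\ forall t, 0 <= t -> continuous (T t),
      forall x, T 0 x = x,
      forall s t, 0 <= s -> 0 <= t -> forall x, T (s + t) x = T s (T t x) &
      forall x, T t x @[t --> 0^'+] --> x].

Definition is_generator (T : R -> {linear X -> X}) (DA : set X) (A : X -> X) : Prop :=
  DA = [set x | cvg (h^-1 *: (T h x - x) @[h --> 0^'+])] /\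
  forall x, DA x -> h^-1 *: (T h x - x) @[h --> 0^'+] --> A x.

Definition exp_bounded (T : R -> {linear X -> X}) (M w : R) : Prop :=
  forall t, 0 <= t -> forall x, `|T t x| <= M * expR (w * t) * `|x|.

Definition growth_bound (T : R -> {linear X -> X}) : \bar R :=
  ereal_inf [set w%:E | w in [set w : R | exists M, exp_bounded T M w]].

(* Multiplication by z on the complexification X + iX of X, realised as X * X.
   The max norm of X * X is equivalent to the usual complexification norms. *)
Definition cscale (z : R[i]) (v : X * X) : X * X :=
  (complex.Re z *: v.1 - complex.Im z *: v.2,
   complex.Re z *: v.2 + complex.Im z *: v.1).

(* The open sector { z <> 0 : |arg z| < theta }. *)
Definition sector (theta : R) (z : R[i]) : Prop :=
  exists r phi : R, [/\ 0 < r, `|phi| < theta &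
    z = ((r * cos phi) +i* (r * sin phi))%C].

Definition clinear (S : X * X -> X * X) : Prop :=
  forall z v, S (cscale z v) = cscale z (S v).

(* In operator norm. *)
Definition holomorphic_at (S : R[i] -> {linear (X * X)%type -> (X * X)%type})
    (z : R[i]) : Prop :=
  exists S' : {linear (X * X)%type -> (X * X)%type},
    [/\ continuous S', clinear S' &
      forall e : R, 0 < e -> exists2 d : R, 0 < d &
        forall h : R[i], Normc.normc h < d -> forall v : X * X,
          `|S (z + h) v - S z v - cscale h (S' v)| <= e * Normc.normc h * `|v|].

(* The complexification of T extends to a holomorphic semigroup on a sector. *)
Definition analytic_semigroup (T : R -> {linear X -> X}) : Prop :=
  C0_semigroup T /\
  exists (theta : R) (S : R[i] -> {linear (X * X)%type -> (X * X)%type}),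
    [/\ 0 < theta <= pi / 2,
        forall t : R, 0 <= t -> forall v, S (t%:C)%C v = (T t v.1, T t v.2),
        forall z, sector theta z ->
          [/\ continuous (S z), clinear (S z) & holomorphic_at S z],
        forall z z', sector theta z -> sector theta z' ->
          forall v, S (z + z') v = S z (S z' v) &
        forall theta', 0 < theta' < theta -> forall v (e : R), 0 < e ->
          exists2 d : R, 0 < d &
            forall z, sector theta' z -> Normc.normc z < d -> `|S z v - v| < e].

End Semigroups.

Definition Gamma {R : realType} (a : R) : R :=
  \int[lebesgue_measure]_(t in `]0, +oo[) (t `^ (a - 1) * expR (- t)).

Section FractionalPowers.
Context {R : realType} {X : normedModType R}.
Context (T : R -> {linear X -> X}) (omega : R).

(* (omega I - A)^(-a) for a > 0, where A is the generator of T and omega exceeds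
   the growth bound of T: A - omega I generates (expR (- omega t) T(t))_t, and
   S^(-a) = Gamma(a)^-1 \int_0^oo t^(a-1) e^(-tS) dt for S = omega I - A. *)
Definition neg_power (a : R) (x : X) : X :=
  (Gamma a)^-1 *: bochner_integral `]0, +oo[
    (fun t => (t `^ (a - 1) * expR (- (omega * t))) *: T t x).

(* The domain of (omega I - A)^a, a > 0, which is the inverse of the (injective)
   operator (omega I - A)^(-a). *)
Definition Xpow (a : R) : set X := range (neg_power a).

(* (omega I - A)^a on Xpow a, and 0 elsewhere. *)
Definition power (a : R) (x : X) : X := xget 0 [set y | neg_power a y = x].

Definition Xpow_norm (a : R) (x : X) : R := `|power a x|.

Definition Xpow_ball (a : R) (w : X) (rho : R) : set X :=
  [set x | Xpow a x /\ Xpow_norm a (x - w) < rho].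

(* The type X with a topology that induces on the subset Xpow a the topology of
   the norm Xpow_norm a. *)
Definition Xpow_top (a : R) : topologicalType := initial_topology (power a).

(* E, with the embedding j of X into E, is the completion X_(-b) of X for the
   norm x |-> |(omega I - A)^(-b) x|. *)
Definition is_extrapolation_space (b : R) (E : completeNormedModType R)
    (j : {linear X -> E}) : Prop :=
  (forall x, `|j x| = `|neg_power b x|) /\ dense (range j).

End FractionalPowers.

Definition Kinfty {R : realType} (gamma : R -> R) : Prop :=
  [/\ {within `[0, +oo[, continuous gamma},
      {in `[0, +oo[ &, {homo gamma : r s / r < s}},
      forall C : R, exists2 r, 0 <= r & C < gamma r &
      gamma 0 = 0].

(* The equation holds in X_(-1) (the type Xm1), into which X embeds by j; Tm1 is
   T_(-1), and Bm1 is B followed by the inclusion of X_(-1+alpha+eps). *)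
Definition mild_solution {R : realType} {X Xm1 : completeNormedModType R}
    {U : normedModType R} (T : R -> {linear X -> X}) (omega alpha : R)
    (j : X -> Xm1) (Tm1 : R -> {linear Xm1 -> Xm1}) (Bm1 : U -> Xm1)
    (f : X -> U -> X) (x0 : X) (u : R -> U) (tau : R) (x : R -> X) : Prop :=
  [/\ {within `[0, tau], continuous x},
      forall s, 0 < s <= tau -> Xpow T omega alpha (x s) &
      forall t, 0 <= t <= tau ->
        let F := fun s => T (t - s) (f (x s) (u s)) in
        let G := fun s => Tm1 (t - s) (Bm1 (u s)) in
        [/\ bochner_integrable `[0, t] F, bochner_integrable `[0, t] G &
            j (x t) = j (T t x0 + bochner_integral `[0, t] F)
                      + bochner_integral `[0, t] G]].

(* Main.v *)
(** Writing S for omega I - A and v = S^alpha x, the mild equation becomes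
      v(t) = T(t) v0 + \int_0^t W(t-s) f(S^(-alpha) v(s), u(s)) ds + \int_0^t Z(t-s) B u(s) ds
    in X, where W(t) = S^alpha T(t) and Z(t) = S^alpha T_(-1)(t) : E -> X satisfy
    |W(t)| <= C t^(-alpha) and |Z(t)| <= C t^(eps-1).  Both singularities are integrable,
    so for small times the right-hand side is a contraction of a ball centred at
    S^alpha w, and compactness of S^alpha Q makes that time independent of w.

    The kernel bounds come from the Cauchy estimate |A T(t)| <= C / t on the sector
    and from the law S^(-a) S^(-b) = c S^(-(a+b)), c > 0, which follows from Tonelli's
    theorem applied to the Gamma integrals of real functionals: one writes
    S^alpha T(t) = c S^(-(1-alpha)) S T(t), and for Z one splits off the factor
    S^(-(1-alpha-eps)), whose norm is that of E.

    For uniqueness, the L^p hypothesis on f(y(s), u(s)) with p > 1/(1-alpha) shows that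
    S^alpha y is bounded for any mild solution y; the local Lipschitz condition then
    applies to the difference of two solutions, which vanishes on successive short
    intervals. *)

From HB Require Import structures.
Require Import Defs.
From mathcomp Require Import measurable_realfun ring lra.

(** Vector-valued statements are pushed down to real integrals: a vector is determined, and its norm
    computed, by the functionals of norm at most one, so a Bochner integral is characterised by
    strong measurability, integrability of the norm and the values of these functionals. Tonelli's
    theorem, the fundamental theorem of calculus and dilations are then applied to real functions.
    Holomorphy is likewise read through real functionals of the complexification, as Cauchy-Riemann
    pairs on a disc, where Cauchy's estimate becomes a statement on averages over circles.

    In the radius, M r comes from |T(t)(v0 - S^alpha w)| <= M e^(lambda t) r; delta is shared
    between e^(lambda t) - 1, the motion of S^alpha Q under T(t), and the two integrals.

    For uniqueness, the obstacle is that a mild solution is only continuous in X, with values in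
    X_alpha at positive times: no bound in X_alpha near 0 is given, so no Lipschitz constant is
    available at the start. The condition p > 1/(1-alpha) says that t^(-alpha) is locally in L^q for
    the conjugate exponent q, and this supplies the bound. *)

Definition linear_pack (R : numFieldType) (V W : normedModType R) (f : V -> W)
  (lf : linear f) : {linear V -> W} := HB.pack f (GRing.isLinear.Build _ _ _ _ _ lf).

(** * Norming functionals *)

Section Norming.
Context {R : realType} {Y : normedModType R}.

(** Partial functionals are handled as graphs. Linearity and domination already make such a graph
    single-valued, since two values over the same vector differ by at most the norm of 0. *)
Let dominated_graph (G : set (Y * R)) : Prop :=
  (forall a u v, G u -> G v -> G (a *: u.1 + v.1, a * u.2 + v.2)) /\
  (forall u, G u -> u.2 <= `|u.1|).

(** One-dimensional extension step: [c] is the value to assign to [y]. It exists because u.2 + v.2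
    <= |u.1 + v.1| <= |u.1 + y| + |v.1 - y| puts every lower constraint below every upper one. *)
Lemma dominated_graph_sup (G : set (Y * R)) (y : Y) : dominated_graph G -> G (0, 0) ->
  exists c, forall u, G u -> u.2 + c <= `|u.1 + y| /\ u.2 - c <= `|u.1 - y|.
Proof.
move=> [lin dom] G0.
pose E := [set u.2 - `|u.1 - y| | u in G].
have ubE u : G u -> ubound E (`|u.1 + y| - u.2).
  move=> Gu _ [v Gv <-].
  have := dom _ (lin 1 _ _ Gu Gv); rewrite /= scale1r mul1r => h.
  have : `|u.1 + v.1| <= `|u.1 + y| + `|v.1 - y|.
    by rewrite (le_trans _ (ler_normD _ _))// addrACA subrr addr0.
  lra.
have sE : has_sup E.
  split; first by exists (0 - `|0 - y|), (0, 0).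
  by exists (`|0 + y| - 0); exact: (ubE (0, 0)).
exists (sup E) => u Gu; split.
- have := ge_sup sE.1 (ubE _ Gu); lra.
- have : u.2 - `|u.1 - y| <= sup E by apply: ub_le_sup; [exact: sE.2|exists u].
  lra.
Qed.

(* Hahn-Banach: extend a |-> a |x| from the line of x by Zorn's lemma on graphs. *)
Lemma exists_norming (x : Y) : exists phi : {linear Y -> R^o},
  (forall y, `|phi y| <= `|y|) /\ phi x = `|x|.
Proof.
pose L : set (Y * R) := [set (a *: x, a * `|x|) | a in setT].
(* Adjoining [L] inside [P] takes care of the empty chain in Zorn's lemma: its union is empty, yet
   the line of [x] is still present. *)
pose P : set (set (Y * R)) := [set G | dominated_graph (G `|` L)].
have domL : dominated_graph L.
  split=> [a u v [b _ <-] [d _ <-]|u [a _ <-]] /=.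
    by exists (a * b + d) => //; rewrite scalerDl scalerA mulrDl mulrA.
  by rewrite normrZ ler_wpM2r// ler_norm.
have [G [PG Gmax]] : exists G, P G /\ forall B, G `<` B -> ~ P B.
  apply: Zorn_bigcup => F FP Ftot; split=> [a u v|u].
  - have ext B w : F B -> (B `|` L) w -> ((\bigcup_(X in F) X) `|` L) w.
      by move=> FB [Bw|]; [left; exists B|right].
    move=> [[B FB Bu]|Lu] [[B' FB' Bv]|Lv].
    + have [BB'|B'B] := Ftot _ _ FB FB'.
      * by apply: (ext B') => //; apply: (FP _ FB').1; left => //; exact: BB'.
      * by apply: (ext B) => //; apply: (FP _ FB).1; left => //; exact: B'B.
    + by apply: (ext B) => //; apply: (FP _ FB).1; [left|right].
    + by apply: (ext B') => //; apply: (FP _ FB').1; [right|left].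
    + by right; exact: domL.1.
  - by move=> [[B FB Bu]|Lu]; [apply: (FP _ FB).2; left|exact: domL.2].
set H := G `|` L.
have H00 : H (0, 0) by right; exists 0 => //; rewrite scale0r mul0r.
have total y : exists r, H (y, r).
  have [c cP] := dominated_graph_sup y PG H00.
  pose H' : set (Y * R) := [set w | exists u b, H u /\ w = (u.1 + b *: y, u.2 + b * c)].
  have HH' : H `<=` H'.
    by move=> [u1 u2] Hu; exists (u1, u2), 0; split => //=; rewrite scale0r mul0r !addr0.
  have PH' : P H'.
    rewrite /P /=; have -> : H' `|` L = H'.
      apply/seteqP; split=> w; last by left.
      by move=> [//|Lw]; apply: HH'; right.
    split=> [a _ _ [u [b [Hu ->]]] [v [d [Hv ->]]]|_ [u [b [Hu ->]]]] /=.
      exists (a *: u.1 + v.1, a * u.2 + v.2), (a * b + d); split; first exact: PG.1.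
      congr (_, _) => /=; last by ring.
      by rewrite scalerDr scalerA scalerDl addrACA.
    have scal k : H (k *: u.1, k * u.2).
      by have := PG.1 k _ _ Hu H00; rewrite /= !addr0.
    (* Dividing by |b| reduces the bound to the two inequalities for [c], the sign of [b] selecting
       between y and - y. *)
    have [b0|b0|->] := ltgtP b 0; last by rewrite scale0r mul0r !addr0 PG.2.
    - have := (cP _ (scal (- b)^-1)).2 => /= h.
      have nb0 : 0 < - b by rewrite oppr_gt0.
      have -> : u.1 + b *: y = (- b) *: ((- b)^-1 *: u.1 - y).
        by rewrite scalerBr scalerA divff ?gt_eqF// scale1r scaleNr opprK.
      rewrite normrZ gtr0_norm//.
      have -> : u.2 + b * c = - b * ((- b)^-1 * u.2 - c) by field; rewrite lt_eqF.
      by rewrite ler_pM2l.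
    - have := (cP _ (scal b^-1)).1 => /= h.
      have -> : u.1 + b *: y = b *: (b^-1 *: u.1 + y).
        by rewrite scalerDr scalerA divff ?gt_eqF// scale1r.
      rewrite normrZ gtr0_norm//.
      have -> : u.2 + b * c = b * (b^-1 * u.2 + c) by field; rewrite gt_eqF.
      by rewrite ler_pM2l.
  have [yH'|] := pselect (G (y, c)); first by exists c; left.
  move=> nGy; exfalso; apply: (Gmax H') => //; split; last first.
    move=> H'G; apply: nGy; apply: H'G; exists (0, 0), 1; split => //=.
    by rewrite scale1r mul1r !add0r.
  by move=> w Gw; apply: HH'; left.
have uniq y r s : H (y, r) -> H (y, s) -> r = s.
  move=> hr hs.
  have := PG.2 _ (PG.1 (-1) _ _ hr hs); have := PG.2 _ (PG.1 (-1) _ _ hs hr) => /=.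
  by rewrite scaleN1r addNr normr0; lra.
pose phi y := projT1 (cid (total y)).
have phiH y : H (y, phi y) by exact: (projT2 (cid (total y))).
have phil : linear (phi : Y -> R^o).
  by move=> a u v; apply: (uniq _ _ _ (phiH _)); exact: (PG.1 a _ _ (phiH u) (phiH v)).
exists (linear_pack phil); split => [y|] /=.
  rewrite ler_norml (PG.2 _ (phiH y)) andbT lerNl.
  have := PG.2 _ (PG.1 (-1) _ _ (phiH y) H00) => /=.
  by rewrite !addr0 scaleN1r normrN mulN1r.
by apply: (uniq _ _ _ (phiH _)); right; exists 1 => //; rewrite scale1r mul1r.
Qed.

Lemma norming_le (x : Y) (C : R) :
  (forall phi : {linear Y -> R^o}, (forall y, `|phi y| <= `|y|) -> phi x <= C) ->
  `|x| <= C.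
Proof. by move=> h; have [phi [bd <-]] := exists_norming x; exact: h. Qed.

Lemma norming_eq (x y : Y) :
  (forall phi : {linear Y -> R^o}, (forall y, `|phi y| <= `|y|) -> phi x = phi y) ->
  x = y.
Proof.
move=> h; apply/eqP; rewrite -subr_eq0 -normr_le0; apply: norming_le => phi bd.
by rewrite linearB /= h// subrr.
Qed.

End Norming.

Section BoundedLinear.
Context {R : realType} {V W : normedModType R}.

Lemma linear_le_continuous (f : {linear V -> W}) (C : R) :
  (forall x, `|f x| <= C * `|x|) -> continuous f.
Proof.
move=> fC; apply: bounded_linear_continuous; apply/linear_boundedP.
near=> r => x; apply: (le_trans (fC x)); rewrite ler_wpM2r//.
Unshelve. all: by end_near. Qed.

Lemma continuous_linear_le (f : {linear V -> W}) : continuous f ->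
  exists2 C : R, 0 < C & forall x, `|f x| <= C * `|x|.
Proof.
move=> /linear_bounded_continuous/linear_boundedP/pinfty_ex_gt0[C C0 fC].
by exists C.
Qed.

End BoundedLinear.

Lemma cauchy_seq_cvg {R : realType} {V : completeNormedModType R} (u : nat -> V) :
  (forall e : R, 0 < e -> exists N, forall n m, (N <= n)%N -> (N <= m)%N ->
     `|u n - u m| < e) -> cvgn u.
Proof.
move=> h; apply/cauchy_cvgP/cauchy_exP => e e0; have [N hN] := h e e0.
by exists (u N); exists N => // n /= Nn; rewrite -ball_normE /=; exact: hN.
Qed.

(** * Bochner integrals *)

Section Negligible.
Context {R : realType}.
Local Notation mu := (@lebesgue_measure R).
Import HBNNSimple.
Local Open Scope ereal_scope.

(** The integrals are compared through the simple functions below [f]: multiplying one of them by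
    the indicator of ~N keeps its integral and puts it below the restricted function. *)
Let integral_nullC_ge0 (N : set R) (f : R -> \bar R) : measurable N -> mu N = 0 ->
  (forall x, 0 <= f x) -> \int[mu]_x f x = \int[mu]_x (f \_ (~` N)) x.
Proof.
move=> mN N0 f0.
have f0' x : 0 <= (f \_ (~` N)) x by rewrite patchE; case: ifPn.
rewrite !ge0_integralTE//; apply/eqP; rewrite eq_le; apply/andP; split.
- apply: ge_ereal_sup => _ [h hf <-]; apply: ereal_sup_ubound.
  exists (proj_nnsfun h (measurableC mN)) => [x|].
    rewrite /= patchE mindicE; case: ifPn => _; first by rewrite mulr1.
    by rewrite mulr0.
  rewrite -(integralT_nnsfun mu h) -integralT_nnsfun.
  rewrite [RHS](@ge0_negligible_integral _ _ _ mu _ _ _ mN)//; last 2 first.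
  + by apply/measurable_EFinP; exact: measurable_funP.
  + by move=> x _; rewrite lee_fin.
  rewrite setTD [RHS]integral_mkcond /=; apply: eq_integral => x _ /=.
  by rewrite patchE mindicE; case: ifPn => _; rewrite ?mulr1 ?mulr0.
- apply: ereal_sup_le => _ [h hf <-]; exists h => // x.
  by apply: (le_trans (hf x)); rewrite patchE; case: ifPn.
Qed.

(* The integral of a nonnegative function, measurable or not, is the supremum of
   the integrals of the simple functions below it. *)
Lemma integral_setD_null (D N : set R) (f : R -> \bar R) : measurable N -> mu N = 0 ->
  \int[mu]_(x in D) f x = \int[mu]_(x in D `\` N) f x.
Proof.
move=> mN N0; rewrite integralE [RHS]integralE.
have aux (g : R -> \bar R) : (forall x, 0 <= g x) ->
    \int[mu]_(x in D) g x = \int[mu]_(x in D `\` N) g x.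
  move=> g0; rewrite integral_mkcond (integral_nullC_ge0 mN N0); last first.
    by move=> x; rewrite patchE; case: ifPn.
  by rewrite [RHS]integral_mkcond setDE setIC patch_setI.
by rewrite !aux.
Qed.

Lemma ae_integral_eq (D : set R) (f g : R -> \bar R) :
  {ae mu, forall x, D x -> f x = g x} ->
  \int[mu]_(x in D) f x = \int[mu]_(x in D) g x.
Proof.
move=> [N [mN N0 sub]]; rewrite (integral_setD_null D f mN N0).
rewrite (integral_setD_null D g mN N0); apply: eq_integral => x.
rewrite inE => -[Dx Nx]; apply: contrapT => fg; apply: Nx; apply: sub => /= h.
by apply: fg; exact: h.
Qed.

Lemma ae_sub (P Q : R -> Prop) : (forall t, P t -> Q t) ->
  {ae mu, forall t, P t} -> {ae mu, forall t, Q t}.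
Proof.
move=> PQ [N [mN N0 sub]]; exists N; split => // t /= nQ; apply: sub => /= Pt.
by apply: nQ; exact: PQ.
Qed.

Lemma ae_sub2 (P1 P2 Q : R -> Prop) : (forall t, P1 t -> P2 t -> Q t) ->
  {ae mu, forall t, P1 t} -> {ae mu, forall t, P2 t} -> {ae mu, forall t, Q t}.
Proof.
move=> PQ [N [mN N0 sub]] [N' [mN' N0' sub']]; exists (N `|` N'); split.
- exact: measurableU.
- exact: etrans (measureU0 mN mN' N0') N0.
- move=> t /= nQ; have [P1t|] := pselect (P1 t); last by left; apply: sub.
  by right; apply: sub' => /= P2t; apply: nQ; exact: PQ.
Qed.

End Negligible.

(** * Functions with finitely many values and measurable fibres *)

Section FinSimple.
Context {R : realType}.
Local Notation mu := (@lebesgue_measure R).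

(** The codomain carries no structure: with a finite range and measurable fibres, composition with
    an arbitrary map stays in the class, so norms, functionals and kernels of simple functions are
    all covered at once. *)
Definition finite_valued (Y : Type) (g : R -> Y) : Prop :=
  finite_set (range g) /\ forall y, measurable (g @^-1` [set y]).

Lemma lebesgue_measureS (A B : set R) : measurable A -> measurable B -> A `<=` B ->
  (mu A <= mu B)%E.
Proof. by move=> mA mB AB; apply: le_measure; rewrite ?inE. Qed.

Lemma finite_valued_comp (Y Z : Type) (F : Y -> Z) (g : R -> Y) :
  finite_valued g -> finite_valued (F \o g).
Proof.
move=> [fg mg]; split; first by rewrite -(image_comp g F setT); exact: finite_image.
move=> z.
have -> : (F \o g) @^-1` [set z] =
    \bigcup_(y in range g `&` F @^-1` [set z]) g @^-1` [set y].
  apply/seteqP; split=> t /=; last by move=> [y [_ <-] ->].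
  by move=> ?; exists (g t) => //; split => //; exists t.
apply: fin_bigcup_measurable => //; exact: finite_setIl.
Qed.

Lemma finite_valued_pair (Y Z : Type) (g : R -> Y) (h : R -> Z) :
  finite_valued g -> finite_valued h -> finite_valued (fun t => (g t, h t)).
Proof.
move=> [fg mg] [fh mh]; split.
  apply: (sub_finite_set _ (finite_setX fg fh)) => _ [t _ <-].
  by split; exists t.
move=> [y z].
have -> : (fun t => (g t, h t)) @^-1` [set (y, z)] = g @^-1` [set y] `&` h @^-1` [set z].
  by apply/seteqP; split=> t /= [-> ->].
exact: measurableI.
Qed.

Lemma finite_valued_cst (Y : Type) (y : Y) : finite_valued (fun=> y).
Proof.
split; first by apply: (sub_finite_set _ (finite_set1 y)) => _ [t _ <-].
move=> z; have [->|yz] := pselect (y = z).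
  by rewrite (_ : _ @^-1` _ = setT)//; apply/seteqP; split.
by rewrite (_ : _ @^-1` _ = set0)//; apply/seteqP; split.
Qed.

Lemma finite_valued_indic (A : set R) : measurable A -> finite_valued (fun t => t \in A).
Proof.
move=> mA; split; first exact: finite_finset.
move=> [].
  rewrite (_ : _ @^-1` _ = A)//.
  by apply/seteqP; split=> t /=; rewrite ?inE// => /asboolP.
rewrite (_ : _ @^-1` _ = ~` A); first exact: measurableC.
apply/seteqP; split=> t /=; first by move=> h; move/negbT: h; rewrite notin_setE.
by move=> nA; apply/negbTE; rewrite notin_setE.
Qed.

Lemma finite_valued_measurable (g : R -> R) : finite_valued g -> measurable_fun setT g.
Proof.
move=> [fg mg] _ B mB; rewrite setTI.
have -> : g @^-1` B = \bigcup_(y in range g `&` B) g @^-1` [set y].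
  apply/seteqP; split=> t /=; last by move=> [y [_ By] ->].
  by move=> ?; exists (g t) => //; split => //; exists t.
apply: fin_bigcup_measurable => //; exact: finite_setIl.
Qed.

Context {Y : normedModType R}.

Lemma simple_fun_finite_valued (s : simple_data) : is_simple s ->
  finite_valued (simple_fun s : R -> Y).
Proof.
elim: s => [_|q s IH qs].
  rewrite (_ : simple_fun _ = fun=> 0); first exact: finite_valued_cst.
  by apply/funext => t; rewrite /simple_fun big_nil.
have -> : simple_fun (q :: s) = (fun p : bool * Y => (if p.1 then q.2 else 0) + p.2)
    \o (fun t => (t \in q.1, simple_fun s t)).
  apply/funext => t; rewrite /simple_fun big_cons /= indicE.
  by case: (t \in q.1); rewrite ?scale1r ?scale0r.
apply/finite_valued_comp/finite_valued_pair.
  by apply: finite_valued_indic; apply: (qs _ _).1; rewrite inE eqxx.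
by apply: IH => p ps; apply: qs; rewrite inE ps orbT.
Qed.

Lemma finite_valued_simple (D : set R) (g : R -> Y) : measurable D -> (mu D < +oo)%E ->
  finite_valued g -> exists s, is_simple s /\
    forall t, simple_fun s t = if t \in D then g t else 0.
Proof.
move=> mD Dfin [fg mg].
have [r0 r0P] := (finite_seqP _).1 fg.
have rP y : (y \in undup r0) = (y \in range g).
  by rewrite mem_undup r0P mem_setE.
pose s := [seq (g @^-1` [set y] `&` D, y) | y <- undup r0].
exists s; split=> [q /mapP [y _ ->] /=|t].
  split; first exact: measurableI.
  by apply: le_lt_trans Dfin; apply: lebesgue_measureS => //; exact: measurableI.
rewrite /simple_fun big_map.
have gt : g t \in undup r0 by rewrite rP inE; exists t.
rewrite (bigD1_seq (g t))//= ?undup_uniq// big1 ?addr0.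
  rewrite indicE in_setI; case: ifPn => tD.
    by rewrite (_ : t \in _ = true) ?scale1r//; apply/mem_set.
  by rewrite andbF scale0r.
move=> y yg; rewrite indicE in_setI.
rewrite (_ : t \in _ = false) ?scale0r//; apply/negbTE; rewrite notin_setE /=.
by move=> E; move: yg; rewrite E eqxx.
Qed.

(* The restriction to D `&` [-n, n] makes the supports of finite measure. *)
Lemma strongly_measurable_lim (D : set R) (g_ : nat -> R -> Y) (g : R -> Y) :
  measurable D -> (forall n, finite_valued (g_ n)) ->
  {ae mu, forall t, D t -> g_ n t @[n --> \oo] --> g t} -> strongly_measurable D g.
Proof.
move=> mD fvg cvg.
pose E n := D `&` `[- (n%:R : R), n%:R]%classic.
have mE n : measurable (E n) by apply: measurableI.
have Efin n : (mu (E n) < +oo)%E.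
  apply: (@le_lt_trans _ _ (mu `[- (n%:R : R), n%:R]%classic)).
    by apply: lebesgue_measureS; [exact: mE| |exact: subIsetr].
  rewrite lebesgue_measure_itv/=; case: ifP => // _.
  by rewrite -EFinD ltry.
have [s sP] := choice (fun n => finite_valued_simple (mE n) (Efin n) (fvg n)).
exists s; split => [n|]; first exact: (sP n).1.
apply: ae_sub cvg => t gt Dt; have := gt Dt; apply: cvg_trans.
apply: near_eq_cvg; near=> n; rewrite (sP n).2 ifT// inE; split => //=.
rewrite in_itv/= -ler_norml; near: n; exact: nbhs_infty_ger.
Unshelve. all: end_near. Qed.

End FinSimple.

(** * Integrals of simple functions and their pairing with functionals *)

Section BochnerSimple.
Context {R : realType} {Y : normedModType R}.
Local Notation mu := (@lebesgue_measure R).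

(** Convergence is required at every point of [D], which makes the norm of [g] and its functionals
    measurable on [D]. A strongly measurable function gets there after removal of a null set, which
    does not affect the integrals. *)
Definition pointwise_measurable (D : set R) (g : R -> Y) : Prop :=
  exists s : nat -> simple_data, (forall n, is_simple (s n)) /\
    forall t, D t -> simple_fun (s n) t @[n --> \oo] --> g t.

Lemma ae_limit_set (D : set R) (h : nat -> R -> Y) (g : R -> Y) :
  {ae mu, forall t, D t -> h n t @[n --> \oo] --> g t} ->
  exists N, [/\ measurable N, mu N = 0 &
    forall t, (D `\` N) t -> h n t @[n --> \oo] --> g t].
Proof.
move=> [N [mN N0 sub]]; exists N; split => // t [Dt Nt].
by apply: contrapT => h'; apply: Nt; apply: sub => /= k; apply: h'; exact: k.
Qed.

Lemma pointwise_measurable_comp (D : set R) (g : R -> Y) (F : Y -> R) :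
  pointwise_measurable D g -> continuous F -> measurable_fun D (F \o g).
Proof.
move=> [s [ss sg]] cF.
apply: (@measurable_fun_cvg _ _ _ _ (fun n => F \o simple_fun (s n))).
  move=> n; apply: (@measurable_funS _ _ _ _ setT) => //.
  by apply: finite_valued_measurable; apply: finite_valued_comp; exact: simple_fun_finite_valued.
by move=> t Dt; apply: continuous_cvg; [exact: cF|exact: sg].
Qed.

Lemma is_simple_cons (q : set R * Y) (s : simple_data) :
  is_simple (q :: s) -> [/\ measurable q.1, (mu q.1 < +oo)%E & is_simple s].
Proof.
move=> h; have [mq fq] := h q (mem_head _ _); split => // p ps.
by apply: h; rewrite inE ps orbT.
Qed.

Lemma measurable_norm_simple (D : set R) (s : simple_data) (F : Y -> R) : is_simple s ->
  measurable_fun D (fun t => (F (simple_fun s t))%:E).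
Proof.
move=> hs; apply/measurable_EFinP; apply: (@measurable_funS _ _ _ _ setT) => //.
by apply: (finite_valued_measurable (finite_valued_comp F (simple_fun_finite_valued hs))).
Qed.

Lemma integral_norm_simple (D : set R) (s : @simple_data R Y) : measurable D -> is_simple s ->
  (\int[mu]_(t in D) (`|simple_fun s t|)%:E < +oo)%E.
Proof.
move=> mD; elim: s => [_|q s IH qs].
  rewrite integral0_eq// => t _; by rewrite /simple_fun big_nil normr0.
have [mq fq hs] := is_simple_cons qs.
have mi : measurable_fun D (fun t => (\1_(q.1) t * `|q.2|)%:E : \bar R).
  by apply/measurable_EFinP; apply: measurable_funM => //; exact: measurable_indic.
apply: (@le_lt_trans _ _
    (\int[mu]_(t in D) ((\1_(q.1) t * `|q.2|)%:E + (`|simple_fun s t|)%:E))%E).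
  apply: ge0_le_integral => //.
  - exact: (measurable_norm_simple _ qs).
  - by apply: emeasurable_funD => //; exact: (measurable_norm_simple _ hs).
  - move=> t _; rewrite -EFinD lee_fin /simple_fun big_cons.
    rewrite (le_trans (ler_normD _ _))// lerD2r normrZ ger0_norm//.
rewrite ge0_integralD//; last exact: (measurable_norm_simple _ hs).
apply: lte_add_pinfty; last exact: IH.
under eq_integral do rewrite EFinM.
rewrite ge0_integralZr//; last first.
  by apply/measurable_EFinP; exact: measurable_indic.
rewrite integral_indic//; apply: lte_mul_pinfty => //; last exact: ltry.
rewrite ge0_fin_numE//; apply: le_lt_trans fq; apply: lebesgue_measureS => //; exact: measurableI.
Qed.

Lemma integrable_norm_le (D : set R) (h : R -> R) (k : R -> R) : measurable D ->
  measurable_fun D h -> measurable_fun D k -> (forall t, D t -> `|h t| <= k t) ->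
  (\int[mu]_(t in D) (k t)%:E < +oo)%E -> mu.-integrable D (EFin \o h).
Proof.
move=> mD mh mk hk kfin; apply/integrableP; split; first exact/measurable_EFinP.
apply: le_lt_trans kfin; apply: ge0_le_integral => //.
- by apply/measurable_EFinP; exact: measurableT_comp.
- exact/measurable_EFinP.
Qed.

Lemma integrable_functional_simple (D : set R) (s : simple_data) (phi : {linear Y -> R^o}) :
  (forall y, `|phi y| <= `|y|) -> measurable D -> is_simple s ->
  mu.-integrable D (EFin \o (fun t => phi (simple_fun s t))).
Proof.
move=> bd mD hs; apply: (@integrable_norm_le _ _ (fun t => `|simple_fun s t|)) => //.
- by apply/measurable_EFinP; exact: (measurable_norm_simple _ hs).
- by apply/measurable_EFinP; exact: (measurable_norm_simple _ hs).
- exact: integral_norm_simple.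
Qed.

Lemma functional_simple_integral (D : set R) (s : simple_data) (phi : {linear Y -> R^o}) :
  (forall y, `|phi y| <= `|y|) -> measurable D -> is_simple s ->
  phi (simple_integral D s) = \int[mu]_(t in D) phi (simple_fun s t).
Proof.
move=> bd mD; elim: s => [_|q s IH qs].
  rewrite /simple_integral big_nil linear0; apply/esym/eqP.
  rewrite /Rintegral integral0_eq// => t _.
  by rewrite /simple_fun big_nil linear0.
have [mq fq hs] := is_simple_cons qs.
rewrite /simple_integral big_cons linearD linearZ /= -/(simple_integral D s) IH//.
have mi : measurable_fun D (\1_(q.1) : R -> R) by exact: measurable_indic.
have I1 : mu.-integrable D (EFin \o (\1_(q.1) : R -> R)).
  apply: (@integrable_norm_le _ _ (\1_(q.1))) => //.
    by move=> t _; rewrite ger0_norm.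
  rewrite integral_indic//; apply: le_lt_trans fq.
  by apply: lebesgue_measureS => //; exact: measurableI.
rewrite (_ : (fun t => phi (simple_fun (q :: s) t)) =
    (fun t => \1_(q.1) t * phi q.2 + phi (simple_fun s t))); last first.
  by apply/funext => t; rewrite /simple_fun big_cons linearD linearZ.
rewrite RintegralD//; last 2 first.
- rewrite (_ : EFin \o _ = (fun t => (EFin \o (\1_(q.1) : R -> R)) t * (phi q.2)%:E)%E).
    exact: integrableZr.
  by apply/funext => t /=; rewrite EFinM.
- exact: integrable_functional_simple.
by rewrite RintegralZr// {2}/Rintegral integral_indic.
Qed.

Lemma simple_integral_norm_le (D : set R) (s : @simple_data R Y) (e : R) : measurable D ->
  is_simple s -> (\int[mu]_(t in D) (`|simple_fun s t|)%:E <= e%:E)%E ->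
  `|simple_integral D s| <= e.
Proof.
move=> mD hs le_e; apply: norming_le => phi bd.
rewrite functional_simple_integral//.
have I := integrable_functional_simple bd mD hs.
rewrite (le_trans (ler_norm _))// (le_trans (le_normr_Rintegral _ I))//.
rewrite -lee_fin /Rintegral fineK; last first.
  by apply: integrable_fin_num => //; exact: (integrable_norm I).
apply: le_trans le_e; apply: ge0_le_integral => //.
- exact: (measurable_norm_simple (fun y => `|phi y|) hs).
- exact: (measurable_norm_simple _ hs).
- by move=> t _; rewrite lee_fin.
Qed.

Definition sub_data (s s' : @simple_data R Y) : simple_data :=
  s ++ [seq (q.1, - q.2) | q <- s'].

Lemma sub_dataP (s s' : @simple_data R Y) : is_simple s -> is_simple s' ->
  [/\ is_simple (sub_data s s'),
      forall t, simple_fun (sub_data s s') t = simple_fun s t - simple_fun s' t &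
      forall D, simple_integral D (sub_data s s')
                = simple_integral D s - simple_integral D s'].
Proof.
move=> hs hs'; split.
- by move=> q; rewrite mem_cat => /orP[/hs//|/mapP[p /hs' ? ->]].
- move=> t; rewrite /simple_fun big_cat big_map /= -sumrN; congr +%R.
  by apply: eq_bigr => q _; rewrite scalerN.
- move=> D; rewrite /simple_integral big_cat big_map /= -sumrN; congr +%R.
  by apply: eq_bigr => q _; rewrite scalerN.
Qed.

End BochnerSimple.

Section BochnerChar.
Context {R : realType} {Y : normedModType R}.
Local Notation mu := (@lebesgue_measure R).

Local Notation functional_bound phi := (forall y, `|phi y| <= `|y|).

Lemma norm_dist_simple_measurable (D : set R) (g : R -> Y) (s : simple_data) :
  pointwise_measurable D g -> is_simple s ->
  measurable_fun D (fun t => `|g t - simple_fun s t|).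
Proof.
move=> [r [rs rg]] hs.
apply: (@measurable_fun_cvg _ _ _ _ (fun n t => `|simple_fun (r n) t - simple_fun s t|)).
  move=> n; apply: (@measurable_funS _ _ _ _ setT) => //.
  have := finite_valued_comp (fun p => `|p.1 - p.2|)
    (finite_valued_pair (simple_fun_finite_valued (rs n)) (simple_fun_finite_valued hs)).
  exact: finite_valued_measurable.
move=> t Dt; apply: cvg_norm; apply: cvgB; [exact: rg|exact: cvg_cst].
Qed.

Lemma pointwise_measurable_norm (D : set R) (g : R -> Y) :
  pointwise_measurable D g -> measurable_fun D (fun t => `|g t|).
Proof. by move=> mg; apply: (pointwise_measurable_comp mg); exact: norm_continuous. Qed.

Lemma Rintegral_dist_le (D : set R) (h k w : R -> R) : measurable D ->
  mu.-integrable D (EFin \o h) -> mu.-integrable D (EFin \o k) -> measurable_fun D w ->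
  (forall t, D t -> `|h t - k t| <= w t) -> (\int[mu]_(t in D) (w t)%:E < +oo)%E ->
  `|\int[mu]_(t in D) h t - \int[mu]_(t in D) k t| <= fine (\int[mu]_(t in D) (w t)%:E).
Proof.
move=> mD Ih Ik mw hkw wfin; rewrite -RintegralB//.
have mhk : measurable_fun D (fun t => h t - k t).
  by apply: measurable_funB; [case/integrableP: Ih|case/integrableP: Ik] => /measurable_EFinP.
have Ihk := integrable_norm_le mD mhk mw hkw wfin.
have := @le_normr_Rintegral _ _ _ mu D _ mD Ihk; move/le_trans; apply.
have le_w : (\int[mu]_(t in D) (`|h t - k t|)%:E <= \int[mu]_(t in D) (w t)%:E)%E.
  apply: ge0_le_integral => //.
  - by apply/measurable_EFinP; exact: measurableT_comp.
  - exact/measurable_EFinP.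
rewrite /Rintegral; apply: fine_le => //.
- by rewrite ge0_fin_numE ?integral_ge0//; exact: le_lt_trans wfin.
- rewrite ge0_fin_numE//; apply: le_trans le_w; exact: integral_ge0.
Qed.

Lemma integrable_functional (D : set R) (g : R -> Y) (phi : {linear Y -> R^o}) :
  functional_bound phi -> measurable D -> pointwise_measurable D g ->
  (\int[mu]_(t in D) (`|g t|)%:E < +oo)%E -> mu.-integrable D (EFin \o (fun t => phi (g t))).
Proof.
move=> bd mD mg fg; apply: (@integrable_norm_le _ _ _ (fun t => `|g t|)) => //.
- apply: (pointwise_measurable_comp mg).
  by apply: (@linear_le_continuous _ _ R^o phi 1) => x; rewrite mul1r.
- exact: pointwise_measurable_norm.
Qed.

(** For phi of norm at most one, phi of a simple integral and the integral of phi o g differ by at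
    most the L^1 distance of the approximant to [g], so the two limits agree. *)
Lemma is_bochner_integral_functional (D : set R) (g : R -> Y) (v : Y) : measurable D ->
  is_bochner_integral D g v ->
  [/\ strongly_measurable D g, (\int[mu]_(t in D) (`|g t|)%:E < +oo)%E &
    forall phi : {linear Y -> R^o}, functional_bound phi ->
      phi v = \int[mu]_(t in D) phi (g t)].
Proof.
move=> mD [s [[ss sg] s0 sv]].
have [N [mN N0 sgN]] := ae_limit_set sg.
have mD' : measurable (D `\` N) by exact: measurableD.
have mg : pointwise_measurable (D `\` N) g by exists s.
have s0' : (\int[mu]_(t in D `\` N) (`|g t - simple_fun (s n) t|)%:E)%E @[n --> \oo] --> 0%E.
  by under eq_fun do rewrite -(integral_setD_null D _ mN N0).
have mgs n : measurable_fun (D `\` N) (fun t => (`|g t - simple_fun (s n) t|)%:E).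
  by apply/measurable_EFinP; exact: norm_dist_simple_measurable.
have mng : measurable_fun (D `\` N) (fun t => (`|g t|)%:E).
  by apply/measurable_EFinP; exact: pointwise_measurable_norm.
have fg : (\int[mu]_(t in D `\` N) (`|g t|)%:E < +oo)%E.
  (* One approximant at L^1 distance below 1, itself integrable, suffices to make the norm of [g]
     integrable. *)
  have [n n1] : exists n, (\int[mu]_(t in D `\` N) (`|g t - simple_fun (s n) t|)%:E < 1)%E.
    have /fine_cvgP[fin /cvgrPdist_lt/(_ 1 ltr01) near1] := s0'.
    near \oo => n; exists n.
    have fn : (\int[mu]_(t in D `\` N) (`|g t - simple_fun (s n) t|)%:E)%E \is a fin_num.
      by near: n.
    rewrite -(fineK fn) lte_fin.
    have : `|0 - fine (\int[mu]_(t in D `\` N) (`|g t - simple_fun (s n) t|)%:E)%E| < 1.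
      by near: n.
    rewrite sub0r normrN; apply: le_lt_trans; exact: ler_norm.
  apply: (@le_lt_trans _ _ (\int[mu]_(t in D `\` N)
      ((`|g t - simple_fun (s n) t|)%:E + (`|simple_fun (s n) t|)%:E))%E).
    apply: ge0_le_integral => //.
    - by apply: emeasurable_funD; [exact: mgs|exact: (measurable_norm_simple _ (ss n))].
    - move=> t _; rewrite -EFinD lee_fin -{1}(subrK (simple_fun (s n) t) (g t)).
      exact: ler_normD.
  rewrite ge0_integralD//; [|exact: mgs|exact: (measurable_norm_simple _ (ss n))].
  apply: lte_add_pinfty; last exact: integral_norm_simple.
  by apply: (lt_trans n1); exact: ltry.
split => [||phi bd]; first by exists s.
  by rewrite (integral_setD_null D _ mN N0).
have Ig := integrable_functional bd mD' mg fg.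
have c1 : phi (simple_integral D (s n)) @[n --> \oo] --> phi v.
  apply: continuous_cvg => //.
  by apply: (@linear_le_continuous _ _ R^o phi 1) => x; rewrite mul1r.
suff c2 : phi (simple_integral D (s n)) @[n --> \oo] --> \int[mu]_(t in D) phi (g t).
  exact: (cvg_unique _ c1 c2).
apply/cvgrPdist_lt => e e0.
have /fine_cvgP[fin /cvgrPdist_lt/(_ e e0) near1] := s0'.
near=> n.
have fn : (\int[mu]_(t in D `\` N) (`|g t - simple_fun (s n) t|)%:E)%E \is a fin_num.
  by near: n.
have Is := integrable_functional_simple bd mD' (ss n).
rewrite functional_simple_integral// /Rintegral !(integral_setD_null D _ mN N0).
apply: (le_lt_trans (Rintegral_dist_le mD' Ig Is (norm_dist_simple_measurable mg (ss n)) _ _)).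
- by move=> t _; rewrite -linearB.
- by rewrite -ge0_fin_numE ?integral_ge0.
have : `|0 - fine (\int[mu]_(t in D `\` N) (`|g t - simple_fun (s n) t|)%:E)%E| < e.
  by near: n.
by rewrite sub0r normrN; apply: le_lt_trans; exact: ler_norm.
Unshelve. all: end_near. Qed.

End BochnerChar.

(** * Existence of the Bochner integral by truncation *)

Section BochnerExists.
Context {R : realType} {Y : completeNormedModType R}.
Local Notation mu := (@lebesgue_measure R).

(** Keeping an approximant only where its norm is at most 2|g| bounds its distance to g by 3|g|. The
    factor 2 leaves room, so that the cut becomes inactive at every point where g is nonzero. *)
Let truncated (D : set R) (g : R -> Y) (s : @simple_data R Y) : set R :=
  D `&` [set t | `|simple_fun s t| <= 2 * `|g t|].

Let truncated_data (A : set R) (s : @simple_data R Y) : simple_data :=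
  [seq (q.1 `&` A, q.2) | q <- s].

Let truncated_dataP (A : set R) (s : simple_data) : measurable A -> is_simple s ->
  is_simple (truncated_data A s) /\
  forall t, simple_fun (truncated_data A s) t = if t \in A then simple_fun s t else 0.
Proof.
move=> mA hs; split=> [_ /mapP[q /hs[mq fq] ->] /=|t].
  split; first exact: measurableI.
  by apply: le_lt_trans fq; apply: lebesgue_measureS => //; exact: measurableI.
rewrite /simple_fun big_map /=; case: ifPn => tA.
  by apply: eq_bigr => q _; rewrite !indicE in_setI tA andbT.
by rewrite big1// => q _; rewrite indicE in_setI (negbTE tA) andbF scale0r.
Qed.

Let measurable_truncated (D : set R) (g : R -> Y) (s : simple_data) : measurable D ->
  pointwise_measurable D g -> is_simple s -> measurable (truncated D g s).
Proof.
move=> mD mg hs.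
have m1 : measurable_fun D (fun t => `|simple_fun s t|).
  by apply/measurable_EFinP; exact: (measurable_norm_simple _ hs).
have m2 : measurable_fun D (fun t => 2 * `|g t|).
  by apply: measurable_funM => //; exact: pointwise_measurable_norm.
have := measurable_fun_ler m1 m2 mD (I : measurable [set true]).
by congr measurable; apply/seteqP; split=> t [].
Qed.

Lemma bochner_integral_exists_pointwise (D : set R) (g : R -> Y) : measurable D ->
  pointwise_measurable D g -> (\int[mu]_(t in D) (`|g t|)%:E < +oo)%E ->
  exists v, is_bochner_integral D g v.
Proof.
move=> mD mg fg; have [s [ss sg]] := mg.
pose A n := truncated D g (s n).
have mA n : measurable (A n) by exact: measurable_truncated.
pose s' n := truncated_data (A n) (s n).
have s'P n := truncated_dataP (mA n) (ss n).
have s's n : is_simple (s' n) := (s'P n).1.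
have s'le n t : D t -> `|simple_fun (s' n) t| <= 2 * `|g t|.
  move=> Dt; rewrite (s'P n).2; case: ifPn => [/set_mem[]//|_].
  by rewrite normr0 mulr_ge0.
have s'g t : D t -> simple_fun (s' n) t @[n --> \oo] --> g t.
  (* Where [g] vanishes, the truncation forces the approximants to vanish; elsewhere |s_n| <= 2|g|
     as soon as |g - s_n| < |g|. *)
  move=> Dt; have [g0|g0] := eqVneq (g t) 0.
    rewrite (_ : (fun n => _) = fun=> 0) ?g0; first exact: cvg_cst.
    apply/funext => n; apply/eqP; rewrite -normr_le0.
    by have := s'le n t Dt; rewrite g0 normr0 mulr0.
  have := sg t Dt; apply: cvg_trans; apply: near_eq_cvg; near=> n.
  rewrite (s'P n).2 ifT//; apply/mem_set; split => //=.
  have : `|g t - simple_fun (s n) t| < `|g t|.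
    near: n; move/cvgrPdist_lt: (sg t Dt); apply.
    by rewrite normr_gt0.
  have := ler_normD (simple_fun (s n) t - g t) (g t).
  rewrite subrK distrC; lra.
have m3 n : measurable_fun D (fun t => (`|g t - simple_fun (s' n) t|)%:E).
  by apply/measurable_EFinP; exact: norm_dist_simple_measurable.
have dist0 : (\int[mu]_(t in D) (`|g t - simple_fun (s' n) t|)%:E)%E @[n --> \oo] --> 0%E.
  have mng : measurable_fun D (fun t => `|g t|) by exact: pointwise_measurable_norm.
  have I3 : mu.-integrable D (EFin \o (fun t => 3 * `|g t|)).
    rewrite (_ : EFin \o _ = (fun t => 3%:E * (EFin \o (fun t => `|g t|%R)) t)%E)//.
    apply: integrableZl => //; apply: (@integrable_norm_le _ _ _ (fun t => `|g t|)) => //.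
    by move=> t _; rewrite normr_id.
  have [] := @dominated_convergence _ _ _ mu D mD
    (fun n t => (`|g t - simple_fun (s' n) t|)%:E) (fun=> 0%E) _ m3 _ _ I3 _.
  - exact: measurable_cst.
  - apply: aeW => t Dt; apply/fine_cvgP; split; first exact: nearW.
    rewrite -(normr0 Y) -(subrr (g t)); apply: cvg_norm; apply: cvgB => //; first exact: cvg_cst.
    exact: s'g.
  - apply: aeW => t n Dt; rewrite /= lee_fin normr_id.
    rewrite (le_trans (ler_normB _ _))//; have := s'le n t Dt; lra.
  - by move=> _ _; rewrite integral0.
suff : cvgn (fun n => simple_integral D (s' n)).
  move=> /cvg_ex[v hv]; exists v, s'; split => //; split => //.
  exact: aeW.
apply: cauchy_seq_cvg => e e0.
have e2 : 0 < e / 2 by rewrite divr_gt0.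
have e4 : 0 < e / 4 by rewrite divr_gt0.
have /fine_cvgP[fin /cvgrPdist_lt/(_ _ e4) near1] := dist0.
have [N _ hN] : \forall n \near \oo,
    (\int[mu]_(t in D) (`|g t - simple_fun (s' n) t|)%:E < (e / 4)%:E)%E.
  near=> n.
  have fn : (\int[mu]_(t in D) (`|g t - simple_fun (s' n) t|)%:E)%E \is a fin_num by near: n.
  rewrite -(fineK fn) lte_fin.
  have : `|0 - fine (\int[mu]_(t in D) (`|g t - simple_fun (s' n) t|)%:E)%E| < e / 4 by near: n.
  by rewrite sub0r normrN; apply: le_lt_trans; exact: ler_norm.
exists N => n m Nn Nm; apply: (@le_lt_trans _ _ (e / 2)); last lra.
have [hsub sfE <-] := sub_dataP (s's n) (s's m).
apply: simple_integral_norm_le => //.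
apply: (@le_trans _ _ (\int[mu]_(t in D)
  ((`|g t - simple_fun (s' n) t|)%:E + (`|g t - simple_fun (s' m) t|)%:E))%E).
  apply: ge0_le_integral => //.
  - exact: (measurable_norm_simple _ hsub).
  - by apply: emeasurable_funD; exact: m3.
  - move=> t _; rewrite -EFinD lee_fin sfE.
    by rewrite (distrC (g t) (simple_fun (s' n) t)) ler_distD.
rewrite ge0_integralD//; [|exact: m3|exact: m3].
have -> : (e / 2)%:E = ((e / 4)%:E + (e / 4)%:E)%E by rewrite -EFinD; congr EFin; lra.
by apply: leeD; apply: ltW; apply: hN.
Unshelve. all: end_near. Qed.

End BochnerExists.

Section BochnerTheory.
Context {R : realType} {Y : completeNormedModType R}.
Local Notation mu := (@lebesgue_measure R).

Lemma strongly_measurableS (V : normedModType R) (D D' : set R) (g : R -> V) : D' `<=` D ->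
  strongly_measurable D g -> strongly_measurable D' g.
Proof. by move=> DD' [s [ss sg]]; exists s; split => //; apply: ae_sub sg => t h /DD'. Qed.

Lemma strongly_measurable_ae (V : normedModType R) (D : set R) (g g' : R -> V) :
  {ae mu, forall t, D t -> g t = g' t} ->
  strongly_measurable D g -> strongly_measurable D g'.
Proof.
move=> gg' [s [ss sg]]; exists s; split => //.
by apply: ae_sub2 gg' sg => t h1 h2 Dt; rewrite -h1//; exact: h2.
Qed.

Lemma ae_exceptional_set (P : R -> Prop) : {ae mu, forall t, P t} ->
  exists N, [/\ measurable N, mu N = 0 & forall t, ~ N t -> P t].
Proof.
move=> [N [mN N0 sub]]; exists N; split => // t Nt; apply: contrapT => h.
by apply: Nt; exact: sub.
Qed.

Lemma strongly_measurable_pointwise (V : normedModType R) (D : set R) (g : R -> V) (P : R -> Prop) :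
  strongly_measurable D g -> {ae mu, forall t, P t} ->
  exists N, [/\ measurable N, mu N = 0, pointwise_measurable (D `\` N) g &
    forall t, ~ N t -> P t].
Proof.
move=> [s [ss sg]] aP.
have [N [mN N0 hN]] : exists N, [/\ measurable N, mu N = 0 &
    forall t, ~ N t -> (D t -> simple_fun (s n) t @[n --> \oo] --> g t) /\ P t].
  by apply: ae_exceptional_set; exact: ae_sub2 sg aP.
exists N; split => //; last by move=> t /hN[].
by exists s; split => // t [Dt /hN[h _]]; exact: h.
Qed.

Lemma norm_integral_le (V : normedModType R) (D : set R) (g : R -> V) (h : R -> R) :
  measurable D -> strongly_measurable D g -> measurable_fun D h ->
  {ae mu, forall t, D t -> `|g t| <= h t} ->
  (\int[mu]_(t in D) (`|g t|)%:E <= \int[mu]_(t in D) (h t)%:E)%E.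
Proof.
move=> mD mg mh gh; have [N [mN N0 mg' gh']] := strongly_measurable_pointwise mg gh.
rewrite !(integral_setD_null D _ mN N0); apply: ge0_le_integral => //.
- exact: measurableD.
- by apply/measurable_EFinP; exact: pointwise_measurable_norm.
- apply/measurable_EFinP; apply: measurable_funS mh => //; exact: subDsetl.
- by move=> t [Dt Nt]; rewrite lee_fin gh'.
Qed.

(** Integrals can then be identified without exhibiting approximants. For the converse, the
    existence result off a null set yields an integral v', and v' = v because functionals of norm at
    most one do not separate them. *)
Lemma is_bochner_integralP (D : set R) (g : R -> Y) (v : Y) : measurable D ->
  is_bochner_integral D g v <->
  [/\ strongly_measurable D g, (\int[mu]_(t in D) (`|g t|)%:E < +oo)%E &
    forall phi : {linear Y -> R^o}, (forall y, `|phi y| <= `|y|) ->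
      phi v = \int[mu]_(t in D) phi (g t)].
Proof.
move=> mD; split; first exact: is_bochner_integral_functional.
move=> [mg fg gv].
have [N [mN N0 mg' _]] := strongly_measurable_pointwise mg (aeW mu (fun t => Logic.I)).
have mD' : measurable (D `\` N) by exact: measurableD.
have [|v' [s [[ss sg] s0 sv]]] := bochner_integral_exists_pointwise mD' mg'.
  by rewrite -integral_setD_null.
have bv' : is_bochner_integral D g v'.
  exists s; split.
  - split => //; have aN : {ae mu, forall t, ~ N t}.
      by exists N; split => // t /= /contrapT.
    by apply: ae_sub2 sg aN => t h Nt Dt; apply: h.
  - by under eq_fun do rewrite (integral_setD_null D _ mN N0).
  - rewrite (_ : (fun n => _) = (fun n => simple_integral (D `\` N) (s n)))//.
    apply/funext => n; apply: norming_eq => phi bd.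
    by rewrite !functional_simple_integral// /Rintegral (integral_setD_null D _ mN N0).
have [_ _ gv'] := is_bochner_integral_functional mD bv'.
by rewrite (_ : v = v')//; apply: norming_eq => phi bd; rewrite gv// gv'.
Qed.

Lemma is_bochner_integral_uniq (D : set R) (g : R -> Y) (v v' : Y) : measurable D ->
  is_bochner_integral D g v -> is_bochner_integral D g v' -> v = v'.
Proof.
move=> mD /(is_bochner_integralP _ _ mD)[_ _ h] /(is_bochner_integralP _ _ mD)[_ _ h'].
by apply: norming_eq => phi bd; rewrite h// h'.
Qed.

Lemma is_bochner_integralE (D : set R) (g : R -> Y) (v : Y) : measurable D ->
  is_bochner_integral D g v -> bochner_integral D g = v.
Proof.
move=> mD bv; apply: (is_bochner_integral_uniq mD _ bv).
by apply: (xgetPex 0); exists v.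
Qed.

Lemma bochner_integralP (D : set R) (g : R -> Y) : measurable D -> bochner_integrable D g ->
  is_bochner_integral D g (bochner_integral D g).
Proof. by move=> mD [v bv]; rewrite (is_bochner_integralE mD bv). Qed.

Lemma is_bochner_integral_ae (D : set R) (g g' : R -> Y) (v : Y) : measurable D ->
  {ae mu, forall t, D t -> g t = g' t} ->
  is_bochner_integral D g v -> is_bochner_integral D g' v.
Proof.
move=> mD gg' /(is_bochner_integralP _ _ mD)[mg fg gv]; apply/is_bochner_integralP => //; split.
- exact: strongly_measurable_ae mg.
- rewrite (ae_integral_eq (g := fun t => (`|g t|)%:E))//.
  by apply: ae_sub gg' => t h Dt; rewrite h.
- move=> phi bd; rewrite gv// /Rintegral (ae_integral_eq (g := fun t => (phi (g' t))%:E))//.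
  by apply: ae_sub gg' => t h Dt; rewrite h.
Qed.

Lemma bochner_integrable_le (D : set R) (g : R -> Y) (h : R -> R) : measurable D ->
  strongly_measurable D g -> measurable_fun D h ->
  {ae mu, forall t, D t -> `|g t| <= h t} -> (\int[mu]_(t in D) (h t)%:E < +oo)%E ->
  bochner_integrable D g.
Proof.
move=> mD mg mh gh hfin.
have [N [mN N0 mg' _]] := strongly_measurable_pointwise mg (aeW mu (fun t => Logic.I)).
have mD' : measurable (D `\` N) by exact: measurableD.
have fg : (\int[mu]_(t in D) (`|g t|)%:E < +oo)%E.
  exact: le_lt_trans (norm_integral_le mD mg mh gh) hfin.
have [|v bv] := bochner_integral_exists_pointwise mD' mg'.
  by rewrite -integral_setD_null.
have [_ _ gv] := is_bochner_integral_functional mD' bv.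
exists v; apply/is_bochner_integralP => //; split => // phi bd.
by rewrite gv// /Rintegral -(integral_setD_null D _ mN N0).
Qed.

(** Dividing by |C| + 1, which is positive whatever C is, reduces to a functional of norm at most
    one. *)
Lemma is_bochner_integral_functionalC (D : set R) (g : R -> Y) (v : Y)
    (phi : {linear Y -> R^o}) (C : R) : measurable D -> (forall y, `|phi y| <= C * `|y|) ->
  is_bochner_integral D g v ->
  phi v = \int[mu]_(t in D) phi (g t).
Proof.
move=> mD bd /(is_bochner_integralP _ _ mD)[mg fg gv].
have C1 : 0 < `|C| + 1 by rewrite ltr_wpDl.
pose k := (`|C| + 1)^-1.
have lin : linear (fun y => k * phi y : R^o).
  by move=> a x y; rewrite linearP /= mulrDr; congr +%R; rewrite /GRing.scale /=; ring.
pose psi := linear_pack lin.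
have psibd y : `|psi y| <= `|y|.
  rewrite /= normrM gtr0_norm ?invr_gt0// ler_pdivrMl//.
  apply: (le_trans (bd y)); apply: ler_wpM2r => //.
  by rewrite (le_trans (ler_norm _))// lerDl.
have kE y : phi y = (`|C| + 1) * psi y by rewrite /= mulrA divff ?gt_eqF// mul1r.
have [N [mN N0 mg' _]] := strongly_measurable_pointwise mg (aeW mu (fun t => Logic.I)).
have mD' : measurable (D `\` N) by exact: measurableD.
rewrite kE gv// /Rintegral !(integral_setD_null D _ mN N0).
rewrite -/(Rintegral mu (D `\` N) (fun t => psi (g t))) -/(Rintegral mu (D `\` N) (fun t => phi (g t))).
rewrite -RintegralZl//; last first.
  by apply: integrable_functional => //; rewrite -integral_setD_null.
by apply: eq_Rintegral => t _; rewrite kE.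
Qed.

Lemma is_bochner_integral_norm_le (D : set R) (g : R -> Y) (v : Y) (c : R) : measurable D ->
  is_bochner_integral D g v -> (\int[mu]_(t in D) (`|g t|)%:E <= c%:E)%E -> `|v| <= c.
Proof.
move=> mD /(is_bochner_integralP _ _ mD)[mg fg gv] gc.
apply: norming_le => phi bd; rewrite gv//.
have [N [mN N0 mg' _]] := strongly_measurable_pointwise mg (aeW mu (fun t => Logic.I)).
have mD' : measurable (D `\` N) by exact: measurableD.
rewrite (integral_setD_null D _ mN N0) in fg gc.
rewrite /Rintegral (integral_setD_null D _ mN N0).
rewrite -/(Rintegral mu (D `\` N) (fun t => phi (g t))).
have Ig := integrable_functional bd mD' mg' fg.
have I0 : mu.-integrable (D `\` N) (EFin \o (fun=> 0)) by exact: integrable0.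
have := Rintegral_dist_le mD' Ig I0 (pointwise_measurable_norm mg') _ fg.
rewrite {2}/Rintegral integral0 subr0 => h.
rewrite (le_trans (ler_norm _))// (le_trans (h _))//.
  by move=> t _; rewrite subr0.
rewrite -lee_fin fineK//; first by rewrite ge0_fin_numE ?integral_ge0.
Qed.

Lemma strongly_measurable_lin (V : normedModType R) (D : set R) (g g' : R -> V) (a : R) :
  strongly_measurable D g -> strongly_measurable D g' ->
  strongly_measurable D (fun t => a *: g t + g' t).
Proof.
move=> [s [ss sg]] [s' [ss' sg']].
exists (fun n => [seq (q.1, a *: q.2) | q <- s n] ++ s' n); split => [n q|].
  by rewrite mem_cat => /orP[/mapP[p /ss ? ->]//|/ss'].
apply: ae_sub2 sg sg' => t h h' Dt.
rewrite (_ : (fun n => _) = (fun n => a *: simple_fun (s n) t + simple_fun (s' n) t)).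
  by apply: cvgD; [apply: cvgZr; exact: h|exact: h'].
apply/funext => n; rewrite /simple_fun big_cat big_map scaler_sumr /=.
by congr +%R; apply: eq_bigr => q _; rewrite !scalerA mulrC.
Qed.

Lemma is_bochner_integral_lin (D : set R) (g g' : R -> Y) (v v' : Y) (a : R) : measurable D ->
  is_bochner_integral D g v -> is_bochner_integral D g' v' ->
  is_bochner_integral D (fun t => a *: g t + g' t) (a *: v + v').
Proof.
move=> mD /(is_bochner_integralP _ _ mD)[mg fg gv].
move=> /(is_bochner_integralP _ _ mD)[mg' fg' gv'].
have mgg := strongly_measurable_lin a mg mg'.
(* One null set must serve g, g' and their combination. N1, N2, N3 are taken nested, each containing
   the previous one, so that N3 serves all three. *)
have [N [mN N0 mgN [mg'N mggN]]] : exists N, [/\ measurable N, mu N = 0,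
   pointwise_measurable (D `\` N) g & pointwise_measurable (D `\` N) g' /\
   pointwise_measurable (D `\` N) (fun t => a *: g t + g' t)].
  have [N1 [mN1 N10 p1 _]] := strongly_measurable_pointwise mg (aeW mu (fun t => Logic.I)).
  have aN1 : {ae mu, forall t, ~ N1 t} by exists N1; split => // t /= /contrapT.
  have [N2 [mN2 N20 p2 sub2]] := strongly_measurable_pointwise mg' aN1.
  have aN2 : {ae mu, forall t, ~ N2 t} by exists N2; split => // t /= /contrapT.
  have [N3 [mN3 N30 p3 sub3]] := strongly_measurable_pointwise mgg aN2.
  exists N3; split => //; last split => //.
  - move: p1 => [q [qs qg]]; exists q; split => // t [Dt Nt]; apply: qg; split => //.
    exact/sub2/sub3.
  - move: p2 => [q [qs qg]]; exists q; split => // t [Dt Nt]; apply: qg; split => //.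
    exact/sub3.
have mD' : measurable (D `\` N) by exact: measurableD.
rewrite (integral_setD_null D _ mN N0) in fg.
rewrite (integral_setD_null D _ mN N0) in fg'.
have mn := pointwise_measurable_norm mgN; have mn' := pointwise_measurable_norm mg'N.
apply/is_bochner_integralP => //; split => //.
- rewrite (integral_setD_null D _ mN N0).
  apply: (@le_lt_trans _ _ (\int[mu]_(t in D `\` N)
    ((`|a|)%:E * (`|g t|)%:E + (`|g' t|)%:E))%E).
    apply: ge0_le_integral => //.
    + by apply/measurable_EFinP; exact: pointwise_measurable_norm.
    + by apply: emeasurable_funD; [apply: measurable_funeM|]; exact/measurable_EFinP.
    + by move=> t _; rewrite -EFinM -EFinD lee_fin -normrZ ler_normD.
  rewrite ge0_integralD//; last 2 first.
  + by apply: measurable_funeM; exact/measurable_EFinP.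
  + exact/measurable_EFinP.
  apply: lte_add_pinfty => //.
  rewrite ge0_integralZl//; last exact/measurable_EFinP.
  by apply: lte_mul_pinfty => //; rewrite ge0_fin_numE// integral_ge0.
- move=> phi bd; rewrite linearP /= gv// gv'// /Rintegral !(integral_setD_null D _ mN N0).
  rewrite -/(Rintegral mu (D `\` N) (fun t => phi (g t))).
  rewrite -/(Rintegral mu (D `\` N) (fun t => phi (g' t))).
  rewrite -/(Rintegral mu (D `\` N) (fun t => phi (a *: g t + g' t))).
  have I1 := integrable_functional bd mD' mgN fg.
  have I2 := integrable_functional bd mD' mg'N fg'.
  rewrite /GRing.scale /= -RintegralZl// -RintegralD//; last first.
    rewrite (_ : EFin \o _ = (fun t => a%:E * (EFin \o (fun t => phi (g t))) t)%E)//.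
    exact: integrableZl.
  by apply: eq_Rintegral => t _; rewrite linearP.
Qed.

End BochnerTheory.

Section BochnerMore.
Context {R : realType} {Y : completeNormedModType R}.
Local Notation mu := (@lebesgue_measure R).

Lemma is_bochner_integral_linear (Z : completeNormedModType R) (L : {linear Y -> Z})
    (D : set R) (g : R -> Y) (v : Y) : measurable D -> continuous L ->
  is_bochner_integral D g v -> is_bochner_integral D (fun t => L (g t)) (L v).
Proof.
move=> mD cL bv; have [C C0 LC] := continuous_linear_le cL.
have [mg fg _] := (is_bochner_integralP g v mD).1 bv.
have mLg : strongly_measurable D (fun t => L (g t)).
  move: mg => [s [ss sg]]; exists (fun n => [seq (q.1, L q.2) | q <- s n]); split.
    by move=> n q /mapP[p /ss ? ->].
  apply: ae_sub sg => t h Dt.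
  rewrite (_ : (fun n => _) = (fun n => L (simple_fun (s n) t))).
    by apply: continuous_cvg; [exact: cL|exact: h].
  apply/funext => n; rewrite /simple_fun big_map linear_sum /=.
  by apply: eq_bigr => q _; rewrite linearZ.
apply/is_bochner_integralP => //; split => //.
- have [N [mN N0 mg' _]] := strongly_measurable_pointwise mg (aeW mu (fun t => Logic.I)).
  have mn := pointwise_measurable_norm mg'.
  have mD' : measurable (D `\` N) by exact: measurableD.
  rewrite (integral_setD_null D _ mN N0); rewrite (integral_setD_null D _ mN N0) in fg.
  apply: (@le_lt_trans _ _ (\int[mu]_(t in D `\` N) (C * `|g t|)%:E)%E).
    apply: norm_integral_le => //; [|exact: measurable_funM|exact: aeW].
    by apply: strongly_measurableS mLg; exact: subDsetl.
  under eq_integral do rewrite EFinM.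
  rewrite ge0_integralZl//; [|exact/measurable_EFinP|by rewrite lee_fin ltW].
  by apply: lte_mul_pinfty => //; rewrite ?lee_fin ?ltW// ge0_fin_numE// integral_ge0.
- move=> phi bd.
  (* phi o L is bounded by C rather than by 1, hence the rescaled form of the pairing. *)
  have lin : linear (fun y => phi (L y) : R^o) by move=> a x y; rewrite !linearP.
  apply: (is_bochner_integral_functionalC (phi := linear_pack lin) (C := C)) => //= y.
  exact: le_trans (bd _) (LC _).
Qed.

Lemma bochner_integrableS (D D' : set R) (g : R -> Y) : measurable D -> measurable D' ->
  D' `<=` D -> bochner_integrable D g -> bochner_integrable D' g.
Proof.
move=> mD mD' sub [v /(is_bochner_integralP _ _ mD)[mg fg _]].
have [N [mN N0 mg' _]] := strongly_measurable_pointwise mg (aeW mu (fun t => Logic.I)).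
have mn := pointwise_measurable_norm mg'.
have mgN : {ae mu, forall t, ~ N t} by exists N; split => // t /= /contrapT.
rewrite (integral_setD_null D _ mN N0) in fg.
have [w bw] : bochner_integrable (D' `\` N) g.
  apply: (bochner_integrable_le (h := fun t => `|g t|)).
  - exact: measurableD.
  - by apply: strongly_measurableS mg => t [/sub].
  - apply: measurable_funS mn; first exact: measurableD.
    by move=> t [/sub].
  - exact: aeW.
  - apply: le_lt_trans fg; apply: ge0_subset_integral => //.
    + exact: measurableD.
    + exact: measurableD.
    + exact/measurable_EFinP.
    + by move=> t [/sub].
exists w; have mD'N : measurable (D' `\` N) by exact: measurableD.
have [_ fw gw] := (is_bochner_integralP _ _ mD'N).1 bw.
apply/is_bochner_integralP => //; split.
- exact: strongly_measurableS mg.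
- by rewrite (integral_setD_null D' _ mN N0).
- by move=> phi bd; rewrite gw// /Rintegral [in RHS](integral_setD_null D' _ mN N0).
Qed.

Lemma is_bochner_integralU (D1 D2 : set R) (g : R -> Y) (v1 v2 w : Y) :
  measurable D1 -> measurable D2 -> [disjoint D1 & D2] ->
  is_bochner_integral D1 g v1 -> is_bochner_integral D2 g v2 ->
  is_bochner_integral (D1 `|` D2) g w -> w = v1 + v2.
Proof.
move=> mD1 mD2 dis b1 b2 bw.
have mD : measurable (D1 `|` D2) by exact: measurableU.
have [mg fg gw] := (is_bochner_integralP _ _ mD).1 bw.
have [_ _ g1] := (is_bochner_integralP _ _ mD1).1 b1.
have [_ _ g2] := (is_bochner_integralP _ _ mD2).1 b2.
have [N [mN N0 mg' _]] := strongly_measurable_pointwise mg (aeW mu (fun t => Logic.I)).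
rewrite (integral_setD_null (D1 `|` D2) _ mN N0) in fg.
apply: norming_eq => phi bd; rewrite linearD /= gw// g1// g2//.
have Ig := integrable_functional bd (measurableD mD mN) mg' fg.
rewrite /Rintegral (integral_setD_null (D1 `|` D2) _ mN N0) (integral_setD_null D1 _ mN N0).
rewrite (integral_setD_null D2 _ mN N0).
rewrite -/(Rintegral mu (D1 `\` N) (fun t => phi (g t))).
rewrite -/(Rintegral mu (D2 `\` N) (fun t => phi (g t))).
rewrite setDUl in Ig *.
rewrite -/(Rintegral mu _ (fun t => phi (g t))) Rintegral_setU//.
- exact: measurableD.
- exact: measurableD.
- rewrite disj_set2E; apply/eqP; rewrite -subset0 => t [[t1 _] [t2 _]].
  by move: dis; rewrite disj_set2E => /eqP E; have : (D1 `&` D2) t by []; rewrite E.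
Qed.

End BochnerMore.

(** * Discretised time and measurability of composed functions *)

Section Step.
Context {R : realType}.
Local Notation mu := (@lebesgue_measure R).

(** Time is rounded down to the grid of mesh 1/(n+1), so for s >= 0 the value stays in [0, s] and a
    kernel taken at t - step n s keeps a nonnegative argument when s <= t. The cutoff at n makes the
    range finite. *)
Definition step (n : nat) (t : R) : R :=
  if t \in `[0, n%:R]%classic then (Num.truncn (t * n.+1%:R))%:R / n.+1%:R else 0.

Lemma step_bound (n : nat) (t : R) : 0 <= t -> 0 <= step n t <= t.
Proof.
move=> t0; rewrite /step; case: ifPn => _; last by rewrite lexx.
rewrite divr_ge0//= ler_pdivrMr//.
by have /andP[] := truncn_itv (mulr_ge0 t0 (ler0n R n.+1)).
Qed.

Lemma step_cvg (t : R) : 0 <= t -> step n t @[n --> \oo] --> t.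
Proof.
move=> t0; apply/cvgrPdist_le => e e0; near=> n.
have tn : t <= n%:R by near: n; exact: nbhs_infty_ger.
have en : e^-1 <= n%:R by near: n; exact: nbhs_infty_ger.
rewrite /step ifT; last by apply/mem_set; rewrite /= in_itv/= t0.
have n0 : 0 < n.+1%:R :> R by [].
have /andP[h1 h2] := truncn_itv (mulr_ge0 t0 (ler0n R n.+1)).
rewrite ger0_norm; last by rewrite subr_ge0 ler_pdivrMr.
have -> : t - (Num.truncn (t * n.+1%:R))%:R / n.+1%:R =
   (t * n.+1%:R - (Num.truncn (t * n.+1%:R))%:R) / n.+1%:R.
  by rewrite mulrBl mulfK// gt_eqF.
rewrite ler_pdivrMr//.
have : 1 <= e * n.+1%:R.
  rewrite -ler_pdivrMl// mulr1 (le_trans en)// ler_nat//.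
move: h2; rewrite -natr1; lra.
Unshelve. all: end_near. Qed.

Lemma finite_valued_step (n : nat) : finite_valued (step n).
Proof.
pose k (t : R) := if t \in `[0, n%:R]%classic then Num.truncn (t * n.+1%:R) else 0%N.
have -> : step n = (fun m : nat => m%:R / n.+1%:R) \o k.
  by apply/funext => t; rewrite /step /k /=; case: ifP; rewrite ?mul0r.
apply: finite_valued_comp; split.
  apply: (sub_finite_set _ (finite_II (n * n.+1).+1)) => _ [t _ <-] /=.
  rewrite /k; case: ifPn => // /set_mem; rewrite /= in_itv/= => /andP[t0 tn].
  rewrite ltnS -(@ler_nat R) (@le_trans _ _ (t * n.+1%:R))//.
    by rewrite truncn_le mulr_ge0.
  by rewrite natrM ler_wpM2r.
(* The fibre over 0 also contains every point outside [0, n], where the cutoff acts, so it is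
   described through its complement. *)
move=> m; have [m0|m0] := eqVneq m 0%N.
  rewrite (_ : _ @^-1` _ = ~` (`[0, n%:R]%classic `\` `[0, n.+1%:R^-1[%classic)).
    by apply: measurableC; apply: measurableD.
  apply/seteqP; split=> t /=; rewrite /k m0 !in_itv/=.
    case: ifPn => [/set_mem|].
      rewrite /= in_itv /= => /andP[t0 tn] h.
      have := truncn_itv (mulr_ge0 t0 (ler0n R n.+1)); rewrite h => /andP[_ h1].
      by move=> [_]; apply; rewrite t0/= -[ltRHS]mul1r ltr_pdivlMr.
    by move=> + _ [h _]; move/negP; apply; apply/mem_set; rewrite /= in_itv.
  move=> h; case: ifPn => // /set_mem; rewrite /= in_itv/= => tn.
  apply: truncn_def; rewrite mulr_ge0 ?(andP tn).1//=.
  rewrite ltNge; apply/negP => h1; apply: h; split => // /andP[_].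
  by rewrite -[ltRHS]mul1r ltr_pdivlMr// ltNge h1.
rewrite (_ : _ @^-1` _ = `[0, n%:R]%classic `&` `[m%:R / n.+1%:R, m.+1%:R / n.+1%:R[%classic).
  exact: measurableI.
apply/seteqP; split=> t /=; rewrite /k !in_itv/=.
  case: ifPn => [/set_mem|_ mE]; last by rewrite -mE in m0.
  rewrite /= in_itv /= => /andP[t0 tn] mE; rewrite t0 tn; split => //.
  by rewrite ler_pdivrMr// ltr_pdivlMr// -mE truncn_itv// mulr_ge0.
move=> [/[dup] t0n /andP[t0 tn] h].
rewrite ifT; last by apply/mem_set; rewrite /= in_itv.
apply: truncn_def; by rewrite -ler_pdivrMr// -ltr_pdivlMr.
Qed.

(* Approximants of s |-> G s (h s): replace s by step n s and h by simple
   functions, which avoids Egorov's theorem. *)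
Lemma strongly_measurable_comp (V Y : normedModType R) (D : set R) (h : R -> V)
    (G : R -> V -> Y) : measurable D -> D `<=` `[0, +oo[%classic -> strongly_measurable D h ->
  {ae mu, forall s, D s -> forall (a : nat -> R) (y : nat -> V),
     (forall n, 0 <= a n <= s) -> a n @[n --> \oo] --> s -> y n @[n --> \oo] --> h s ->
     G (a n) (y n) @[n --> \oo] --> G s (h s)} ->
  strongly_measurable D (fun s => G s (h s)).
Proof.
move=> mD D0 [s [ss sh]] aeG.
apply: (strongly_measurable_lim (g_ := fun n t => G (step n t) (simple_fun (s n) t))) => //.
  move=> n; apply: (finite_valued_comp (fun p : R * V => G p.1 p.2)
    (g := fun t => (step n t, simple_fun (s n) t))).
  by apply: finite_valued_pair; [exact: finite_valued_step|exact: simple_fun_finite_valued].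
apply: ae_sub2 aeG sh => t Gt ht Dt.
have t0 : 0 <= t by have := D0 _ Dt; rewrite /= in_itv/= andbT.
by apply: Gt => //; [move=> n; exact: step_bound|exact: step_cvg|exact: ht].
Qed.

(** [step] approaches s from within [0, s], so continuity is stated along such sequences; the
    composition lemma is applied to the zero function. *)
Lemma strongly_measurable_continuous (Y : normedModType R) (D : set R) (g : R -> Y) :
  measurable D -> D `<=` `[0, +oo[%classic ->
  (forall s (a : nat -> R), D s -> (forall n, 0 <= a n <= s) ->
     a n @[n --> \oo] --> s -> g (a n) @[n --> \oo] --> g s) ->
  strongly_measurable D g.
Proof.
move=> mD D0 cg; apply: (@strongly_measurable_comp R^o Y D (fun=> 0) (fun t _ => g t)) => //.
  exists (fun=> [::]); split => //; apply: aeW => t _.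
  rewrite (_ : (fun n => _) = fun=> 0); first exact: cvg_cst.
  by apply/funext => n; rewrite /simple_fun big_nil.
by apply: aeW => s Ds a y a0 as_ _; exact: cg.
Qed.

End Step.

(** * Singular integrals on the half-line *)

Section SingularIntegrals.
Context {R : realType}.
Local Notation mu := (@lebesgue_measure R).

(** Both endpoints may be singular: the theorem on closed intervals is applied along an increasing
    exhaustion, and monotone convergence, available because [f] is nonnegative, passes to the
    limit. *)
Lemma FTC_open_interval (f F : R -> R) (a b la lb : R) : a < b ->
  (forall x, a < x < b -> is_derive x 1 F (f x)) ->
  (forall x, a < x < b -> {for x, continuous f}) ->
  (forall x, a < x < b -> 0 <= f x) ->
  F x @[x --> a^'+] --> la -> F x @[x --> b^'-] --> lb ->
  (\int[mu]_(x in `]a, b[) (f x)%:E)%E = (lb - la)%:E.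
Proof.
move=> ab dF cf f0 Fa Fb.
(* The shift by 3 keeps e n below half the length, so that every interval of the exhaustion is
   nondegenerate from n = 0 on. *)
pose e (n : nat) := (b - a) / n.+3%:R.
have ba : 0 < b - a by rewrite subr_gt0.
have e0 n : 0 < e n by rewrite divr_gt0.
have ecvg : e n @[n --> \oo] --> 0.
  rewrite -(mulr0 (b - a)); apply: cvgMr.
  have := @cvg_harmonic R; rewrite -(cvg_shiftn 2) /=.
  by apply: cvg_trans; apply: near_eq_cvg; apply: nearW => n; rewrite addn2.
have e2 n : e n < (b - a) / 2.
  by rewrite /e ltr_pM2l// ltf_pV2 ?posrE// ltr_nat.
have abn n : a + e n < b - e n by have := e2 n; lra.
pose E n := `[a + e n, b - e n]%classic.
have sub n x : E n x -> a < x < b.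
  by rewrite /E /= in_itv/= => /andP[h1 h2]; have := e0 n; lra.
have sub' n x : a + e n < x < b - e n -> a < x < b.
  by move=> /andP[h1 h2]; have := e0 n; lra.
have cF x : a < x < b -> {for x, continuous F}.
  move=> xab; have h := dF x xab.
  by apply/differentiable_continuous/derivable1_diffP; exact: ex_derive.
have In n : (\int[mu]_(x in E n) (f x)%:E)%E = (F (b - e n) - F (a + e n))%:E.
  rewrite (continuous_FTC2 (F := F))//.
  - apply: continuous_in_subspaceT => x; rewrite inE => /sub h; exact: cf.
  - split => [x||].
    + rewrite in_itv/= => /sub' h; exact: (@ex_derive _ _ _ _ _ _ _ (dF x h)).
    + apply: cvg_at_right_filter; apply: cF; have := abn n; have := e0 n; lra.
    + apply: cvg_at_left_filter; apply: cF; have := abn n; have := e0 n; lra.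
  - by move=> x; rewrite in_itv/= => /sub' h; rewrite derive1E; have /@derive_val := dF x h.
have UE : `]a, b[%classic = \bigcup_n E n.
  apply/seteqP; split=> x /=; last by move=> [n _ /sub]; rewrite in_itv.
  rewrite in_itv/= => /andP[ax xb].
  have m0 : 0 < Num.min (x - a) (b - x) by rewrite lt_min !subr_gt0 ax.
  have [N _ /(_ N (leqnn N)) /=] := ((cvgrPdist_lt _ _).1 ecvg) _ m0.
  rewrite sub0r normrN gtr0_norm// lt_min => /andP[h1 h2].
  by exists N => //; rewrite /E /= in_itv/=; lra.
have mf n : measurable_fun (E n) (EFin \o f).
  have cE : {within E n, continuous f}.
    by apply: continuous_in_subspaceT => x; rewrite inE => /sub h; exact: cf.
  apply/measurable_EFinP; exact: (subspace_continuous_measurable_fun (measurable_itv _) cE).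
have ndE : nondecreasing_seq E.
  move=> m n mn; apply/subsetPset => x; rewrite /E /= !in_itv/=.
  have : e n <= e m by rewrite /e ler_pM2l// lef_pV2 ?posrE// ler_nat.
  lra.
have c1 := @ge0_nondecreasing_set_cvg_integral _ (measurableTypeR R) R E (EFin \o f) mu ndE
  (fun=> measurable_itv _) mf _.
rewrite UE; apply: (cvg_unique _ (c1 _)) => //.
  by move=> n x /sub h; rewrite lee_fin f0.
rewrite (_ : (fun i => _) = (fun n => (F (b - e n) - F (a + e n))%:E)); last first.
  by apply/funext => n; exact: In.
apply: cvg_EFin; first exact: nearW.
apply: cvgB.
- apply: (cvg_comp _ _ _ Fb) => A /=.
  move=> [d /= d0 dA]; have [N _ hN] := ((cvgrPdist_lt _ _).1 ecvg) _ d0.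
  exists N => // n /hN /=; rewrite sub0r normrN => hn; apply: dA => /=; last first.
    by have := e0 n; lra.
  by rewrite opprD opprK addrA subrr add0r.
- apply: (cvg_comp _ _ _ Fa) => A /=.
  move=> [d /= d0 dA]; have [N _ hN] := ((cvgrPdist_lt _ _).1 ecvg) _ d0.
  exists N => // n /hN /=; rewrite sub0r normrN => hn; apply: dA => /=; last first.
    by have := e0 n; lra.
  by rewrite opprD addrA subrr add0r normrN.
Qed.

Lemma powR_continuous_gt0 (g x : R) : 0 < x -> {for x, continuous (@powR R ^~ g)}.
Proof.
move=> x0; apply/differentiable_continuous/derivable1_diffP.
exact: (@ex_derive _ _ _ _ _ _ _ (is_derive1_powR g x0)).
Qed.

Lemma integral_powR0 (a r : R) : 0 < a -> 0 < r ->
  (\int[mu]_(t in `]0%R, r[) (t `^ (a - 1))%R%:E)%E = (r `^ a / a)%:E.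
Proof.
move=> a0 r0; rewrite -[in RHS](subr0 (r `^ a / a)).
apply: (FTC_open_interval (F := fun t => t `^ a / a)) => //.
- move=> x /andP[x0 _].
  have h := is_derive1_powR a x0.
  have : is_derive x 1 (fun t => a^-1 *: (t `^ a : R^o)) (a^-1 *: (a * x `^ (a - 1))) by apply: is_deriveZ.
  rewrite /GRing.scale /= mulrA mulVf ?gt_eqF// mul1r.
  by under eq_fun do rewrite mulrC.
- by move=> x /andP[x0 _]; exact: powR_continuous_gt0.
- by move=> x _; exact: powR_ge0.
- rewrite -[X in _ --> X](mul0r a^-1); apply: cvgMl; exact: (powR_cvg0 a0).
- apply: cvg_at_left_filter; apply: cvgMl; exact: powR_continuous_gt0.
Qed.

Lemma integral_powR_kernel (g a t : R) : g < 1 -> a < t ->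
  (\int[mu]_(s in `]a, t[) ((t - s) `^ (- g))%R%:E)%E = ((t - a) `^ (1 - g) / (1 - g))%:E.
Proof.
move=> g1 at_; have g0 : 0 < 1 - g by rewrite subr_gt0.
rewrite (_ : _ / _ = 0 - (- ((t - a) `^ (1 - g) / (1 - g)))); last by rewrite sub0r opprK.
have ts x : a < x < t -> 0 < t - x by lra.
apply: (FTC_open_interval (F := fun s => - ((t - s) `^ (1 - g) / (1 - g)))) => //.
- move=> x /ts x0.
  have h := is_derive1_powR (1 - g) x0.
  have h2 : is_derive x 1 (fun s => t - s) (- 1).
    have : is_derive x 1 (cst t - id) (0 - 1) by apply: is_deriveB.
    by rewrite sub0r.
  have h3 := @is_derive1_comp R (@powR R ^~ (1 - g)) (fun s => t - s) x _ _ h h2.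
  have : is_derive x 1 (fun s => - (1 - g)^-1 *: ((t - s) `^ (1 - g) : R^o)) (- (1 - g)^-1 *: ((1 - g) * (t - x) `^ (1 - g - 1) * -1)).
    by apply: is_deriveZ.
  rewrite (_ : - (1 - g)^-1 *: _ = (t - x) `^ (- g)); last first.
    rewrite /GRing.scale /=.
    rewrite (_ : 1 - g - 1 = - g); last by ring.
    by field; rewrite gt_eqF.
  rewrite (_ : (fun s => - (1 - g)^-1 *: _) = (fun s => - ((t - s) `^ (1 - g) / (1 - g))))//.
  by apply/funext => s; rewrite /GRing.scale /= mulNr mulrC.
- move=> x /ts x0; apply: (continuous_comp (f := fun s => t - s) (g := @powR R ^~ (- g))).
    by apply: cvgB; [exact: cvg_cst|exact: cvg_id].
  exact: powR_continuous_gt0.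
- by move=> x _; exact: powR_ge0.
- apply: cvg_at_right_filter; apply: cvgN; apply: cvgMl.
  apply: (continuous_comp (f := fun s => t - s) (g := @powR R ^~ (1 - g))).
    by apply: cvgB; [exact: cvg_cst|exact: cvg_id].
  by apply: powR_continuous_gt0; lra.
- rewrite -[X in _ --> X]oppr0; apply: cvgN; rewrite -[X in _ --> X](mul0r (1 - g)^-1); apply: cvgMl.
  apply: (cvg_comp (fun s => t - s) (@powR R ^~ (1 - g)) _ (powR_cvg0 g0)) => A /=.
  move=> [d /= d0 dA]; exists d => // s /= hs st; apply: dA => /=; last by rewrite subr_gt0.
  by rewrite sub0r normrN.
Qed.

Lemma derive_powR_div (a x : R) : a != 0 -> 0 < x ->
  is_derive x 1 (fun t => t `^ a / a) (x `^ (a - 1)).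
Proof.
move=> a0 x0; have h := is_derive1_powR a x0.
have : is_derive x 1 (fun t => a^-1 *: (t `^ a : R^o)) (a^-1 *: (a * x `^ (a - 1))).
  by apply: is_deriveZ.
rewrite /GRing.scale /= mulrA mulVf// mul1r.
by under eq_fun do rewrite mulrC.
Qed.

Lemma integral_powR_tail (a : R) : 0 < a ->
  (\int[mu]_(t in `[1%R, +oo[) (t `^ (- a - 1))%R%:E = (a^-1)%:E)%E.
Proof.
move=> a0.
have Na0 : - a != 0 by rewrite oppr_eq0 gt_eqF.
rewrite (ge0_continuous_FTC2y (F := fun t => t `^ (- a) / (- a)) (l := 0)).
- by rewrite powR1 sub0e -EFinN; congr EFin; field; rewrite gt_eqF.
- by move=> x _; exact: powR_ge0.
- apply: continuous_in_subspaceT => x; rewrite inE /= in_itv/= andbT => x1.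
  by apply: powR_continuous_gt0; exact: lt_le_trans x1.
- rewrite -[X in _ --> X](mul0r (- a)^-1); apply: cvgMl.
  apply/cvgrPdist_le => e e0; near=> t.
  (* The threshold e^(-1/a) is the solution of t^(-a) = e. *)
  have Mt : e `^ (- a^-1) <= t by near: t; exact: nbhs_pinfty_ge.
  have M0 : 0 < e `^ (- a^-1) by exact: powR_gt0.
  rewrite sub0r normrN ger0_norm ?powR_ge0// powRN.
  rewrite -(invrK e) lef_pV2 ?posrE ?invr_gt0//; last first.
    by apply: powR_gt0; exact: lt_le_trans Mt.
  rewrite (_ : e^-1 = (e `^ (- a^-1)) `^ a); last first.
    by rewrite -powRrM mulNr mulVf ?gt_eqF// powR_inv1// ltW.
  by apply: ge0_ler_powR; rewrite ?nnegrE// ltW// (lt_le_trans M0).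
- move=> x x1; apply: (@ex_derive _ _ _ _ _ _ _ (derive_powR_div Na0 _)); exact: lt_trans x1.
- apply: cvg_at_right_filter; apply: cvgMl; exact: powR_continuous_gt0.
- move=> x; rewrite in_itv/= andbT => x1; rewrite derive1E.
  have x0 : 0 < x by exact: lt_trans x1.
  exact: (@derive_val _ _ _ _ _ _ _ (derive_powR_div Na0 x0)).
Unshelve. all: end_near. Qed.

Lemma integral_expR_tail (k : R) : 0 < k ->
  (\int[mu]_(t in `[1%R, +oo[) (expR (- (k * t)))%R%:E < +oo)%E.
Proof.
move=> k0.
have dF (x : R) : is_derive x 1 (fun t => - k^-1 * expR (- (k * t))) (expR (- (k * x))).
  have h1 : is_derive x 1 (fun t => - k *: (t : R^o)) (- k *: (1 : R^o)) by apply: is_deriveZ.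
  have h2 := @is_derive1_comp R expR _ x _ _ (is_derive_expR _) h1.
  have : is_derive x 1 (fun t => - k^-1 *: (expR (- k * t) : R^o)) (- k^-1 *: (expR (- k * x) * (- k * 1))).
    by apply: is_deriveZ.
  rewrite /GRing.scale /=.
  rewrite (_ : - k^-1 * (_ * _) = expR (- (k * x))); last first.
    by rewrite -(mulNr k x); field; rewrite gt_eqF.
  rewrite (_ : (fun t => - k^-1 * expR (- k * t)) = (fun t => - k^-1 * expR (- (k * t))))//.
  by apply/funext => t; rewrite (mulNr k t).
rewrite (ge0_continuous_FTC2y (F := fun t => - k^-1 * expR (- (k * t))) (l := 0)).
- by rewrite -EFinB ltry.
- by move=> x _; exact: expR_ge0.
- apply: continuous_in_subspaceT => x _; apply: (continuous_comp (f := fun t => - (k * t)) (g := expR)).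
    by apply: cvgN; apply: cvgMr; exact: cvg_id.
  exact: continuous_expR.
- rewrite -(mulr0 (- k^-1)); apply: cvgMr.
  apply: (@cvg_comp _ _ _ (fun t => k * t) (fun y => expR (- y)) _ (pinfty_nbhs R)).
    by apply: gt0_cvgMry => //; exact: cvg_id.
  exact: cvgr_expR.
- by move=> x x1; exact: (@ex_derive _ _ _ _ _ _ _ (dF x)).
- apply: cvg_at_right_filter.
  have : {for 1, continuous (fun t => - k^-1 * expR (- (k * t)))}; last by [].
  apply/differentiable_continuous/derivable1_diffP.
  exact: (@ex_derive _ _ _ _ _ _ _ (dF 1)).
- by move=> x _; rewrite derive1E; exact: (@derive_val _ _ _ _ _ _ _ (dF x)).
Qed.

Lemma integral_scale_measurable (g : R -> \bar R) (l : R) : 0 < l ->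
  measurable_fun (`]0%R, +oo[ : set R) g ->
  measurable_fun (`]0%R, +oo[ : set R) (fun t => g (l * t)).
Proof.
move=> l0 mg.
apply: (measurable_comp (g := fun t : R => l * t) (measurable_itv _) _ mg).
- by move=> _ /= [t + <-]; rewrite !in_itv/= !andbT; exact: mulr_gt0.
- exact: measurable_funM.
Qed.

(** Uniqueness of Lebesgue measure: l times the image of mu under t |-> l t agrees with mu on
    half-open intervals, hence on all measurable sets. *)
Lemma integral_scale (g : R -> \bar R) (l : R) : 0 < l ->
  measurable_fun (`]0%R, +oo[ : set R) g -> (forall x, 0 < x -> (0 <= g x)%E) ->
  (\int[mu]_(t in `]0%R, +oo[) g (l * t)%R = (l^-1)%:E * \int[mu]_(t in `]0%R, +oo[) g t)%E.
Proof.
move=> l0 mg g0.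
pose phi (t : measurableTypeR R) : measurableTypeR R := l * t.
have mphi : measurable_fun setT phi by apply: measurable_funM.
have pre a b : phi @^-1` `]a, b] = `](a / l), (b / l)]%classic.
  by apply/seteqP; split=> t; rewrite /phi /= !in_itv/= ltr_pdivrMr// ler_pdivlMr// mulrC.
have E A : measurable A -> mu A = (mscale (NngNum (ltW l0)) (pushforward mu phi)) A.
  apply: lebesgue_measure_unique => _ [[a b] _ <-] /=.
  rewrite /mscale /= /pushforward pre !lebesgue_measure_itv /= !lte_fin.
  rewrite ltr_pM2r ?invr_gt0//; case: ifP => ab; last by rewrite mule0.
  by rewrite -!EFinB -EFinM; congr EFin; field; rewrite gt_eqF.
have preD : `]0%R, +oo[%classic = phi @^-1` `]0%R, +oo[%classic.
  by apply/seteqP; split=> t; rewrite /phi /= !in_itv/= !andbT pmulr_rgt0.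
have D0 : {in (`]0%R, +oo[%classic : set R), forall y, (0 <= g y)%E}.
  by move=> y; rewrite inE /= in_itv/= andbT; exact: g0.
have D0' : forall y, (`]0%R, +oo[%classic : set R) y -> (0 <= g y)%E.
  by move=> y yD; apply: D0; exact/mem_set.
rewrite {1}preD -(ge0_integral_pushforward mphi mu (measurable_itv _) mg D0).
have -> : (\int[mu]_(t in `]0%R, +oo[) g t =
    \int[mscale (NngNum (ltW l0)) (pushforward mu phi)]_(t in `]0%R, +oo[) g t)%E.
  by move=> m; apply: eq_measure_integral => A mA _; exact: E.
rewrite ge0_integral_mscale//= muleA -EFinM mulVf ?gt_eqF// mul1e.
by [].
Qed.

End SingularIntegrals.

(** * Gamma and Beta integrals, and the identity behind products of fractional powers *)

Section BetaLaw.
Context {R : realType}.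
Local Notation mu := (@lebesgue_measure R).
Local Notation D := (`]0%R, +oo[%classic : set R).

Lemma integral_half_line_split (f : R -> R) : measurable_fun D f ->
  (forall t, 0 < t -> 0 <= f t) ->
  (\int[mu]_(t in D) (f t)%:E = \int[mu]_(t in `]0%R, 1%R[) (f t)%:E
     + \int[mu]_(t in `[1%R, +oo[) (f t)%:E)%E.
Proof.
move=> mf f0.
have DE : D = `]0%R, 1%R[%classic `|` `[1%R, +oo[%classic.
  apply/seteqP; split=> t /=; rewrite !in_itv/= !andbT.
    by move=> t0; case: (ltP t 1) => h; [left; rewrite t0|right].
  by move=> [/andP[]//|]; exact: lt_le_trans.
rewrite {1}DE ge0_integral_setU//.
- by rewrite -DE; exact/measurable_EFinP.
- by move=> t; rewrite -DE /= in_itv/= andbT => t0; rewrite lee_fin f0.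
- rewrite disj_set2E; apply/eqP; rewrite -subset0 => t /= [].
  by rewrite !in_itv/= andbT => /andP[_ h1] h2; move: h1; rewrite ltNge h2.
Qed.

Lemma itv_measurable_subset (f : R -> R) (i : interval R) : measurable_fun D f ->
  [set` i] `<=` D -> measurable_fun [set` i] (EFin \o f).
Proof. by move=> mf iD; apply/measurable_EFinP; exact: measurable_funS mf. Qed.

(** The two possible divergences are separated at 1: [g] controls the origin and [h] controls
    infinity. *)
Lemma half_line_lty (f g h : R -> R) : measurable_fun D f ->
  measurable_fun D g -> measurable_fun D h ->
  (forall t, 0 < t -> 0 <= f t) -> (forall t, 0 < t < 1 -> f t <= g t) ->
  (forall t, 1 <= t -> f t <= h t) ->
  (\int[mu]_(t in `]0%R, 1%R[) (g t)%:E < +oo)%E ->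
  (\int[mu]_(t in `[1%R, +oo[) (h t)%:E < +oo)%E ->
  (\int[mu]_(t in D) (f t)%:E < +oo)%E.
Proof.
move=> mf mg mh f0 fg fh gfin hfin.
have s1 : `]0%R, 1%R[%classic `<=` D by move=> t /=; rewrite !in_itv/= andbT => /andP[].
have s2 : `[1%R, +oo[%classic `<=` D.
  by move=> t /=; rewrite !in_itv/= !andbT; exact: lt_le_trans.
rewrite integral_half_line_split//; apply: lte_add_pinfty.
- apply: le_lt_trans gfin; apply: ge0_le_integral => //.
  + by move=> t /s1; rewrite /= in_itv/= andbT => t0; rewrite lee_fin f0.
  + exact: itv_measurable_subset.
  + exact: itv_measurable_subset.
- apply: le_lt_trans hfin; apply: ge0_le_integral => //.
  + by move=> t /s2; rewrite /= in_itv/= andbT => t0; rewrite lee_fin f0.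
  + exact: itv_measurable_subset.
  + exact: itv_measurable_subset.
  + by move=> t /=; rewrite in_itv/= andbT => t01; rewrite lee_fin fh.
Qed.

Lemma half_line_gt0 (f : R -> R) (c : R) : measurable_fun D f -> 0 < c ->
  (forall t, 0 < t -> 0 <= f t) -> (forall t, 0 < t < 1 -> c <= f t) ->
  (0 < \int[mu]_(t in D) (f t)%:E)%E.
Proof.
move=> mf c0 f0 fc.
have s1 : `]0%R, 1%R[%classic `<=` D by move=> t /=; rewrite !in_itv/= andbT => /andP[].
have s2 : `[1%R, +oo[%classic `<=` D.
  by move=> t /=; rewrite !in_itv/= !andbT; exact: lt_le_trans.
rewrite integral_half_line_split//; apply: (@lt_le_trans _ _ c%:E); first by rewrite lte_fin.
rewrite -[leLHS]adde0; apply: leeD; last first.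
  apply: integral_ge0 => t /s2; rewrite /= in_itv/= andbT => t0.
  by rewrite lee_fin f0.
have -> : c%:E = (\int[mu]_(t in `]0%R, 1%R[) c%:E)%E.
  by rewrite integral_cst//= lebesgue_measure_itv/= lte_fin ltr01 oppr0 adde0 mule1.
apply: ge0_le_integral => //.
- by move=> t _; rewrite lee_fin ltW.
- exact: itv_measurable_subset.
Qed.

Lemma measurable_powRW (A : set R) (p : R) : measurable_fun A (@powR R ^~ p).
Proof. by apply: (@measurable_funS _ _ _ _ setT) => //; exact: measurable_powR. Qed.

Lemma measurable_expRM (A : set R) (k : R) : measurable_fun A (fun t => expR (- (k * t))).
Proof.
apply: (@measurable_funS _ _ _ _ setT) => //.
apply: (measurableT_comp (@measurable_expR R)); apply: (measurableT_comp (@oppr_measurable R _)).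
exact: measurable_funM.
Qed.

Lemma expR_decay_le1 (k t : R) : 0 < k -> 0 < t -> expR (- (k * t)) <= 1.
Proof. by move=> k0 t0; rewrite -expR0 ler_expR oppr_le0 mulr_ge0// ltW. Qed.

Lemma powR_decay_le1 (a t : R) : a <= 0 -> 1 <= t -> t `^ a <= 1.
Proof. by move=> a0 t1; rewrite -[leRHS](powRr0 t); exact: ler_powR. Qed.

Lemma gamma_integral_lty (a k : R) : 0 < a -> a <= 1 -> 0 < k ->
  (\int[mu]_(t in D) (t `^ (a - 1) * expR (- (k * t)))%R%:E < +oo)%E.
Proof.
move=> a0 a1 k0.
apply: (half_line_lty (g := fun t => t `^ (a - 1)) (h := fun t => expR (- (k * t)))).
- by apply: measurable_funM; [exact: measurable_powRW|exact: measurable_expRM].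
- exact: measurable_powRW.
- exact: measurable_expRM.
- by move=> t _; rewrite mulr_ge0 ?powR_ge0 ?expR_ge0.
- move=> t /andP[t0 _]; rewrite ler_piMr ?powR_ge0//; exact: expR_decay_le1.
- move=> t t1; rewrite ler_piMl ?expR_ge0//; apply: powR_decay_le1 => //; lra.
- by rewrite integral_powR0// ltry.
- exact: integral_expR_tail.
Qed.

Lemma Gamma_gt0 (a : R) : 0 < a -> a <= 1 -> 0 < Gamma a.
Proof.
move=> a0 a1; rewrite /Gamma /Rintegral; apply: fine_gt0.
have E : (\int[mu]_(t in D) (t `^ (a - 1) * expR (- t))%R%:E =
    \int[mu]_(t in D) (t `^ (a - 1) * expR (- (1 * t)))%R%:E)%E.
  by apply: eq_integral => t _; rewrite mul1r.
apply/andP; split; last by rewrite E gamma_integral_lty.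
apply: (half_line_gt0 (c := expR (-1))); rewrite ?expR_gt0//.
- apply: measurable_funM; first exact: measurable_powRW.
  rewrite (_ : (fun t => _) = (fun t => expR (- (1 * t)))); first exact: measurable_expRM.
  by apply/funext => t; rewrite mul1r.
- by move=> t _; rewrite mulr_ge0 ?powR_ge0 ?expR_ge0.
- move=> t /andP[t0 t1]; rewrite -[leLHS]mul1r ler_pM ?expR_ge0//.
    rewrite -[leLHS](powRr0 t); apply: ger_powR; [by rewrite t0 ltW|lra].
  by rewrite ler_expR lerN2 ltW.
Qed.

(** Integrand of the Beta function B(a, b) on the half-line, obtained from x^(b-1) (1-x)^(a-1) on
    the unit interval by x = t / (1 + t). *)
Definition beta_kernel (a b t : R) : R := t `^ (b - 1) * (1 + t) `^ (- (a + b)).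

Lemma measurable_beta_kernel (a b : R) : measurable_fun D (beta_kernel a b).
Proof.
apply: measurable_funM; first exact: measurable_powRW.
apply: (@measurableT_comp _ _ _ _ _ _ (@powR R ^~ (- (a + b)))); first exact: measurable_powR.
exact: measurable_funD.
Qed.

Lemma beta_integral_lty (a b : R) : 0 < a -> 0 < b ->
  (\int[mu]_(t in D) (beta_kernel a b t)%:E < +oo)%E.
Proof.
move=> a0 b0; have ab : - (a + b) <= 0 by lra.
apply: (half_line_lty (g := fun t => t `^ (b - 1)) (h := fun t => t `^ (- a - 1))).
- exact: measurable_beta_kernel.
- exact: measurable_powRW.
- exact: measurable_powRW.
- by move=> t _; rewrite mulr_ge0 ?powR_ge0.
- move=> t /andP[t0 _]; rewrite /beta_kernel ler_piMr ?powR_ge0//.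
  by apply: powR_decay_le1 => //; lra.
- move=> t t1; have t0 : 0 < t by exact: lt_le_trans t1.
  rewrite /beta_kernel (_ : - a - 1 = (b - 1) + (- (a + b))); last by ring.
  rewrite [leRHS]powRD; last by rewrite (gt_eqF t0) implybT.
  rewrite ler_wpM2l ?powR_ge0// !powRN lef_pV2 ?posrE ?powR_gt0//; last lra.
  by apply: ge0_ler_powR; rewrite ?nnegrE; lra.
- by rewrite integral_powR0// ltry.
- by rewrite integral_powR_tail// ltry.
Qed.

Lemma beta_integral_gt0 (a b : R) : 0 < a -> 0 < b -> b <= 1 ->
  (0 < \int[mu]_(t in D) (beta_kernel a b t)%:E)%E.
Proof.
move=> a0 b0 b1; apply: (half_line_gt0 (c := 2 `^ (- (a + b)))).
- exact: measurable_beta_kernel.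
- exact: powR_gt0.
- by move=> t _; rewrite mulr_ge0 ?powR_ge0.
- move=> t /andP[t0 t1]; rewrite -[leLHS]mul1r ler_pM ?powR_ge0//.
    rewrite -[leLHS](powRr0 t); apply: ger_powR; [by rewrite t0 ltW|lra].
  rewrite !powRN lef_pV2 ?posrE ?powR_gt0//; last lra.
  by apply: ge0_ler_powR; rewrite ?nnegrE; lra.
Qed.

Definition beta_const (a b : R) : R := fine (\int[mu]_(t in D) (beta_kernel a b t)%:E)%E.

Lemma beta_const_gt0 (a b : R) : 0 < a -> 0 < b -> b <= 1 -> 0 < beta_const a b.
Proof.
by move=> a0 b0 b1; apply: fine_gt0; rewrite beta_integral_gt0// beta_integral_lty.
Qed.

Lemma beta_constE (a b : R) : 0 < a -> 0 < b ->
  (\int[mu]_(t in D) (beta_kernel a b t)%:E)%E = (beta_const a b)%:E.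
Proof.
move=> a0 b0; rewrite fineK// ge0_fin_numE ?beta_integral_lty//.
by apply: integral_ge0 => t _; rewrite lee_fin mulr_ge0 ?powR_ge0.
Qed.

(* Substituting t = s tau only uses dilations of the half-line. *)
Lemma tonelli_beta (a b : R) (k : R -> R) : 0 < a -> 0 < b ->
  measurable_fun D k -> (forall r, 0 < r -> 0 <= k r) ->
  (\int[mu]_(s in D) ((s `^ (a - 1))%R%:E * \int[mu]_(t in D) (t `^ (b - 1) * k (s + t))%R%:E)
   = (beta_const a b)%:E * \int[mu]_(r in D) (r `^ (a + b - 1) * k r)%R%:E)%E.
Proof.
move=> a0 b0 mk k0.
pose K : R -> R := k \_ D.
have mD : measurable D by exact: measurable_itv.
have mK : measurable_fun setT K by apply/(measurable_restrictT k mD).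
have KE r : 0 < r -> K r = k r by move=> r0; rewrite /K patchE ifT// inE /= in_itv/= r0.
have K0 r : 0 <= K r.
  rewrite /K patchE; case: ifPn => // /set_mem; rewrite /= in_itv/= andbT; exact: k0.
have mp p : measurable_fun setT ((@powR R ^~ p) \_ D).
  by apply/(measurable_restrictT _ mD); exact: measurable_powRW.
have p0 p t : 0 <= ((@powR R ^~ p) \_ D) t by rewrite patchE; case: ifPn => // _; exact: powR_ge0.
have pE p t : 0 < t -> ((@powR R ^~ p) \_ D) t = t `^ p.
  by move=> t0; rewrite patchE ifT// inE /= in_itv/= t0.
(* [F] is the integrand in the new variables, the original t being the product of the two. Extending
   each factor by zero makes it measurable on the whole plane, where Tonelli's theorem is
   applied. *)
pose F (z : R * R) : R :=
  ((@powR R ^~ (a + b - 1)) \_ D) z.1 * ((@powR R ^~ (b - 1)) \_ D) z.2 * K (z.1 * (1 + z.2)).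
have mF : measurable_fun setT (EFin \o F).
  apply/measurable_EFinP; apply: measurable_funM; first apply: measurable_funM.
  - exact: (measurableT_comp (mp _) measurable_fst).
  - exact: (measurableT_comp (mp _) measurable_snd).
  - apply: (measurableT_comp mK); apply: measurable_funM; first exact: measurable_fst.
    by apply: measurable_funD => //; exact: measurable_snd.
have F0 z : (0 <= (EFin \o F) z)%E by rewrite lee_fin !mulr_ge0.
have FN1 s t : ~ 0 < s -> F (s, t) = 0.
  move=> s0; rewrite /F /= (_ : (_ \_ D) s = 0) ?mul0r//.
  by rewrite patchE ifF//; apply/negbTE; rewrite notin_setE /= in_itv/= andbT.
have FN2 s t : ~ 0 < t -> F (s, t) = 0.
  move=> t0; rewrite /F /= (_ : (_ \_ D) t = 0) ?mulr0 ?mul0r//.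
  by rewrite patchE ifF//; apply/negbTE; rewrite notin_setE /= in_itv/= andbT.
have restr (h : R -> \bar R) : (forall t, ~ 0 < t -> h t = 0%E) ->
    (\int[mu]_t h t = \int[mu]_(t in D) h t)%E.
  move=> h0; rewrite [RHS]integral_mkcond; apply: eq_integral => t _.
  rewrite patchE; case: ifPn => //; rewrite notin_setE /= in_itv/= andbT => t0; exact: h0.
have := @fubini_tonelli _ _ (measurableTypeR R) (measurableTypeR R) R mu mu (EFin \o F) mF F0.
rewrite (restr (fun s => (\int[mu]_t (EFin \o F) (s, t))%E)); last first.
  by move=> s s0; apply: integral0_eq => t _ /=; rewrite FN1.
rewrite (restr (fun t => (\int[mu]_s (EFin \o F) (s, t))%E)); last first.
  by move=> t t0; apply: integral0_eq => s _ /=; rewrite FN2.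
have -> : (\int[mu]_(s in D) \int[mu]_t (EFin \o F) (s, t) =
  \int[mu]_(s in D) ((s `^ (a - 1))%R%:E * \int[mu]_(t in D) (t `^ (b - 1) * k (s + t))%R%:E))%E.
  apply: eq_integral => s; rewrite inE /= in_itv/= andbT => s0.
  rewrite restr; last by move=> t t0 /=; rewrite FN2.
  have mg : measurable_fun D (fun t => (t `^ (b - 1) * k (s + t))%:E : \bar R).
    apply/measurable_EFinP; apply: measurable_funM; first exact: measurable_powRW.
    apply: (@eq_measurable_fun _ _ _ _ _ (K \o (fun t => s + t))).
      by move=> t; rewrite inE /= in_itv/= andbT => t0; rewrite KE// addr_gt0.
    apply: (measurableT_comp mK); exact: measurable_funD.
  have h0 t : 0 < t -> (0 <= (t `^ (b - 1) * k (s + t))%:E)%E.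
    by move=> t0; rewrite lee_fin mulr_ge0 ?powR_ge0 ?k0// addr_gt0.
  (* For fixed s, the dilation by s contributes s^(-1), which turns s^a into s^(a-1). *)
  transitivity (\int[mu]_(t in D) ((s `^ a)%:E * ((s * t) `^ (b - 1) * k (s + s * t))%R%:E))%E.
    apply: eq_integral => t; rewrite inE /= in_itv/= andbT => t0.
    rewrite -EFinM; congr EFin; rewrite /F /= !pE// KE ?mulr_gt0 ?addr_gt0//.
    rewrite powRM ?ltW// mulrDr mulr1 (_ : a + b - 1 = a + (b - 1)); last by ring.
    by rewrite powRD ?(gt_eqF s0) ?implybT//; ring.
  rewrite ge0_integralZl//; last 3 first.
  - have := integral_scale_measurable s0 mg; exact.
  - by move=> t; rewrite /= in_itv/= andbT => t0; apply: h0; rewrite mulr_gt0.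
  - by rewrite lee_fin powR_ge0.
  rewrite (integral_scale s0 mg h0) muleA -EFinM; congr (_%:E * _)%E.
  by rewrite powRB ?(gt_eqF s0) ?implybT// powRr1// ltW.
move=> ->.
have mG : measurable_fun D (fun r => (r `^ (a + b - 1) * k r)%:E : \bar R).
  by apply/measurable_EFinP; apply: measurable_funM => //; exact: measurable_powRW.
have G0 r : 0 < r -> (0 <= (r `^ (a + b - 1) * k r)%:E)%E.
  by move=> r0; rewrite lee_fin mulr_ge0 ?powR_ge0 ?k0.
set I := (\int[mu]_(r in D) (r `^ (a + b - 1) * k r)%R%:E)%E.
have I0 : (0 <= I)%E.
  by apply: integral_ge0 => r; rewrite /= in_itv/= andbT; exact: G0.
transitivity (\int[mu]_(t in D) ((beta_kernel a b t)%:E * I))%E; last first.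
  rewrite ge0_integralZr//; first by rewrite beta_constE.
  - by apply/measurable_EFinP; exact: measurable_beta_kernel.
  - by move=> t _; rewrite lee_fin mulr_ge0 ?powR_ge0.
apply: eq_integral => t; rewrite inE /= in_itv/= andbT => t0.
rewrite restr; last by move=> s s0 /=; rewrite FN1.
have l0 : 0 < 1 + t by rewrite addr_gt0.
(* For fixed t, the dilation by 1 + t contributes (1 + t)^(-1), which completes (1 + t)^(-(a+b-1))
   to the factor of the Beta kernel. *)
transitivity (\int[mu]_(s in D) ((t `^ (b - 1) * (1 + t) `^ (- (a + b - 1)))%:E *
    (((1 + t) * s) `^ (a + b - 1) * k ((1 + t) * s))%R%:E))%E.
  apply: eq_integral => s; rewrite inE /= in_itv/= andbT => s0.
  rewrite -EFinM; congr EFin; rewrite /F /= !pE// KE ?mulr_gt0// (mulrC s (1 + t)).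
  rewrite powRM ?ltW// powRN.
  by field; rewrite gt_eqF// powR_gt0.
rewrite ge0_integralZl//; last 3 first.
- have := integral_scale_measurable l0 mG; exact.
- by move=> s; rewrite /= in_itv/= andbT => s0; apply: G0; rewrite mulr_gt0.
- by rewrite lee_fin mulr_ge0 ?powR_ge0.
rewrite (integral_scale l0 mG G0) muleA -EFinM; congr (_%:E * _)%E.
rewrite /beta_kernel -mulrA; congr *%R.
rewrite -[X in _ * X]powR_inv1 ?ltW// -powRD ?(gt_eqF l0) ?implybT//.
by congr powR; ring.
Qed.

End BetaLaw.

Section BetaLawSigned.
Context {R : realType}.
Local Notation mu := (@lebesgue_measure R).
Local Notation D := (`]0%R, +oo[%classic : set R).

Lemma integrable_gamma_weight (a C kappa : R) (k : R -> R) : 0 < a -> a <= 1 -> 0 < kappa ->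
  measurable_fun D k -> (forall r, 0 < r -> `|k r| <= C * expR (- (kappa * r))) ->
  mu.-integrable D (EFin \o (fun r => r `^ (a - 1) * k r)).
Proof.
move=> a0 a1 ka0 mk kC.
have mD : measurable D by exact: measurable_itv.
have mg : measurable_fun D (fun r => r `^ (a - 1) * expR (- (kappa * r))).
  by apply: measurable_funM; [exact: measurable_powRW|exact: measurable_expRM].
apply: (@integrable_norm_le _ _ _ (fun r => C * (r `^ (a - 1) * expR (- (kappa * r))))) => //.
- by apply: measurable_funM => //; exact: measurable_powRW.
- exact: measurable_funM.
- move=> r /=; rewrite in_itv/= andbT => r0.
  rewrite normrM ger0_norm ?powR_ge0// mulrCA ler_wpM2l ?powR_ge0//; exact: kC.
- have C0 : 0 <= C.
    have := kC 1 ltr01; have := normr_ge0 (k 1); move=> h1 h2.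
    by rewrite -(pmulr_lge0 C (expR_gt0 (- (kappa * 1)))); exact: le_trans h2.
  under eq_integral do rewrite EFinM.
  rewrite ge0_integralZl//; last 2 first.
  + exact/measurable_EFinP.
  + by move=> r _; rewrite lee_fin mulr_ge0 ?powR_ge0 ?expR_ge0.
  apply: lte_mul_pinfty => //; last exact: gamma_integral_lty.
Qed.

Lemma shift_decay (C kappa s : R) (k : R -> R) : 0 < kappa -> 0 < s ->
  (forall r, 0 < r -> `|k r| <= C * expR (- (kappa * r))) ->
  forall r, 0 < r -> `|k (s + r)| <= C * expR (- (kappa * s)) * expR (- (kappa * r)).
Proof.
move=> ka0 s0 kC r r0; rewrite -mulrA -expRD -opprD -mulrDr; apply: kC.
exact: addr_gt0.
Qed.

Lemma measurable_shift (s : R) (k : R -> R) : 0 < s -> measurable_fun D k ->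
  measurable_fun D (fun t => k (s + t)).
Proof.
move=> s0 mk; apply: (measurable_comp (g := fun t : R => s + t) (measurable_itv _) _ mk).
  by move=> _ /= [t + <-]; rewrite !in_itv/= !andbT; exact: addr_gt0.
exact: measurable_funD.
Qed.

Let inner (b : R) (k : R -> R) (s : R) := \int[mu]_(t in D) (t `^ (b - 1) * k (s + t)).

Let beta_law_ge0 (a b C kappa : R) (k : R -> R) : 0 < a -> 0 < b -> a + b <= 1 ->
  0 < kappa -> measurable_fun D k -> (forall r, 0 < r -> 0 <= k r) ->
  (forall r, 0 < r -> `|k r| <= C * expR (- (kappa * r))) ->
  mu.-integrable D (EFin \o (fun s => s `^ (a - 1) * inner b k s)) /\
  \int[mu]_(s in D) (s `^ (a - 1) * inner b k s) =
    beta_const a b * \int[mu]_(r in D) (r `^ (a + b - 1) * k r).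
Proof.
move=> a0 b0 ab1 ka0 mk k0 kC.
have mD : measurable D by exact: measurable_itv.
have b1 : b <= 1 by lra.
have I1 s : 0 < s -> mu.-integrable D (EFin \o (fun t => t `^ (b - 1) * k (s + t))).
  move=> s0; apply: integrable_gamma_weight ka0 _ (shift_decay ka0 s0 kC) => //.
  exact: measurable_shift.
have I2 : mu.-integrable D (EFin \o (fun r => r `^ (a + b - 1) * k r)).
  by apply: (integrable_gamma_weight _ ab1 ka0 mk kC); exact: addr_gt0.
have innerE s : 0 < s ->
    (\int[mu]_(t in D) (t `^ (b - 1) * k (s + t))%R%:E)%E = (inner b k s)%:E.
  by move=> s0; rewrite /inner /Rintegral fineK//; apply: integrable_fin_num => //; exact: I1.
have inner0 s : 0 < s -> 0 <= inner b k s.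
  move=> s0; apply: Rintegral_ge0 => t; rewrite /= in_itv/= andbT => t0.
  by rewrite mulr_ge0 ?powR_ge0 ?k0// addr_gt0.
have T := tonelli_beta a0 b0 mk k0.
have IE : (\int[mu]_(r in D) (r `^ (a + b - 1) * k r)%R%:E)%E =
    (\int[mu]_(r in D) (r `^ (a + b - 1) * k r))%:E.
  by rewrite /Rintegral fineK//; exact: integrable_fin_num.
have E : (\int[mu]_(s in D) (s `^ (a - 1) * inner b k s)%R%:E)%E =
    (beta_const a b * \int[mu]_(r in D) (r `^ (a + b - 1) * k r))%:E.
  rewrite EFinM -IE -T; apply: eq_integral => s; rewrite inE /= in_itv/= andbT => s0.
  by rewrite innerE// EFinM.
(* Measurability of the inner integral in s comes with Tonelli's theorem, applied to t^(b-1) k(s +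
   t) with both factors extended by zero. *)
have minner : measurable_fun D (inner b k).
  pose K : R -> R := k \_ D.
  have mK : measurable_fun setT K by apply/(measurable_restrictT k mD).
  pose p : R -> R := (@powR R ^~ (b - 1)) \_ D.
  have mp : measurable_fun setT p by apply/(measurable_restrictT _ mD); exact: measurable_powRW.
  pose G (z : R * R) : R := p z.2 * K (z.1 + z.2).
  have mG : measurable_fun setT (EFin \o G).
    apply/measurable_EFinP; apply: measurable_funM.
      exact: (measurableT_comp mp measurable_snd).
    apply: (measurableT_comp mK); apply: measurable_funD; [exact: measurable_fst|exact: measurable_snd].
  have G0 z : (0 <= (EFin \o G) z)%E.
    rewrite lee_fin mulr_ge0// /p /K patchE; case: ifPn => // h; first exact: powR_ge0.
    by apply: k0; move: h => /set_mem; rewrite /= in_itv/= andbT.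
  have mF := @measurable_fun_fubini_tonelli_F _ _ (measurableTypeR R) (measurableTypeR R) R mu (EFin \o G) mG G0.
  have := @measurableT_comp _ _ _ _ _ _ (@fine R) _ _ (fine_measurable measurableT) mF.
  move=> /(@measurable_funS _ _ _ _ setT D _ measurableT (@subsetT _ _)).
  apply: eq_measurable_fun => s; rewrite inE /= in_itv/= andbT => s0.
  rewrite /inner /Rintegral [in RHS]integral_mkcond; congr fine; apply: eq_integral => t _.
  rewrite /= /G /p /= !patchE; case: ifPn => [|_]; last by rewrite mul0r.
  rewrite inE /= in_itv/= andbT => t0; rewrite /K patchE ifT// inE /= in_itv/= andbT.
  exact: addr_gt0.
have mI : measurable_fun D (fun s => s `^ (a - 1) * inner b k s).
  by apply: measurable_funM => //; exact: measurable_powRW.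
split; last by rewrite {1}/Rintegral E.
apply: (@integrable_norm_le _ _ _ (fun s => s `^ (a - 1) * inner b k s)) => //.
  move=> s; rewrite /= in_itv/= andbT => s0.
  by rewrite ger0_norm// mulr_ge0 ?powR_ge0 ?inner0.
by rewrite E ltry.
Qed.

(** Tonelli's theorem handles nonnegative functions; a signed k is written (k + h) - h with h its
    exponential majorant, and both terms are nonnegative with the same rate of decay. *)
Lemma beta_law (a b C kappa : R) (k : R -> R) : 0 < a -> 0 < b -> a + b <= 1 ->
  0 < kappa -> measurable_fun D k ->
  (forall r, 0 < r -> `|k r| <= C * expR (- (kappa * r))) ->
  \int[mu]_(s in D) (s `^ (a - 1) * \int[mu]_(t in D) (t `^ (b - 1) * k (s + t))) =
    beta_const a b * \int[mu]_(r in D) (r `^ (a + b - 1) * k r).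
Proof.
move=> a0 b0 ab1 ka0 mk kC.
have mD : measurable D by exact: measurable_itv.
have b1 : b <= 1 by lra.
pose h r := C * expR (- (kappa * r)).
have mh : measurable_fun D h by apply: measurable_funM => //; exact: measurable_expRM.
have h0 r : 0 < r -> 0 <= h r by move=> r0; exact: le_trans (kC r r0).
have hC r : 0 < r -> `|h r| <= C * expR (- (kappa * r)) by move=> r0; rewrite ger0_norm ?h0.
pose kh r := k r + h r.
have mkh : measurable_fun D kh by apply: measurable_funD.
have kh0 r : 0 < r -> 0 <= kh r.
  by move=> r0; have := kC r r0; rewrite ler_norml /kh /h => /andP[]; lra.
have khC r : 0 < r -> `|kh r| <= (2 * C) * expR (- (kappa * r)).
  move=> r0; apply: (le_trans (ler_normD _ _)); have := kC r r0; have := hC r r0.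
  by rewrite /h -mulrA; lra.
have [Ih Eh] := beta_law_ge0 a0 b0 ab1 ka0 mh h0 hC.
have [Ikh Ekh] := beta_law_ge0 a0 b0 ab1 ka0 mkh kh0 khC.
have J1 s (g : R -> R) C' : 0 < s -> measurable_fun D g ->
    (forall r, 0 < r -> `|g r| <= C' * expR (- (kappa * r))) ->
    mu.-integrable D (EFin \o (fun t => t `^ (b - 1) * g (s + t))).
  move=> s0 mg gC; apply: integrable_gamma_weight ka0 _ (shift_decay ka0 s0 gC) => //.
  exact: measurable_shift.
have J2 (g : R -> R) C' : measurable_fun D g ->
    (forall r, 0 < r -> `|g r| <= C' * expR (- (kappa * r))) ->
    mu.-integrable D (EFin \o (fun r => r `^ (a + b - 1) * g r)).
  by move=> mg gC; apply: (integrable_gamma_weight _ ab1 ka0 mg gC); exact: addr_gt0.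
transitivity (\int[mu]_(s in D) (s `^ (a - 1) * inner b kh s - s `^ (a - 1) * inner b h s)).
  apply: eq_Rintegral => s; rewrite inE /= in_itv/= andbT => s0.
  rewrite -mulrBr; congr *%R; rewrite /inner -RintegralB//; [|exact: J1 khC|exact: J1 hC].
  by apply: eq_Rintegral => t _; rewrite -mulrBr /kh addrK.
rewrite RintegralB// Eh Ekh -mulrBr; congr *%R.
rewrite -RintegralB//; [|exact: J2 khC|exact: J2 hC].
by apply: eq_Rintegral => r _; rewrite -mulrBr /kh addrK.
Qed.

End BetaLawSigned.

(** * Cauchy estimates for analytic semigroups *)

Section PlaneCalculus.
Context {R : realType}.
Local Notation mu := (@lebesgue_measure R).

(** Total differentiability at (x, y) with partial derivatives P and Q; this is what the chain rule
    along rays and circles relies on. *)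
Definition plane_derivative (U : R -> R -> R) (x y P Q : R) : Prop :=
  forall e : R, 0 < e -> exists2 d : R, 0 < d & forall h k, `|h| < d -> `|k| < d ->
    `|U (x + h) (y + k) - U x y - (h * P + k * Q)| <= e * (`|h| + `|k|).

Lemma is_derive_cvg (f : R -> R) (t l : R) :
  h^-1 * (f (h + t) - f t) @[h --> 0^'] --> l -> is_derive t 1 f l.
Proof.
move=> c.
have c' : h^-1 *: ((f \o shift t) (h *: (1 : R)) - f t) @[h --> 0^'] --> l.
  by apply: cvg_trans c; apply: near_eq_cvg; apply: nearW => h; rewrite /= scaler1.
by apply: DeriveDef; [apply/cvg_ex; exists l|exact: cvg_lim].
Qed.

Lemma is_derive_quotient (f : R -> R) (t l : R) : is_derive t 1 f l ->
  h^-1 * (f (h + t) - f t) @[h --> 0^'] --> l.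
Proof.
move=> [/cvg_ex[l' c] d]; have := cvg_lim _ c; rewrite -/('D_1 f t) d => E.
have {E} <- : l' = l by rewrite E.
by apply: cvg_trans c; apply: near_eq_cvg; apply: nearW => h; rewrite /= scaler1.
Qed.

Lemma plane_chain_rule (U : R -> R -> R) (g k : R -> R) (t g' k' P Q : R) :
  is_derive t 1 g g' -> is_derive t 1 k k' -> plane_derivative U (g t) (k t) P Q ->
  is_derive t 1 (fun s => U (g s) (k s)) (g' * P + k' * Q).
Proof.
move=> dg dk dU; have qg := is_derive_quotient dg; have qk := is_derive_quotient dk.
have cg : {for t, continuous g}.
  by apply/differentiable_continuous/derivable1_diffP; exact: (@ex_derive _ _ _ _ _ _ _ dg).
have ck : {for t, continuous k}.
  by apply/differentiable_continuous/derivable1_diffP; exact: (@ex_derive _ _ _ _ _ _ _ dk).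
have tr : (fun h => h + t) @ 0^' --> t.
  have : (fun h => h + t) @ 0 --> 0 + t by apply: cvgD; [exact: cvg_id|exact: cvg_cst].
  by rewrite add0r => c; apply: cvg_trans c; apply: cvg_app; exact: cvg_within.
apply: is_derive_cvg.
pose a h := g (h + t) - g t; pose b h := k (h + t) - k t.
have ca : a h @[h --> 0^'] --> 0.
  rewrite -[X in _ --> X](subrr (g t)); apply: cvgB; last exact: cvg_cst.
  exact: (cvg_comp _ _ tr cg).
have cb : b h @[h --> 0^'] --> 0.
  rewrite -[X in _ --> X](subrr (k t)); apply: cvgB; last exact: cvg_cst.
  exact: (cvg_comp _ _ tr ck).
have c1 : (h^-1 * a h) * P + (h^-1 * b h) * Q @[h --> 0^'] --> g' * P + k' * Q.
  by apply: cvgD; apply: cvgMl.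
pose r h := h^-1 * (U (g (h + t)) (k (h + t)) - U (g t) (k t) - (a h * P + b h * Q)).
suff c2 : r h @[h --> 0^'] --> 0.
  rewrite -[X in _ --> X]addr0.
  apply: (@cvg_trans _ ((fun h => ((h^-1 * a h) * P + (h^-1 * b h) * Q) + r h) @ 0^')).
    by apply: near_eq_cvg; apply: nearW => h; rewrite /r; ring.
  exact: cvgD.
apply/cvgrPdist_le => e e0.
(* Eventually both difference quotients are within 1 of their limits, so the sum of their absolute
   values is at most B. *)
pose B := `|g'| + `|k'| + 2.
have B0 : 0 < B by rewrite /B; have := normr_ge0 g'; have := normr_ge0 k'; lra.
have [d d0 dP] := dU (e / B) (divr_gt0 e0 B0).
have na : \forall h \near 0^', `|a h| < d by apply: cvgr0_norm_lt.
have nb : \forall h \near 0^', `|b h| < d by apply: cvgr0_norm_lt.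
have nqa : \forall h \near 0^', `|g' - h^-1 * a h| <= 1 by move/cvgrPdist_le: qg; apply.
have nqb : \forall h \near 0^', `|k' - h^-1 * b h| <= 1 by move/cvgrPdist_le: qk; apply.
near=> h.
have h0 : h != 0 by near: h; exact: nbhs_dnbhs_neq.
have ad : `|a h| < d.
  by near: h; exact: na.
have bd : `|b h| < d.
  by near: h; exact: nb.
have qa : `|h^-1 * a h| <= `|g'| + 1.
  have : `|g' - h^-1 * a h| <= 1 by near: h; exact: nqa.
  have := ler_normB g' (g' - h^-1 * a h); rewrite opprB addrCA subrr addr0; lra.
have qb : `|h^-1 * b h| <= `|k'| + 1.
  have : `|k' - h^-1 * b h| <= 1 by near: h; exact: nqb.
  have := ler_normB k' (k' - h^-1 * b h); rewrite opprB addrCA subrr addr0; lra.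
have := dP (a h) (b h) ad bd.
rewrite /a /b [g t + _]addrC subrK [k t + _]addrC subrK -/(a h) -/(b h) => le1.
rewrite sub0r normrN /r normrM.
apply: (le_trans (ler_wpM2l (normr_ge0 _) le1)).
rewrite mulrCA mulrDr -!normrM.
apply: (@le_trans _ _ (e / B * B)); last by rewrite divfK// gt_eqF.
apply: ler_wpM2l; first by rewrite divr_ge0// ltW.
by rewrite /B; lra.
Unshelve. all: end_near. Qed.

Local Notation Circle := (`[0, 2 * pi]%classic : set R).

Lemma circle_integral_linear (f f1 : R -> R -> R) (r G L : R) : 0 < r ->
  (forall rho th : R, `|rho| < r -> is_derive rho 1 (fun s : R => f s th) (f1 rho th)) ->
  (forall rho th, `|rho| < r -> `|f1 rho th| <= G) ->
  (forall rho, `|rho| < r -> continuous (f rho)) ->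
  (forall rho, 0 < rho < r -> \int[mu]_(th in Circle) f1 rho th = L) ->
  forall rho, 0 < rho < r ->
    \int[mu]_(th in Circle) f rho th = \int[mu]_(th in Circle) f 0 th + L * rho.
Proof.
move=> r0 df f1G cf f1L rho /andP[rho0 rhor].
have mC : measurable Circle by exact: measurable_itv.
have rI a : a \in `]- r, r[ -> `|a| < r by rewrite in_itv/= ltr_norml.
pose F a := \int[mu]_(th in Circle) f a th.
have If a : `|a| < r -> mu.-integrable Circle (EFin \o f a).
  move=> ar; apply: continuous_compact_integrable; first exact: segment_compact.
  exact: continuous_subspaceT (cf a ar).
have dF (a : R) : `|a| < r -> is_derive a 1 F (\int[mu]_(th in Circle) f1 a th).
  move=> ar.
  have aI : `]- r, r[%classic a by rewrite /= in_itv/= -ltr_norml.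
  have derf (th x : R) : `|x| < r -> derivable (fun s : R => f s th) x 1.
    by move=> xr; exact: (@ex_derive _ _ _ _ _ _ _ (df x th xr)).
  have d1E (th x : R) : `|x| < r -> partial1of2 f x th = f1 x th.
    by move=> xr; rewrite partial1of2E; exact: (@derive_val _ _ _ _ _ _ _ (df x th xr)).
  have H := @cvg_differentiation_under_integral R _ (measurableTypeR R) mu f Circle mC a (- r) r aI
    (fun x xI => If x (rI x xI)) (fun x th xI _ => derf th x (rI x xI)) (fun=> G).
  apply: is_derive_cvg.
  have -> : \int[mu]_(th in Circle) f1 a th = \int[mu]_(th in Circle) partial1of2 f a th.
    by apply: eq_Rintegral => th _; rewrite d1E.
  apply: H => [th||x th xI _].
  - by apply: le_trans (f1G 0 0 _); rewrite ?normr0.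
  - apply: continuous_compact_integrable; first exact: segment_compact.
    by apply: continuous_subspaceT => x; exact: cvg_cst.
  - by rewrite d1E; [exact: f1G (rI x xI)|exact: rI].
have cF (a : R) : `|a| < r -> {for a, continuous F}.
  move=> ar; apply/differentiable_continuous/derivable1_diffP.
  exact: (@ex_derive _ _ _ _ _ _ _ (dF a ar)).
have [] := @MVT R F (fun a => \int[mu]_(th in Circle) f1 a th) 0 rho rho0.
- by move=> x; rewrite in_itv/= => /andP[x0 xr]; apply: dF; rewrite gtr0_norm//; exact: lt_trans rhor.
- apply: continuous_in_subspaceT => x; rewrite inE /= in_itv/= => /andP[x0 xr].
  by apply: cF; rewrite ger0_norm//; exact: le_lt_trans rhor.
move=> x; rewrite in_itv/= => /andP[x0 xr]; rewrite f1L; last by rewrite x0 (lt_trans xr).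
by rewrite subr0 -/(F rho) -/(F 0) => /eqP; rewrite subr_eq addrC => /eqP.
Qed.

End PlaneCalculus.

Section CauchyEstimate.
Context {R : realType}.
Local Notation mu := (@lebesgue_measure R).
Local Notation Circle := (`[0, 2 * pi]%classic : set R).

(* The Cauchy-Riemann equations for U - i V, whose complex derivative is P - i Q,
   on the disc of center c and radius r, in polar coordinates. *)
Definition conjugate_pair (c r K : R) (U V P Q : R -> R -> R) : Prop :=
  forall rho th : R, `|rho| < r ->
    let x := c + rho * cos th in let y := rho * sin th in
    [/\ plane_derivative U x y (P x y) (Q x y),
        plane_derivative V x y (Q x y) (- P x y),
        `|P x y| <= K /\ `|Q x y| <= K &
        {for th, continuous (fun t => P (c + rho * cos t) (rho * sin t))} /\
        {for th, continuous (fun t => Q (c + rho * cos t) (rho * sin t))}].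

Lemma is_derive_radial (c th t : R) : is_derive t 1 (fun s : R => c + s * cos th) (cos th).
Proof.
have : is_derive t 1 (cst c + (fun s : R => cos th *: (s : R^o))) (0 + cos th *: (1 : R^o)).
  by apply: is_deriveD.
rewrite add0r /GRing.scale /= mulr1 (_ : _ + _ = (fun s => c + s * cos th))//.
by apply/funext => s; rewrite !fctE mulrC.
Qed.

Lemma is_derive_radial0 (k t : R) : is_derive t 1 (fun s : R => s * k) k.
Proof.
have : is_derive t 1 (fun s : R => k *: (s : R^o)) (k *: (1 : R^o)) by apply: is_deriveZ.
rewrite /GRing.scale /= mulr1 (_ : (fun s => k * s) = (fun s => s * k))//.
by apply/funext => s; rewrite mulrC.
Qed.

Lemma is_derive_angular_cos (c rho t : R) :
  is_derive t 1 (fun s : R => c + rho * cos s) (rho * - sin t).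
Proof.
have h : is_derive t 1 (fun s : R => rho *: (cos s : R^o)) (rho *: (- sin t : R^o)).
  by apply: is_deriveZ.
have : is_derive t 1 (cst c + (fun s : R => rho *: (cos s : R^o))) (0 + rho *: (- sin t : R^o)).
  by apply: is_deriveD.
by rewrite add0r.
Qed.

Lemma is_derive_angular_sin (rho t : R) :
  is_derive t 1 (fun s : R => rho * sin s) (rho * cos t).
Proof.
by have : is_derive t 1 (fun s : R => rho *: (sin s : R^o)) (rho *: (cos t : R^o)) by apply: is_deriveZ.
Qed.

Lemma is_derive_continuous (f : R -> R) (t l : R) : is_derive t 1 f l -> {for t, continuous f}.
Proof.
move=> h; apply/differentiable_continuous/derivable1_diffP.
exact: (@ex_derive _ _ _ _ _ _ _ h).
Qed.

Section Pair.
Variables (c r K : R) (U V P Q : R -> R -> R).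
Hypothesis r0 : 0 < r.
Hypothesis CP : conjugate_pair c r K U V P Q.

Let X (rho th : R) := c + rho * cos th.
Let Y (rho th : R) := rho * sin th.

Lemma pair_radial (rho th : R) : `|rho| < r ->
  is_derive rho 1 (fun s : R => U (X s th) (Y s th))
    (cos th * P (X rho th) (Y rho th) + sin th * Q (X rho th) (Y rho th)) /\
  is_derive rho 1 (fun s : R => V (X s th) (Y s th))
    (cos th * Q (X rho th) (Y rho th) - sin th * P (X rho th) (Y rho th)).
Proof.
move=> rr; have [dU dV _ _] := CP th rr; split.
  exact: (plane_chain_rule (is_derive_radial c th rho) (is_derive_radial0 (sin th) rho) dU).
rewrite -mulrN.
exact: (plane_chain_rule (is_derive_radial c th rho) (is_derive_radial0 (sin th) rho) dV).
Qed.

Lemma pair_angular (rho th : R) : `|rho| < r ->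
  is_derive th 1 (fun s : R => U (X rho s) (Y rho s))
    (rho * - sin th * P (X rho th) (Y rho th) + rho * cos th * Q (X rho th) (Y rho th)) /\
  is_derive th 1 (fun s : R => V (X rho s) (Y rho s))
    (rho * - sin th * Q (X rho th) (Y rho th) + rho * cos th * - P (X rho th) (Y rho th)).
Proof.
move=> rr; have [dU dV _ _] := CP th rr; split.
  exact: (plane_chain_rule (is_derive_angular_cos c rho th) (is_derive_angular_sin rho th) dU).
exact: (plane_chain_rule (is_derive_angular_cos c rho th) (is_derive_angular_sin rho th) dV).
Qed.

Lemma pair_angular_continuous (rho : R) : `|rho| < r ->
  continuous (fun th => U (X rho th) (Y rho th)) /\
  continuous (fun th => V (X rho th) (Y rho th)).
Proof.
move=> rr; split=> th; have [dU dV] := pair_angular th rr; exact: is_derive_continuous.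
Qed.

Lemma circle_cst_integral (a : R) : \int[mu]_(th in Circle) a = 2 * pi * a.
Proof.
rewrite Rintegral_cst//= lebesgue_measure_itv/= lte_fin.
by rewrite mulr_gt0 ?pi_gt0//= oppr0 addr0 mulrC.
Qed.

Lemma circle_FTC (F f : R -> R) : (forall th : R, is_derive th 1 F (f th)) ->
  continuous f -> F (2 * pi) = F 0 -> \int[mu]_(th in Circle) f th = 0.
Proof.
move=> dF cf F2; have p0 : 0 < 2 * pi :> R by rewrite mulr_gt0 ?pi_gt0.
rewrite /Rintegral (continuous_FTC2 p0 (F := F)).
- by rewrite F2 -EFinB subrr.
- exact: continuous_subspaceT.
- split => [x _||].
  + exact: (@ex_derive _ _ _ _ _ _ _ (dF x)).
  + by apply: cvg_at_right_filter; exact: is_derive_continuous (dF 0).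
  + by apply: cvg_at_left_filter; exact: is_derive_continuous (dF (2 * pi)).
- by move=> x _; rewrite derive1E; exact: (@derive_val _ _ _ _ _ _ _ (dF x)).
Qed.

Lemma cosM_bound (th : R) (a b k : R) : `|a| <= k -> `|b| <= k ->
  `|cos th * a + sin th * b| <= 2 * k.
Proof.
move=> ak bk; apply: (le_trans (ler_normD _ _)); rewrite !normrM.
have c1 : `|cos th| <= 1 by rewrite ler_norml cos_geN1 cos_le1.
have s1 : `|sin th| <= 1 by rewrite ler_norml sin_geN1 sin_le1.
have : `|cos th| * `|a| <= 1 * k by apply: ler_pM.
have : `|sin th| * `|b| <= 1 * k by apply: ler_pM.
lra.
Qed.

(** Mean value property. By the Cauchy-Riemann equations, the radial derivative of U on the circle
    of radius a is the angular derivative of - V / a, whose integral over a full turn is zero; the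
    mean is thus independent of the radius. *)
Lemma circle_mean (rho : R) : 0 < rho < r ->
  \int[mu]_(th in Circle) U (X rho th) (Y rho th) = 2 * pi * U c 0.
Proof.
pose f1 a th := cos th * P (X a th) (Y a th) + sin th * Q (X a th) (Y a th).
move=> rr.
have H1 (a th : R) : `|a| < r -> is_derive a 1 (fun s : R => U (X s th) (Y s th)) (f1 a th).
  by move=> ar; have [] := pair_radial th ar.
have H2 (a th : R) : `|a| < r -> `|f1 a th| <= 2 * K.
  by move=> ar; have [_ _ [PK QK] _] := CP th ar; exact: cosM_bound.
have H3 (a : R) : `|a| < r -> continuous (fun th => U (X a th) (Y a th)).
  by move=> ar; have [] := pair_angular_continuous ar.
have H4 (a : R) : 0 < a < r -> \int[mu]_(th in Circle) f1 a th = 0.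
  move=> /andP[a0 ar]; have aa : `|a| < r by rewrite gtr0_norm.
  apply: (circle_FTC (F := fun th => - a^-1 * V (X a th) (Y a th))).
  + move=> th; have [_ dV] := pair_angular th aa.
    have : is_derive th 1 (fun s : R => - a^-1 *: (V (X a s) (Y a s) : R^o))
      (- a^-1 *: (a * - sin th * Q (X a th) (Y a th) + a * cos th * - P (X a th) (Y a th))).
      by apply: is_deriveZ.
    rewrite /GRing.scale /= (_ : - a^-1 * _ = f1 a th)//.
    by rewrite /f1; field; rewrite gt_eqF.
  + move=> th; have [_ _ _ [cP cQ]] := CP th aa.
    apply: cvgD; apply: cvgM => //; [exact: continuous_cos|exact: continuous_sin].
  + by rewrite /X /Y mulr_natl sin2pi cos2pi sin0 cos0.
rewrite (circle_integral_linear r0 H1 H2 H3 H4 rr) mul0r addr0 -circle_cst_integral.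
by apply: eq_Rintegral => th _; rewrite /X /Y !mul0r addr0.
Qed.

End Pair.

(** [f] is the real part of e^(-i theta) (U - i V). Its radial derivative is P, whose integral over
    each circle is 2 pi P(c, 0) by the mean value property of the second pair, and its integral at
    radius 0 vanishes. Hence 2 pi rho P(c, 0) is the integral of [f] at radius rho, at most 4 pi M
    in absolute value. *)
Lemma cauchy_estimate (c r K K' M rho : R) (U V P Q P2 Q2 : R -> R -> R) : 0 < rho < r ->
  conjugate_pair c r K U V P Q -> conjugate_pair c r K' P Q P2 Q2 ->
  (forall th, `|U (c + rho * cos th) (rho * sin th)| <= M /\
              `|V (c + rho * cos th) (rho * sin th)| <= M) ->
  `|P c 0| <= 2 * M / rho.
Proof.
move=> rr; have /andP[rho0 rhor] := rr; move=> CP CP2 UVM.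
have r0 : 0 < r by exact: lt_trans rhor.
have p0 : 0 < 2 * pi :> R by rewrite mulr_gt0 ?pi_gt0.
pose X (rho th : R) := c + rho * cos th.
pose Y (rho th : R) := rho * sin th.
pose f a th := cos th * U (X a th) (Y a th) + sin th * - V (X a th) (Y a th).
pose f1 a th := P (X a th) (Y a th).
have cf a : `|a| < r -> continuous (f a).
  move=> ar th; have [cU cV] := pair_angular_continuous CP ar.
  apply: cvgD; apply: cvgM; [exact: continuous_cos|exact: cU|exact: continuous_sin|].
  by apply: cvgN; exact: cV.
have E : \int[mu]_(th in Circle) f rho th = 2 * pi * P c 0 * rho.
  have H1 (a th : R) : `|a| < r -> is_derive a 1 (fun s : R => f s th) (f1 a th).
    move=> ar; have [dU dV] := pair_radial CP th ar.
    have h1 : is_derive a 1 (fun s : R => cos th *: (U (X s th) (Y s th) : R^o))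
       (cos th *: (cos th * P (X a th) (Y a th) + sin th * Q (X a th) (Y a th))) by apply: is_deriveZ.
    have h2 : is_derive a 1 (fun s : R => - sin th *: (V (X s th) (Y s th) : R^o))
       (- sin th *: (cos th * Q (X a th) (Y a th) - sin th * P (X a th) (Y a th))) by apply: is_deriveZ.
    have := is_deriveD h1 h2.
    rewrite (_ : _ + _ = (fun s => f s th)); last first.
      by apply/funext => s; rewrite !fctE /GRing.scale /= /f mulNr mulrN.
    rewrite (_ : _ + _ = f1 a th)// /f1 /GRing.scale /=.
    transitivity ((cos th ^+ 2 + sin th ^+ 2) * P (X a th) (Y a th)); first by ring.
    by rewrite cos2Dsin2 mul1r.
  have H2 (a th : R) : `|a| < r -> `|f1 a th| <= K by move=> ar; have [_ _ [PK _] _] := CP a th ar.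
  have H4 (a : R) : 0 < a < r -> \int[mu]_(th in Circle) f1 a th = 2 * pi * P c 0.
    by move=> ar; exact: (circle_mean r0 CP2).
  rewrite (circle_integral_linear r0 H1 H2 cf H4 rr) -[RHS]add0r; congr +%R.
  apply: (circle_FTC (F := fun th => sin th * U c 0 + cos th * V c 0)).
  + move=> th.
    have : is_derive th 1 ((fun s : R => U c 0 *: (sin s : R^o)) + (fun s : R => V c 0 *: (cos s : R^o)))
      (U c 0 *: (cos th : R^o) + V c 0 *: (- sin th : R^o)) by apply: is_deriveD.
    rewrite (_ : _ + _ = (fun s => sin s * U c 0 + cos s * V c 0)); last first.
      by apply/funext => s; rewrite !fctE /GRing.scale /= mulrC [V c 0 * _]mulrC.
    rewrite (_ : _ + _ = f 0 th)// /f /X /Y !mul0r addr0 /GRing.scale /=.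
    by ring.
  + by apply: cf; rewrite normr0.
  + by rewrite mulr_natl sin2pi cos2pi sin0 cos0.
have M0 : 0 <= M by apply: le_trans (UVM 0).1.
have le1 : `|\int[mu]_(th in Circle) f rho th| <= 2 * pi * (2 * M).
  have arr : `|rho| < r by rewrite gtr0_norm.
  have If : mu.-integrable Circle (EFin \o f rho).
    apply: continuous_compact_integrable; first exact: segment_compact.
    exact: continuous_subspaceT (cf rho arr).
  have := @le_normr_Rintegral _ _ _ mu Circle (f rho) (measurable_itv _) If.
  move=> /le_trans; apply.
  rewrite -circle_cst_integral; apply: le_Rintegral => //.
  - apply: continuous_compact_integrable; first exact: segment_compact.
    apply: continuous_subspaceT => th.
    by apply: (continuous_comp (cf rho arr th)); exact: norm_continuous.
  - apply: continuous_compact_integrable; first exact: segment_compact.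
    by apply: continuous_subspaceT => x; exact: cvg_cst.
  - by move=> th _; apply: cosM_bound; rewrite ?normrN; have [] := UVM th.
move: le1; rewrite E !normrM (gtr0_norm rho0) (gtr0_norm (pi_gt0 R)) (ger0_norm (ler0n R 2)).
by rewrite -mulrA ler_pM2l// -ler_pdivlMr.
Qed.

End CauchyEstimate.

(** * Sectors in Cartesian coordinates *)

Section SectorGeometry.
Context {R : realType}.

(** The sector is given in polar coordinates, whereas the discs around real points are studied in
    Cartesian ones. The slope eta comes from continuity of atan at 0, the angle being atan (y /
    x). *)
Lemma sector_cone (theta : R) : 0 < theta -> exists2 eta : R, 0 < eta &
  forall x y, 0 < x -> `|y| < eta * x -> sector theta (x +i* y)%C.
Proof.
move=> th0.
have catan : {for 0, continuous (@atan R)} by exact: is_derive_continuous (is_derive1_atan 0).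
have /cvgrPdist_lt/(_ _ th0) := catan; rewrite atan0 => -[d /= d0 dP].
exists d => // x y x0 yx.
pose u := y / x.
have ud : `|u| < d by rewrite normf_div (gtr0_norm x0) ltr_pdivrMr.
have au : `|atan u| < theta.
  have : ball_ Num.norm 0 d u by rewrite /= sub0r normrN.
  by move=> /dP /=; rewrite sub0r normrN.
have c0 : 0 < cos (atan u).
  by rewrite cos_atan invr_gt0 sqrtr_gt0; have := sqr_ge0 u; lra.
exists (x / cos (atan u)), (atan u); split => //; first exact: divr_gt0.
have su : sin (atan u) = u * cos (atan u).
  by rewrite -[X in X * _](atanK u) /tan divfK// gt_eqF.
rewrite su divfK ?gt_eqF//; congr Complex.
by rewrite mulrCA mulrC divfK ?gt_eqF// mulrC /u divfK// gt_eqF.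
Qed.

Lemma normc_le (x y : R) : Normc.normc (x +i* y)%C <= `|x| + `|y|.
Proof.
have h : 0 <= `|x| + `|y| by rewrite addr_ge0.
rewrite /= -[leRHS](ger0_norm h) -sqrtr_sqr; apply: ler_wsqrtr.
rewrite -(real_normK (num_real x)) -(real_normK (num_real y)).
have := mulr_ge0 (normr_ge0 x) (normr_ge0 y); rewrite !expr2; lra.
Qed.

End SectorGeometry.

(** * The bound C / t for the derivative on the real axis *)

Section AnalyticDerivative.
Context {R : realType} {X : completeNormedModType R}.
Variables (theta : R) (S : R[i] -> {linear (X * X)%type -> (X * X)%type}).
Hypothesis theta0 : 0 < theta.
Hypothesis Shol : forall z, sector theta z ->
  [/\ continuous (S z), clinear (S z) & holomorphic_at S z].
Hypothesis Ssemi : forall z z', sector theta z -> sector theta z' ->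
  forall v, S (z + z') v = S z (S z' v).
Hypothesis Scont : forall theta', 0 < theta' < theta -> forall v (e : R), 0 < e ->
  exists2 d : R, 0 < d & forall z, sector theta' z -> Normc.normc z < d -> `|S z v - v| < e.

Local Notation XX := (X * X)%type.

Lemma sectorW (theta' : R) z : theta' <= theta -> sector theta' z -> sector theta z.
Proof. by move=> le [r [phi [r0 p E]]]; exists r, phi; split => //; exact: lt_le_trans le. Qed.

Lemma norm_fst_le (v : XX) : `|v.1| <= `|v|.
Proof. by rewrite [leRHS]prod_normE le_max lexx. Qed.

Lemma norm_snd_le (v : XX) : `|v.2| <= `|v|.
Proof. by rewrite [leRHS]prod_normE le_max lexx orbT. Qed.

Lemma norm_pair0 (x : X) : `|((x, 0) : XX)| = `|x|.
Proof. by rewrite prod_normE /= normr0; apply/max_idPl. Qed.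

Let ci : R[i] := (0 +i* 1)%C.

Lemma cscale_ci (v : XX) : cscale ci v = (- v.2, v.1).
Proof. by rewrite /cscale /= !scale0r !scale1r sub0r add0r. Qed.

Lemma norm_cscale_ci (v : XX) : `|cscale ci v| = `|v|.
Proof. by rewrite cscale_ci !prod_normE /= normrN maxC. Qed.

Lemma cscaleE (h k : R) (v : XX) : cscale (h +i* k)%C v = h *: v + k *: cscale ci v.
Proof. by rewrite cscale_ci /cscale /=; congr pair; rewrite /= scalerN. Qed.

(* Banach-Steinhaus on the two real factors of X * X. *)
Lemma analytic_uniform_bound (theta' : R) : 0 < theta' < theta ->
  exists d K : R, [/\ 0 < d, 0 < K &
    forall z, sector theta' z -> Normc.normc z < d -> forall v, `|S z v| <= K * `|v|].
Proof.
move=> th'; have /andP[_ th'lt] := th'.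
have key : exists d K : R, [/\ 0 < d, 0 < K & forall z, sector theta' z -> Normc.normc z < d ->
    forall x : X, `|S z (x, 0)| <= K * `|x|].
  (* Failure of the bound for d = 1 / (n + 1) and K = n + 1 gives points z_n of the subsector, of
     modulus below 1 / (n + 1), where the norm of S(z_n) on the first factor exceeds n + 1. *)
  apply: contrapT => nobound.
  have bad n : exists z, [/\ sector theta' z, Normc.normc z < n.+1%:R^-1 &
      exists x : X, n.+1%:R * `|x| < `|S z (x, 0)|].
    apply: contrapT => h; apply: nobound; exists n.+1%:R^-1, n.+1%:R; split => //.
    move=> z sz nz x; rewrite leNgt; apply/negP => lt; apply: h; exists z; split => //.
    by exists x.
  have [z zP] := choice bad.
  pose F : set (X -> XX) := [set (fun x => S (z n) (x, 0)) | n in setT].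
  have Flin n : linear (fun x : X => S (z n) (x, 0)).
    move=> a x y; rewrite -linearP /=; congr (S _ _); congr pair.
    by rewrite /= scaler0 addr0.
  have Fbd f : F f -> bounded_fun_norm f /\ linear f.
    move=> [n _ <-]; split; last exact: Flin.
    have [sz _ _] := zP n; have [cS _ _] := Shol (sectorW (ltW th'lt) sz).
    have [C C0 CS] := continuous_linear_le cS.
    move=> r; exists (C * r) => x xr; apply: (le_trans (CS _)).
    by rewrite norm_pair0 ler_wpM2l// ltW.
  have Fpt : pointwise_bounded F.
    move=> x.
    have [d d0 dP] := Scont th' ((x, 0) : XX) ltr01.
    (* Pointwise boundedness: once 1 / (n + 1) is below d, strong continuity in the subsector bounds
       S(z_n) (x, 0) by 1 + |x|; finitely many indices remain. *)
    have [C HC] : exists C, forall n, (n <= Num.truncn d^-1)%N -> `|S (z n) (x, 0)| <= C.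
      elim: (Num.truncn d^-1) => [|m [C HC]].
        by exists `|S (z 0%N) (x, 0)| => n; rewrite leqn0 => /eqP ->.
      exists (Num.max C `|S (z m.+1) (x, 0)|) => n.
      rewrite leq_eqVlt ltnS => /predU1P[->|/HC h]; rewrite le_max ?lexx ?orbT//.
      by rewrite h.
    exists (Num.max C (1 + `|x|)) => _ [n _ <-]; rewrite le_max.
    have [/HC -> //|h] := leqP n (Num.truncn d^-1); apply/orP; right.
    have [sz nz _] := zP n.
    have nd : Normc.normc (z n) < d.
      apply: (lt_le_trans nz); rewrite -[leRHS]invrK lef_pV2 ?posrE ?invr_gt0//.
      apply: ltW; apply: lt_le_trans (_ : (Num.truncn d^-1).+1%:R <= _).
        have di : 0 <= d^-1 by rewrite invr_ge0 ltW.
        by have /andP[] := truncn_itv di.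
      by rewrite ler_nat ltnS ltnW.
    have := dP _ sz nd; have := ler_normD (S (z n) (x, 0) - (x, 0)) ((x, 0) : XX).
    by rewrite subrK norm_pair0; lra.
  have [M FM] := Banach_Steinhauss Fbd Fpt 1.
  pose n := Num.truncn `|M|.
  have [_ _ [x xP]] := zP n.
  have x0 : 0 < `|x|.
    rewrite normr_gt0; apply/eqP => x0; move: xP; rewrite x0 normr0 mulr0.
    by rewrite linear0 normr0 ltxx.
  have := FM _ (imageP _ (I : setT n)) (`|x|^-1 *: x) _.
  rewrite normrZ normfV normr_id mulVf ?gt_eqF// lexx => /(_ isT).
  have -> : ((`|x|^-1 *: x, 0) : XX) = `|x|^-1 *: ((x, 0) : XX).
    by congr pair; rewrite /= scaler0.
  rewrite linearZ /= normrZ normfV normr_id ler_pdivrMl// => h.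
  have : n.+1%:R * `|x| < M * `|x| by rewrite (lt_le_trans xP)// mulrC.
  rewrite ltr_pM2r// => h2.
  have /andP[_] := truncn_itv (normr_ge0 M); rewrite -/n => h3.
  by have := ler_norm M; lra.
have [d [K [d0 K0 KP]]] := key.
exists d, (K + K); split => //; first exact: addr_gt0.
move=> z sz nz v.
have vE : v = (v.1, 0) + cscale ci (v.2, 0).
  by rewrite cscale_ci /= oppr0; case: v => v1 v2; congr pair; rewrite /= ?addr0 ?add0r.
have [_ cl _] := Shol (sectorW (ltW th'lt) sz).
rewrite {1}vE linearD /= cl (le_trans (ler_normD _ _))// norm_cscale_ci mulrDl.
by apply: lerD; apply: (le_trans (KP z sz nz _)); apply: ler_wpM2l;
  rewrite ?norm_fst_le ?norm_snd_le// ltW.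
Qed.

(* The semigroup law transports the derivative at the real point s to the translate
   of the sector by s. *)
Lemma sector_derivative (D : {linear XX -> XX}) (s : R) (zeta : R[i]) (eta : R) : 0 < s ->
  0 < eta -> (forall x y : R, 0 < x -> `|y| < eta * x -> sector theta (x +i* y)%C) ->
  (forall e : R, 0 < e -> exists2 d : R, 0 < d &
        forall h : R[i], Normc.normc h < d -> forall v : XX,
          `|S ((s +i* 0)%C + h) v - S (s +i* 0)%C v - cscale h (D v)| <= e * Normc.normc h * `|v|) ->
  sector theta zeta ->
  forall e : R, 0 < e -> exists2 d : R, 0 < d & forall h k : R, `|h| < d -> `|k| < d ->
    forall v : XX, `|S (zeta + ((s + h) +i* k)%C) v - S (zeta + (s +i* 0)%C) v
               - cscale (h +i* k)%C (S zeta (D v))| <= e * (`|h| + `|k|) * `|v|.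
Proof.
move=> s0 eta0 cone hol sz e e0.
have [cS clS _] := Shol sz; have [C C0 CS] := continuous_linear_le cS.
have [d d0 dP] := hol (e / C) (divr_gt0 e0 C0).
(* The bounds s / 2 and eta s / 2 keep s + h + i k in the cone; d / 2 for each of h and k keeps the
   modulus of h + i k below d. *)
have m0 : 0 < Num.min (d / 2) (Num.min (s / 2) (eta * (s / 2))).
  by rewrite !lt_min !divr_gt0//= mulr_gt0// divr_gt0.
exists (Num.min (d / 2) (Num.min (s / 2) (eta * (s / 2)))) => // h k.
rewrite !lt_min => /and3P[h1 h2 h3] /and3P[k1 k2 k3] v.
have sR : sector theta (s +i* 0)%C by apply: cone => //; rewrite normr0 mulr_gt0.
have sh : sector theta ((s + h) +i* k)%C.
  have hs : s / 2 < s + h by move: h2; rewrite ltr_norml => /andP[]; lra.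
  apply: cone; first by apply: lt_trans hs; rewrite divr_gt0.
  by apply: (lt_trans k3); rewrite ltr_pM2l.
rewrite !Ssemi// -clS -!linearB /=; apply: (le_trans (CS _)).
have hk : Normc.normc (h +i* k)%C < d by apply: (le_lt_trans (normc_le _ _)); lra.
have := dP _ hk v.
rewrite (_ : (s +i* 0)%C + (h +i* k)%C = ((s + h) +i* k)%C); last by rewrite -[k in RHS]add0r.
move=> le1; apply: (@le_trans _ _ (C * (e / C * Normc.normc (h +i* k)%C * `|v|))).
  by rewrite ler_wpM2l// ltW.
have -> : C * (e / C * Normc.normc (h +i* k)%C * `|v|) = e * Normc.normc (h +i* k)%C * `|v|.
  by field; rewrite gt_eqF.
by apply: ler_wpM2r => //; apply: ler_wpM2l; rewrite ?normc_le// ltW.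
Qed.

(** Since S(z - a) = S(z - a - s) S(s), differentiating at z amounts to differentiating at s. The
    partial derivatives belong to the same family of functions, with translate a + s and vector D v
    or i D v, and can be differentiated again. *)
Lemma plane_derivative_functional (phi : {linear XX -> R^o}) (D : {linear XX -> XX})
  (s a x y : R) (eta : R) (v : XX) : (forall w, `|phi w| <= `|w|) -> 0 < s ->
  0 < eta -> (forall x y : R, 0 < x -> `|y| < eta * x -> sector theta (x +i* y)%C) ->
  (forall e : R, 0 < e -> exists2 d : R, 0 < d &
        forall h : R[i], Normc.normc h < d -> forall v : XX,
          `|S ((s +i* 0)%C + h) v - S (s +i* 0)%C v - cscale h (D v)| <= e * Normc.normc h * `|v|) ->
  sector theta ((x - a - s) +i* y)%C ->
  plane_derivative (fun x y => phi (S ((x - a) +i* y)%C v)) x y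
    (phi (S ((x - (a + s)) +i* y)%C (D v))) (phi (S ((x - (a + s)) +i* y)%C (cscale ci (D v)))).
Proof.
move=> bd s0 eta0 cone hol sz e e0; rewrite opprD addrA.
have v1 : 0 < `|v| + 1 by rewrite ltr_wpDl.
have [d d0 dP] := sector_derivative s0 eta0 cone hol sz (divr_gt0 e0 v1).
exists d => // h k hd kd; have := dP h k hd kd v.
rewrite (_ : ((x - a - s) +i* y)%C + ((s + h) +i* k)%C = ((x + h - a) +i* (y + k))%C); last first.
  by congr Complex; ring.
rewrite (_ : ((x - a - s) +i* y)%C + (s +i* 0)%C = ((x - a) +i* y)%C); last first.
  by congr Complex; ring.
have [_ clS _] := Shol sz.
move=> le1.
have -> : h * phi (S ((x - a - s) +i* y)%C (D v)) + k * phi (S ((x - a - s) +i* y)%C (cscale ci (D v)))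
   = phi (cscale (h +i* k)%C (S ((x - a - s) +i* y)%C (D v))).
  by rewrite clS (cscaleE h k) linearD !linearZ.
rewrite -!linearB /=; apply: (le_trans (bd _)); apply: (le_trans le1).
rewrite mulrAC; apply: ler_wpM2r; first by rewrite addr_ge0.
by rewrite mulrAC ler_pdivrMr// ler_wpM2l ?ltW// ltrDl.
Qed.

(* |P| <= 2 M / rho for the derivative at t, where U, P, P2 are values of S at
   successive translates by t/2, t/4, t/8. *)
Lemma analytic_derivative_bound (D : R -> {linear XX -> XX}) :
  (forall s : R, 0 < s -> forall e : R, 0 < e -> exists2 d : R, 0 < d &
        forall h : R[i], Normc.normc h < d -> forall v : XX,
          `|S ((s +i* 0)%C + h) v - S (s +i* 0)%C v - cscale h (D s v)| <= e * Normc.normc h * `|v|) ->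
  (forall s : R, 0 < s -> continuous (D s) /\ clinear (D s)) ->
  exists t0 C : R, [/\ 0 < t0, 0 < C & forall t, 0 < t < t0 -> forall v,
    `|S ((t / 2) +i* 0)%C (D (t / 2) v)| <= C / t * `|v|].
Proof.
move=> hol cD.
have th2 : 0 < theta / 2 < theta by rewrite divr_gt0//= ltr_pdivrMr// ltr_pMr// ltr1n.
have [d [K [d0 K0 KP]]] := analytic_uniform_bound th2.
have [eta eta0 cone2] := sector_cone (divr_gt0 theta0 (ltr0n R 2)).
have cone x y : 0 < x -> `|y| < eta * x -> sector theta (x +i* y)%C.
  by move=> x0 yx; apply: (@sectorW (theta / 2)); [lra|exact: cone2].
(* The disc of radius del t about t, moved to the left by at most 7 t / 8, keeps its real part above
   t / 16 and its imaginary part below eta t / 32, hence stays in the cone. *)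
pose del := Num.min (1 / 32) (eta / 32).
have del0 : 0 < del by rewrite lt_min !divr_gt0.
have del1 : del <= 1 / 32 by rewrite ge_min lexx.
have del2 : del <= eta / 32 by rewrite ge_min lexx orbT.
(* For t < d / 2 the disc also stays within the modulus d of the uniform bound. The constant is 2 K
   |v| / rho on the circle of radius rho = del t / 2. *)
exists (d / 2), (4 * K / del); split; [by rewrite divr_gt0|by rewrite divr_gt0// mulr_gt0|].
move=> t /andP[t_gt0 td] v; apply: norming_le => phi bd.
pose r := del * t.
have r0 : 0 < r by rewrite mulr_gt0.
have r1 : r <= t / 32 by rewrite /r; have := ler_wpM2r (ltW t_gt0) del1; lra.
have r2 : r <= eta * (t / 32) by rewrite /r; have := ler_wpM2r (ltW t_gt0) del2; lra.
have dom (b rho th : R) : 0 <= b <= 7 / 8 * t -> `|rho| < r ->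
    0 < t + rho * cos th - b /\ `|rho * sin th| < eta * (t + rho * cos th - b) /\
    t + rho * cos th - b + `|rho * sin th| < d.
  move=> /andP[b0 bt] rr.
  have hc : `|rho * cos th| < r.
    apply: le_lt_trans rr; rewrite normrM ler_piMr// ler_norml cos_geN1 cos_le1//.
  have hs : `|rho * sin th| < r.
    apply: le_lt_trans rr; rewrite normrM ler_piMr// ler_norml sin_geN1 sin_le1//.
  move: hc; rewrite ltr_norml => /andP[hc1 hc2].
  have h1 : t / 16 < t + rho * cos th - b by lra.
  split; first by apply: lt_trans h1; rewrite divr_gt0.
  split; last by lra.
  apply: (lt_trans hs); apply: (le_lt_trans r2); rewrite ltr_pM2l//; lra.
have sec (b rho th : R) : 0 <= b <= 7 / 8 * t -> `|rho| < r ->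
    sector (theta / 2) ((t + rho * cos th - b) +i* (rho * sin th))%C.
  by move=> bt rr; have [h1 [h2 _]] := dom b rho th bt rr; exact: cone2.
have bnd (b rho th : R) (w : XX) : 0 <= b <= 7 / 8 * t -> `|rho| < r ->
    `|phi (S ((t + rho * cos th - b) +i* (rho * sin th))%C w)| <= K * `|w|.
  move=> bt rr; apply: (le_trans (bd _)); apply: KP; first exact: sec.
  have [h1 [_ h3]] := dom b rho th bt rr.
  by apply: (le_lt_trans (normc_le _ _)); rewrite (gtr0_norm h1).
pose W (b : R) (w : XX) (x y : R) : R := phi (S ((x - b) +i* y)%C w).
have fre (a s rho th : R) (w : XX) : 0 <= a -> 0 < s -> a + s <= 7 / 8 * t -> `|rho| < r ->
    plane_derivative (W a w) (t + rho * cos th) (rho * sin th)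
     (W (a + s) (D s w) (t + rho * cos th) (rho * sin th))
     (W (a + s) (cscale ci (D s w)) (t + rho * cos th) (rho * sin th)).
  move=> a0 s0 as_ rr.
  have := @plane_derivative_functional phi (D s) s a (t + rho * cos th) (rho * sin th) eta w
    bd s0 eta0 cone (hol s s0).
  apply; rewrite -addrA -opprD; apply: (@sectorW (theta / 2)); first lra.
  by apply: sec => //; rewrite as_ andbT addr_ge0// ltW.
(* Continuity on circles is obtained from one more differentiation, over the time t / 8; hence the
   restriction to b <= 3 t / 4. *)
have cts (b rho th : R) (w : XX) : 0 <= b <= 3 / 4 * t -> `|rho| < r ->
    {for th, continuous (fun a => W b w (t + rho * cos a) (rho * sin a))}.
  move=> /andP[b0 bt] rr; apply: is_derive_continuous.
  apply: (plane_chain_rule (is_derive_angular_cos t rho th) (is_derive_angular_sin rho th)).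
  apply: (fre b (t / 8)) => //; first by rewrite divr_gt0.
  lra.
have cp (a s : R) (w : XX) : 0 <= a -> 0 < s -> a + s <= 3 / 4 * t ->
    conjugate_pair t r (K * `|D s w|) (W a w) (W a (cscale ci w))
      (W (a + s) (D s w)) (W (a + s) (cscale ci (D s w))).
  move=> a0 s0 as_ rho th rr; have [_ clD] := cD s s0.
  have as7 : a + s <= 7 / 8 * t by lra.
  have asb : 0 <= a + s <= 7 / 8 * t by rewrite as7 andbT addr_ge0// ltW.
  have asc : 0 <= a + s <= 3 / 4 * t by rewrite as_ andbT addr_ge0// ltW.
  split; first exact: fre.
  - have := fre a s rho th (cscale ci w) a0 s0 as7 rr.
    rewrite clD; congr plane_derivative.
    rewrite /W (_ : cscale ci (cscale ci (D s w)) = - D s w) ?linearN//.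
    by rewrite !cscale_ci /=; case: (D s w).
  - split; first exact: bnd.
    by apply: (le_trans (bnd _ _ _ _ asb rr)); rewrite norm_cscale_ci.
  - by split; exact: cts.
have t2 : 0 < t / 2 by rewrite divr_gt0.
have t4 : 0 < t / 4 by rewrite divr_gt0.
have cp1 : conjugate_pair t r (K * `|D (t / 2) v|) (W 0 v) (W 0 (cscale ci v))
      (W (0 + t / 2) (D (t / 2) v)) (W (0 + t / 2) (cscale ci (D (t / 2) v))).
  by apply: cp => //; lra.
have cp2 : conjugate_pair t r (K * `|D (t / 4) (D (t / 2) v)|) (W (0 + t / 2) (D (t / 2) v))
    (W (0 + t / 2) (cscale ci (D (t / 2) v)))
    (W (0 + t / 2 + t / 4) (D (t / 4) (D (t / 2) v))) (W (0 + t / 2 + t / 4) (cscale ci (D (t / 4) (D (t / 2) v)))).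
  by apply: cp => //; lra.
have r2r : 0 < r / 2 < r by rewrite divr_gt0//=; lra.
have UV (th : R) : `|W 0 v (t + r / 2 * cos th) (r / 2 * sin th)| <= K * `|v| /\
    `|W 0 (cscale ci v) (t + r / 2 * cos th) (r / 2 * sin th)| <= K * `|v|.
  have b0 : 0 <= (0 : R) <= 7 / 8 * t by rewrite lexx mulr_ge0 ?divr_ge0// ltW.
  have rr : `|r / 2| < r by rewrite gtr0_norm ?divr_gt0//; lra.
  split; first exact: bnd.
  by apply: (le_trans (bnd _ _ _ _ b0 rr)); rewrite norm_cscale_ci.
have := cauchy_estimate r2r cp1 cp2 UV.
rewrite /W add0r (_ : t - t / 2 = t / 2); last by lra.
move=> le1; apply: (le_trans (ler_norm _)); apply: (le_trans le1).
rewrite /r le_eqVlt; apply/orP; left; apply/eqP; field.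
by rewrite !gt_eqF.
Qed.

End AnalyticDerivative.

Section SemigroupDerivative.
Context {R : realType} {X : completeNormedModType R}.

(** A T(t) is realised as S(t / 2) D(t / 2): real vectors are embedded as (x, 0) and the first
    component of the result is kept, so the bound on the complexification descends to X. *)
Lemma semigroup_derivative (T : R -> {linear X -> X}) : analytic_semigroup T ->
  exists (A' : R -> {linear X -> X}) (t0 C : R), [/\ 0 < t0, 0 < C,
    forall t, 0 < t -> forall x, h^-1 *: (T (h + t) x - T t x) @[h --> 0^'] --> A' t x &
    forall t, 0 < t < t0 -> forall x, `|A' t x| <= C / t * `|x|].
Proof.
move=> [_ [theta [S [/andP[theta0 _] ST Shol Ssemi Scont]]]].
have [eta eta0 cone] := sector_cone theta0.
have secR (s : R) : 0 < s -> sector theta (s +i* 0)%C.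
  by move=> s0; apply: cone => //; rewrite normr0 mulr_gt0.
have ex (s : R) : exists D : {linear (X * X)%type -> (X * X)%type}, 0 < s ->
    [/\ continuous D, clinear D & forall e : R, 0 < e -> exists2 d : R, 0 < d &
        forall h : R[i], Normc.normc h < d -> forall v : (X * X)%type,
          `|S ((s +i* 0)%C + h) v - S (s +i* 0)%C v - cscale h (D v)| <= e * Normc.normc h * `|v|].
  (* [S 0] is a placeholder for s <= 0, where no derivative is asked for. *)
  have [s0|s0] := pselect (0 < s); last by exists (S 0).
  by have [_ _ [D DP]] := Shol _ (secR s s0); exists D.
have [D DP] := choice ex.
have [||t0 [C [t00 C0 bound]]] := @analytic_derivative_bound R X theta S theta0 Shol Ssemi Scont D.
- by move=> s s0; have [_ _ h] := DP s s0; exact: h.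
- by move=> s s0; have [cD clD _] := DP s s0.
have lin (t : R) : linear (fun x : X => (S ((t / 2) +i* 0)%C (D (t / 2) (x, 0))).1 : X).
  move=> a x y; rewrite -[a *: x + y]/(((a *: x + y, 0) : (X * X)%type).1).
  have -> : ((a *: x + y, 0) : (X * X)%type) = a *: ((x, 0) : (X * X)%type) + (y, 0).
    by congr pair; rewrite /= scaler0 addr0.
  by rewrite !linearP.
exists (fun t => linear_pack (lin t)), t0, C; split => // t; last first.
  move=> tt x /=; apply: (le_trans (norm_fst_le _)); apply: (le_trans (bound t tt _)).
  by rewrite norm_pair0.
move=> t_gt0 x.
have t2 : 0 < t / 2 by rewrite divr_gt0.
have [_ _ holt] := DP _ t2.
apply/cvgrPdist_le => e e0.
have x1 : 0 < `|x| + 1 by rewrite ltr_wpDl.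
have [d d0 dP] := sector_derivative Shol Ssemi t2 eta0 cone holt (secR _ t2) (divr_gt0 e0 x1).
have m0 : 0 < Num.min d t by rewrite lt_min d0.
near=> h.
have h0 : h != 0 by near: h; exact: nbhs_dnbhs_neq.
have hd : `|h| < Num.min d t.
  near: h; apply: dnbhs0_lt => //.
move: hd; rewrite lt_min => /andP[hd ht].
have := dP h 0 hd _ ((x, 0) : (X * X)%type); rewrite normr0 => /(_ d0).
have th : 0 <= t + h by move: ht; rewrite ltr_norml => /andP[]; lra.
rewrite (_ : (t / 2 +i* 0)%C + ((t / 2 + h) +i* 0)%C = ((t + h)%:C)%C); last first.
  by congr Complex; [rewrite addrA -splitr|rewrite /= addr0].
rewrite (_ : (t / 2 +i* 0)%C + (t / 2 +i* 0)%C = (t%:C)%C); last first.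
  by congr Complex; [rewrite -splitr|rewrite /= addr0].
rewrite (ST _ th) (ST _ (ltW t_gt0)) addr0 norm_pair0 => le1.
have := le_trans (norm_fst_le _) le1.
rewrite /cscale /= scale0r subr0 => {}le1.
rewrite -[X in X - _](scalerK h0) -scalerBr normrZ normfV distrC (addrC h t).
rewrite ler_pdivrMl ?normr_gt0//; apply: (le_trans le1).
rewrite mulrAC mulrC ler_wpM2l// mulrAC ler_pdivrMr// ler_wpM2l ?ltW// ltrDl.
by [].
Unshelve. all: end_near. Qed.

End SemigroupDerivative.

(** * Negative fractional powers *)

Section SemigroupOrbits.
Context {R : realType} {X : normedModType R}.
Context (T : R -> {linear X -> X}) (hT : C0_semigroup T).

Lemma semigroup_near0 (x : X) (e : R) : 0 < e ->
  exists2 d : R, 0 < d & forall h, 0 <= h < d -> `|T h x - x| < e.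
Proof.
move=> e0; have [_ T0 _ Tc] := hT.
have /cvgrPdist_lt/(_ e e0)[d /= d0 dP] := Tc x.
exists d => // h /andP[]; rewrite le_eqVlt => /predU1P[<-|h0] hd.
  by rewrite T0 subrr normr0.
by rewrite distrC dP//= sub0r normrN gtr0_norm.
Qed.

Lemma exp_bounded_itv (M w tau : R) : exp_bounded T M w ->
  exists2 C : R, 0 < C & forall t x, 0 <= t <= tau -> `|T t x| <= C * `|x|.
Proof.
move=> hb; exists (`|M| * expR (`|w| * tau) + 1) => [|t x /andP[t0 tt]].
  by rewrite ltr_wpDl// mulr_ge0// expR_ge0.
apply: (le_trans (hb t t0 x)); apply: ler_wpM2r => //; apply: ler_wpDr => //.
apply: (@le_trans _ _ (`|M| * expR (w * t))).
  by apply: ler_wpM2r; rewrite ?expR_ge0// ler_norm.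
apply: ler_wpM2l => //; rewrite ler_expR.
apply: (@le_trans _ _ (`|w| * t)); first by rewrite ler_wpM2r// ler_norm.
exact: ler_wpM2l.
Qed.

(** Joint continuity in time and vector. Factoring out T at the smaller of the two times leaves T(|s
    - a_i|) x - x, so continuity at 0 serves on both sides; the local bound on T absorbs the moving
    vector. *)
Lemma semigroup_cvg (I : Type) (F : set_system I) {FF : Filter F} (M w s : R) (x : X)
    (a : I -> R) (y : I -> X) :
  exp_bounded T M w -> 0 <= s -> (\forall i \near F, 0 <= a i) ->
  a i @[i --> F] --> s -> y i @[i --> F] --> x ->
  T (a i) (y i) @[i --> F] --> T s x.
Proof.
move=> hb s0 na ca cy; have [_ T0 Tadd _] := hT.
have [C C0 CP] := exp_bounded_itv (s + 1) hb.
apply/cvgrPdist_lt => e e0.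
have e2 : 0 < e / 2 / C by rewrite !divr_gt0.
have [d d0 dP] := semigroup_near0 x e2.
have d1 : 0 < Num.min d 1 by rewrite lt_min d0 ltr01.
near=> n.
have an : `|s - a n| < Num.min d 1.
  by near: n; move/cvgrPdist_lt : ca; apply.
have a0 : 0 <= a n by near: n.
have yn : `|x - y n| < e / 2 / C.
  by near: n; move/cvgrPdist_lt : cy; apply.
move: an; rewrite lt_min => /andP[and an1].
have -> : T s x - T (a n) (y n) = T s x - T (a n) x + T (a n) (x - y n).
  by rewrite linearB /= addrA subrK.
rewrite (splitr e); apply: (le_lt_trans (ler_normD _ _)); apply: ler_ltD; last first.
  rewrite (le_lt_trans (CP _ _ _))//.
    by rewrite a0/=; move: an1; rewrite ltr_norml => /andP[]; lra.
  by rewrite mulrC -ltr_pdivlMr.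
have [as_|sa] := leP (a n) s.
  have -> : T s x - T (a n) x = T (a n) (T (s - a n) x - x).
    by rewrite linearB /= -Tadd ?subr_ge0// subrKC.
  rewrite (le_trans (CP _ _ _))//; first by rewrite a0 (le_trans as_)// lerDl.
  rewrite mulrC -ler_pdivlMr// ltW// dP// subr_ge0 as_/=.
  by rewrite -[s - a n]ger0_norm ?subr_ge0.
have -> : T s x - T (a n) x = - T s (T (a n - s) x - x).
  by rewrite linearB /= -Tadd ?subr_ge0 ?(ltW sa)// subrKC opprB.
rewrite normrN (le_trans (CP _ _ _))//; first by rewrite s0/= lerDl.
rewrite mulrC -ler_pdivlMr// ltW// dP// subr_ge0 (ltW sa)/=.
by rewrite -[a n - s]ger0_norm ?subr_ge0 ?(ltW sa)// distrC.
Unshelve. all: end_near. Qed.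

End SemigroupOrbits.

(** * Integration of exponentially decaying derivatives over the half-line *)

Section HalfLineFTC.
Context {R : realType}.
Local Notation mu := (@lebesgue_measure R).
Local Notation D := (`]0%R, +oo[%classic : set R).

Lemma cvg_expR_decay (kappa : R) : 0 < kappa ->
  expR (- (kappa * r)) @[r --> +oo] --> (0 : R).
Proof.
move=> k0; apply/cvgrPdist_lt => e e0; near=> r.
have r0 : 0 < r by near: r; exact: nbhs_pinfty_gt.
have kr : e^-1 < kappa * r.
  by rewrite mulrC -ltr_pdivrMr//; near: r; apply: nbhs_pinfty_gt; exact: num_real.
rewrite sub0r normrN ger0_norm ?expR_ge0// expRN invf_plt ?posrE ?expR_gt0//.
by apply: (lt_le_trans kr); rewrite (le_trans _ (expR_ge1Dx _))// lerDr.
Unshelve. all: end_near. Qed.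

(* Adding the derivative of [- C / kappa * expR (- kappa r)] makes the integrand
   nonnegative. *)
Lemma integral_derive_decay (K k : R -> R) (C kappa : R) : 0 < kappa ->
  (forall r : R, 0 <= r -> is_derive r 1 K (k r)) ->
  (forall r : R, 0 <= r -> {for r, continuous k}) ->
  (forall r, 0 <= r -> `|K r| <= C * expR (- (kappa * r))) ->
  (forall r, 0 <= r -> `|k r| <= C * expR (- (kappa * r))) ->
  \int[mu]_(r in D) k r = - K 0.
Proof.
move=> k0 dK ck bK bk; have mD : measurable (D : set (measurableTypeR R)) by [].
have main (K1 k1 : R -> R) : (forall r : R, 0 <= r -> is_derive r 1 K1 (k1 r)) ->
    (forall r : R, 0 <= r -> {for r, continuous k1}) ->
    (forall r, 0 <= r -> `|K1 r| <= C * expR (- (kappa * r))) ->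
    (forall r, 0 <= r -> `|k1 r| <= C * expR (- (kappa * r))) ->
    mu.-integrable D (EFin \o k1) /\ (\int[mu]_(r in D) (k1 r + C * expR (- (kappa * r)))%:E)%E =
      (C / kappa - K1 0)%:E.
  move=> dK1 ck1 bK1 bk1.
  have mk1 : measurable_fun D k1.
    apply: open_continuous_measurable_fun => //.
    by move=> r; rewrite inE /= in_itv/= andbT => r0; apply: ck1; exact: ltW.
  split.
    have -> : EFin \o k1 = EFin \o (fun r : R => r `^ (1 - 1) * k1 r).
      by apply/funext => r /=; rewrite subrr powRr0 mul1r.
    apply: (integrable_gamma_weight (C := C) (kappa := kappa)) => //.
    by move=> r r0; apply: bk1; exact: ltW.
  pose F r : R := K1 r - C / kappa * expR (- (kappa * r)).
  have dF (r : R) : 0 <= r -> is_derive r 1 F (k1 r + C * expR (- (kappa * r))).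
    move=> r0; have d1 := dK1 r r0.
    have d2 : is_derive r 1 (fun r : R => - (kappa * r)) (- kappa).
      have -> : (fun r : R => - (kappa * r)) = - (kappa *: (id : R -> R)) by [].
      by apply: is_derive_eq; rewrite /GRing.scale /= mulr1.
    have d3 : is_derive r 1 (fun r : R => expR (- (kappa * r))) (- kappa * expR (- (kappa * r))).
      by rewrite mulrC; exact: (is_derive1_comp (is_derive_expR _) d2).
    have -> : F = K1 - (C / kappa) *: (fun r : R => expR (- (kappa * r))) by [].
    apply: is_derive_eq; rewrite /GRing.scale /=.
    by field; rewrite gt_eqF.
  have cF0 : F x @[x --> 0^'+] --> F 0.
    have [dF1 _] := dF 0 (lexx 0).
    by apply: cvg_at_right_filter; apply: differentiable_continuous; apply/derivable1_diffP.
  transitivity ((0 : R)%:E - (F 0)%:E)%E; last first.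
    by rewrite -EFinB /F mulr0 oppr0 expR0; congr EFin; ring.
  rewrite -(@ge0_continuous_FTC2y _ (fun r => k1 r + C * expR (- (kappa * r))) F 0 0).
  - rewrite -integral_itv_obnd_cbnd//; apply/measurable_EFinP; apply: measurable_funD => //.
    by apply: measurable_funM => //; exact: measurable_expRM.
  - by move=> r r0; have := bk1 r r0; rewrite ler_norml => /andP[]; lra.
  - apply: continuous_in_subspaceT => r; rewrite inE/= in_itv/= andbT => r0.
    apply: cvgD; first exact: ck1.
    apply: cvgMr; apply: continuous_comp; last exact: continuous_expR.
    by apply: cvgN; apply: cvgMr.
  - rewrite -[X in _ --> X](subr0) -[X in _ - X](mulr0 (C / kappa)).
    apply: cvgB; last by apply: cvgMr; exact: cvg_expR_decay.
    have cC : C * expR (- (kappa * r)) @[r --> +oo] --> (0 : R).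
      by rewrite -[X in _ --> X](mulr0 C); apply: cvgMr; exact: cvg_expR_decay.
    have cC' : - (C * expR (- (kappa * r))) @[r --> +oo] --> (0 : R).
      by rewrite -[X in _ --> X]oppr0; exact: cvgN.
    apply: (squeeze_cvgr _ cC' cC); near=> r; rewrite -ler_norml; apply: bK1.
    by near: r; exact: nbhs_pinfty_ge.
  - by move=> r r0; have [] := dF r (ltW r0).
  - exact: cF0.
  - by move=> r; rewrite in_itv/= andbT => r0; rewrite derive1E; have /@derive_val := dF r (ltW r0).
have [ik ek] := main _ _ dK ck bK bk.
have C0 : 0 <= C by have := le_trans (normr_ge0 _) (bK 0 (lexx 0)); rewrite mulr0 oppr0 expR0 mulr1.
have [|||i0 e0] := main (cst 0) (cst 0).
- by move=> r _; exact: cvg_cst.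
- by move=> r _; rewrite normr0 mulr_ge0// expR_ge0.
- by move=> r _; rewrite normr0 mulr_ge0// expR_ge0.
have ie : mu.-integrable D (EFin \o (fun r => C * expR (- (kappa * r)))).
  have -> : EFin \o (fun r => C * expR (- (kappa * r))) =
      EFin \o (fun r : R => r `^ (1 - 1) * (C * expR (- (kappa * r)))).
    by apply/funext => r /=; rewrite subrr powRr0 mul1r.
  apply: (integrable_gamma_weight (C := C) (kappa := kappa)) => //.
    by apply: measurable_funM => //; exact: measurable_expRM.
  by move=> r _; rewrite ger0_norm// mulr_ge0// expR_ge0.
have {}e0 : (\int[mu]_(r in D) (C * expR (- (kappa * r)))%:E)%E = (C / kappa)%:E.
  rewrite -[C / kappa]subr0; apply: etrans e0.
  by apply: eq_integral => r _; rewrite add0r.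
move: ek; rewrite integralD_EFin// e0 /Rintegral => ek.
have fk := integrable_fin_num mD ik.
by move: ek; rewrite -(fineK fk) -EFinD => -[/=]; lra.
Unshelve. all: end_near. Qed.

End HalfLineFTC.

(** * Boundedness, product law and injectivity of the negative powers *)

Section NegPower.
Context {R : realType} {X : completeNormedModType R}.
Context (T : R -> {linear X -> X}) (omega M0 w0 : R).
Context (hT : C0_semigroup T) (hb : exp_bounded T M0 w0) (w0_lt : w0 < omega).
Local Notation mu := (@lebesgue_measure R).
Local Notation D := (`]0%R, +oo[%classic : set R).
Let mD : measurable (D : set (measurableTypeR R)). Proof. by []. Qed.

(** This is the semigroup generated by A - omega I; it decays at the rate omega - w0. *)
Definition damped (t : R) (x : X) : X := expR (- (omega * t)) *: T t x.

Lemma damped_linear (t : R) : linear (damped t).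
Proof. by move=> a x y; rewrite /damped linearP /= scalerDr !scalerA mulrC. Qed.

Lemma damped_cvg (I : Type) (F : set_system I) {FF : Filter F} (s : R) (x : X) (a : I -> R) :
  0 <= s -> (\forall i \near F, 0 <= a i) ->
  a i @[i --> F] --> s -> damped (a i) x @[i --> F] --> damped s x.
Proof.
move=> s0 a0 ca; apply: cvgZ; last by apply: (semigroup_cvg hT hb) => //; exact: cvg_cst.
by apply: continuous_cvg; [exact: continuous_expR|apply: cvgN; exact: cvgMr].
Qed.

Lemma norm_damped (t : R) (x : X) : 0 <= t ->
  `|damped t x| <= M0 * expR (- ((omega - w0) * t)) * `|x|.
Proof.
move=> t0; rewrite normrZ ger0_norm ?expR_ge0//.
rewrite (_ : - ((omega - w0) * t) = - (omega * t) + w0 * t); last by ring.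
rewrite expRD [M0 * _]mulrCA -mulrA; apply: ler_wpM2l; rewrite ?expR_ge0//; exact: hb.
Qed.

Lemma norm_bound_ge0 (x : X) : 0 <= M0 * `|x|.
Proof.
by have := le_trans (normr_ge0 _) (norm_damped x (lexx 0)); rewrite mulr0 oppr0 expR0 mulr1.
Qed.

Lemma damped_add (s t : R) (x : X) : 0 <= s -> 0 <= t ->
  damped (s + t) x = damped s (damped t x).
Proof.
move=> s0 t0; have [_ _ Tadd _] := hT.
by rewrite /damped Tadd// [T s (_ *: _)]linearZZ scalerA -expRD -opprD -mulrDr.
Qed.

Lemma strongly_measurable_damped (p : R) (x : X) :
  strongly_measurable D (fun t => t `^ p *: damped t x).
Proof.
apply: strongly_measurable_continuous => //.
  by move=> t /=; rewrite !in_itv/= !andbT; exact: ltW.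
move=> s a /=; rewrite in_itv/= andbT => s0 as_ ca; apply: cvgZ.
  have := powR_continuous_gt0 s0 (g := p); exact: cvg_comp.
by apply: damped_cvg => //; [exact: ltW|apply: nearW => n; case/andP: (as_ n)].
Qed.

Lemma measurable_damped (C : R) (x : X) (phi : {linear X -> R^o}) :
  (forall y, `|phi y| <= C * `|y|) -> measurable_fun D (fun t => phi (damped t x)).
Proof.
move=> bd; apply: open_continuous_measurable_fun => //.
move=> t; rewrite inE/= in_itv/= andbT => t0.
apply: continuous_cvg; first exact: (linear_le_continuous bd).
by apply: damped_cvg => //; [exact: ltW|near do apply: ltW; exact: lt_nbhsr].
Unshelve. all: end_near. Qed.

Lemma neg_power_integral (a : R) (x : X) : 0 < a -> a <= 1 ->
  is_bochner_integral D (fun t => t `^ (a - 1) *: damped t x)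
    (Gamma a *: neg_power T omega a x).
Proof.
move=> a0 a1; have G0 := Gamma_gt0 a0 a1.
rewrite /neg_power scalerA divff ?gt_eqF// scale1r.
rewrite (_ : (fun t => _ *: T t x) = (fun t => t `^ (a - 1) *: damped t x)); last first.
  by apply/funext => t; rewrite scalerA.
apply: bochner_integralP => //.
pose h (t : R) := t `^ (a - 1) * (M0 * `|x| * expR (- ((omega - w0) * t))).
have h0 t : 0 <= h t by rewrite mulr_ge0 ?powR_ge0// mulr_ge0 ?expR_ge0// norm_bound_ge0.
have ih : mu.-integrable D (EFin \o h).
  apply: (integrable_gamma_weight (C := M0 * `|x|) (kappa := omega - w0)) => //.
  - by rewrite subr_gt0.
  - by apply: measurable_funM => //; exact: measurable_expRM.
  - by move=> r r0; rewrite ger0_norm// mulr_ge0 ?expR_ge0// norm_bound_ge0.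
apply: (bochner_integrable_le (h := h)) => //.
- exact: strongly_measurable_damped.
- by apply/measurable_EFinP; exact: measurable_int ih.
- apply: aeW => t; rewrite /= in_itv/= andbT => t0.
  rewrite normrZ ger0_norm ?powR_ge0//; apply: ler_wpM2l; first exact: powR_ge0.
  by rewrite mulrAC; apply: norm_damped; exact: ltW.
- move/integrableP : ih => [_]; apply: le_lt_trans; rewrite le_eqVlt; apply/orP; left; apply/eqP.
  by apply: eq_integral => t _ /=; rewrite ger0_norm.
Qed.

Lemma neg_power_functional (a C : R) (x : X) (phi : {linear X -> R^o}) : 0 < a -> a <= 1 ->
  (forall y, `|phi y| <= C * `|y|) ->
  Gamma a * phi (neg_power T omega a x) =
    \int[mu]_(t in D) (t `^ (a - 1) * phi (damped t x)).
Proof.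
move=> a0 a1 bd.
have := is_bochner_integral_functionalC mD bd (neg_power_integral x a0 a1).
have <- : phi (Gamma a *: neg_power T omega a x) = Gamma a * phi (neg_power T omega a x).
  by rewrite linearZ.
by move=> ->; apply: eq_Rintegral => t _; rewrite linearZ.
Qed.

Lemma neg_power_eq (a : R) (x y : X) : 0 < a -> a <= 1 ->
  is_bochner_integral D (fun t => t `^ (a - 1) *: damped t x) (Gamma a *: y) ->
  neg_power T omega a x = y.
Proof.
move=> a0 a1 /(is_bochner_integral_uniq mD (neg_power_integral x a0 a1)).
by apply: scalerI; rewrite gt_eqF// Gamma_gt0.
Qed.

Lemma neg_power_commutes (a : R) (L : {linear X -> X}) (x : X) : 0 < a -> a <= 1 ->
  continuous L -> (forall t y, 0 < t -> L (T t y) = T t (L y)) ->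
  neg_power T omega a (L x) = L (neg_power T omega a x).
Proof.
move=> a0 a1 cL LT; apply: neg_power_eq => //.
rewrite -linearZZ; apply: is_bochner_integral_ae (is_bochner_integral_linear mD cL
  (neg_power_integral x a0 a1)) => //.
by apply: aeW => t; rewrite /= in_itv/= andbT => t0; rewrite /damped [L (_ *: _)]linearZZ [L (_ *: _)]linearZZ LT.
Qed.

Lemma neg_power_linear (a : R) : 0 < a -> a <= 1 -> linear (neg_power T omega a).
Proof.
move=> a0 a1 c x y; apply: neg_power_eq => //.
rewrite scalerDr scalerA mulrC -scalerA.
apply: is_bochner_integral_ae (is_bochner_integral_lin c mD (neg_power_integral x a0 a1)
  (neg_power_integral y a0 a1)) => //.
by apply: aeW => t _; rewrite damped_linear scalerDr (scalerA c) mulrC -scalerA.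
Qed.

Lemma neg_power_norm_le (a : R) (x : X) (h : R -> R) (c : R) : 0 < a -> a <= 1 ->
  measurable_fun D h -> (forall t, 0 < t -> `|damped t x| <= h t) ->
  (\int[mu]_(t in D) (t `^ (a - 1) * h t)%:E <= c%:E)%E ->
  Gamma a * `|neg_power T omega a x| <= c.
Proof.
move=> a0 a1 mh bh ih.
have -> : Gamma a * `|neg_power T omega a x| = `|Gamma a *: neg_power T omega a x|.
  have := Gamma_gt0 a0 a1; move: (Gamma a) => g g0.
  by rewrite [RHS]normrZ (gtr0_norm g0).
apply: (is_bochner_integral_norm_le mD (neg_power_integral x a0 a1)).
apply: le_trans ih; apply: norm_integral_le => //.
- exact: strongly_measurable_damped.
- by apply: measurable_funM => //; exact: measurable_powRW.
- apply: aeW => t; rewrite /= in_itv/= andbT => t0.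
  by rewrite normrZ ger0_norm ?powR_ge0//; apply: ler_wpM2l; rewrite ?powR_ge0// bh.
Qed.

Lemma neg_power_bounded (a : R) : 0 < a -> a <= 1 ->
  exists2 C : R, 0 < C & forall x, `|neg_power T omega a x| <= C * `|x|.
Proof.
move=> a0 a1; have k0 : 0 < omega - w0 by rewrite subr_gt0.
pose I := (\int[mu]_(t in D) (t `^ (a - 1) * expR (- ((omega - w0) * t)))%:E)%E.
have fI : I \is a fin_num.
  rewrite ge0_fin_numE ?gamma_integral_lty//; apply: integral_ge0 => t _.
  by rewrite lee_fin mulr_ge0 ?powR_ge0 ?expR_ge0.
have G0 := Gamma_gt0 a0 a1.
have I0 : 0 <= fine I.
  apply: fine_ge0; apply: integral_ge0 => t _.
  by rewrite lee_fin mulr_ge0 ?powR_ge0 ?expR_ge0.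
exists (`|M0| * fine I / Gamma a + 1) => [|x].
  by rewrite ltr_wpDl// divr_ge0 ?(ltW G0)// mulr_ge0.
rewrite mulrDl mul1r; apply: ler_wpDr => //.
rewrite -(ler_pM2l G0) [leRHS](_ : _ = `|M0| * fine I * `|x|); last by field; rewrite gt_eqF.
apply: (@neg_power_norm_le _ _ (fun t => `|M0| * `|x| * expR (- ((omega - w0) * t)))) => //.
- by apply: measurable_funM => //; exact: measurable_expRM.
- move=> t t0; apply: (le_trans (norm_damped x (ltW t0))); rewrite mulrAC.
  by apply: ler_wpM2r; rewrite ?expR_ge0//; apply: ler_wpM2r => //; exact: ler_norm.
- rewrite mulrAC EFinM (fineK fI) -ge0_integralZl//.
  + rewrite le_eqVlt; apply/orP; left; apply/eqP; apply: eq_integral => t _.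
    by rewrite -EFinM; congr EFin; ring.
  + apply/measurable_EFinP; apply: measurable_funM; first exact: measurable_powRW.
    exact: measurable_expRM.
  + by move=> t _; rewrite lee_fin mulr_ge0 ?powR_ge0 ?expR_ge0.
Qed.

Lemma neg_power_continuous (a : R) : 0 < a -> a <= 1 ->
  continuous (neg_power T omega a).
Proof.
move=> a0 a1; have [C _ CP] := neg_power_bounded a0 a1.
exact: (@linear_le_continuous _ _ _ (linear_pack (neg_power_linear a0 a1)) C).
Qed.

(** The constant is B(a, b) Gamma(a + b) / (Gamma(a) Gamma(b)), delivered by [beta_law] for each
    function r |-> phi (damped r x). Its positivity is what allows later steps to divide by it. *)
Lemma neg_power_mul (a b : R) : 0 < a -> 0 < b -> a + b <= 1 ->
  exists2 c : R, 0 < c & forall x,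
    neg_power T omega a (neg_power T omega b x) = c *: neg_power T omega (a + b) x.
Proof.
move=> a0 b0 ab1.
have a1 : a <= 1 by lra.
have b1 : b <= 1 by lra.
have ab0 : 0 < a + b by lra.
have Ga := Gamma_gt0 a0 a1; have Gb := Gamma_gt0 b0 b1; have Gab := Gamma_gt0 ab0 ab1.
have B0 := beta_const_gt0 a0 b0 b1.
have alg (p q B r u v : R) : 0 < p -> 0 < q -> p * (q * u) = B * (r * v) ->
    u = B * r / (p * q) * v.
  by move=> p0 q0 e; apply: (mulfI (lt0r_neq0 (mulr_gt0 p0 q0))); rewrite -[LHS]mulrA e; field; rewrite !gt_eqF.
have pos (p q r s : R) : 0 < p -> 0 < q -> 0 < r -> 0 < s -> 0 < p * q / (r * s).
  by move=> *; rewrite divr_gt0// mulr_gt0.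
exists (beta_const a b * Gamma (a + b) / (Gamma a * Gamma b)) => [|x]; first exact: pos.
apply: norming_eq => phi bd; have bd1 y : `|phi y| <= 1 * `|y| by rewrite mul1r.
have phiZ (c : R) y : phi (c *: y) = c * phi y by rewrite linearZ.
have [V VE bV] : exists2 V, V = Gamma b *: neg_power T omega b x &
    is_bochner_integral D (fun t => t `^ (b - 1) *: damped t x) V.
  by eexists; [reflexivity|exact: neg_power_integral].
have JV : neg_power T omega a V = Gamma b *: neg_power T omega a (neg_power T omega b x).
  rewrite VE; move: (neg_power T omega b x) => y.
  exact: (linearZZ (linear_pack (neg_power_linear a0 a1)) (Gamma b) y).
have phidamped (s : R) : 0 < s ->
    phi (damped s V) = \int[mu]_(t in D) (t `^ (b - 1) * phi (damped (s + t) x)).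
  move=> s0; have lin : linear (fun y => phi (damped s y) : R^o).
    by move=> c y z; rewrite damped_linear linearP.
  have bdl y : `|linear_pack lin y| <= M0 * expR (- ((omega - w0) * s)) * `|y|.
    by apply: (le_trans (bd _)); apply: norm_damped; exact: ltW.
  apply: etrans (is_bochner_integral_functionalC mD bdl bV) _.
  apply: eq_Rintegral => t; rewrite inE/= in_itv/= andbT => t0.
  by rewrite (damped_add _ (ltW s0) (ltW t0)); exact: (linearZZ (linear_pack lin)).
have F1 := neg_power_functional V a0 a1 bd1.
have F2 := neg_power_functional x ab0 ab1 bd1.
have F3 : \int[mu]_(t in D) (t `^ (a - 1) * phi (damped t V)) =
    beta_const a b * \int[mu]_(t in D) (t `^ (a + b - 1) * phi (damped t x)).
  rewrite -(@beta_law _ a b (M0 * `|x|) (omega - w0))//.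
  - apply: eq_Rintegral => s; rewrite inE/= in_itv/= andbT => s0.
    by rewrite phidamped.
  - by rewrite subr_gt0.
  - exact: measurable_damped bd1.
  - by move=> r r0; apply: (le_trans (bd _)); rewrite mulrAC; apply: norm_damped; exact: ltW.
have u1 : phi (neg_power T omega a V) =
    Gamma b * phi (neg_power T omega a (neg_power T omega b x)) by rewrite JV; exact: phiZ.
have F4 := etrans (congr1 ( *%R (Gamma a)) (esym u1))
  (etrans F1 (etrans F3 (congr1 ( *%R (beta_const a b)) (esym F2)))).
apply: etrans (esym (phiZ _ _)); move: F4.
by move: (Gamma a) (Gamma b) (Gamma (a + b)) Ga Gb => p q r p0 q0; exact: alg.
Qed.

Section NegPowerDerivative.
Context (A' : R -> {linear X -> X}) (t0 C : R) (t0_gt0 : 0 < t0) (C_gt0 : 0 < C).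
Context (dT : forall t, 0 < t -> forall x,
  h^-1 *: (T (h + t) x - T t x) @[h --> 0^'] --> A' t x).
Context (bA' : forall t, 0 < t < t0 -> forall x, `|A' t x| <= C / t * `|x|).

(** With A' t in the role of A T(t), this is (A - omega I) e^(- omega t) T(t), that is, minus S
    applied to the damped semigroup, where S = omega I - A. *)
Definition damped_derive (t : R) (x : X) : X :=
  expR (- (omega * t)) *: (A' t x - omega *: T t x).

Lemma damped_derive_linear (t : R) : linear (damped_derive t).
Proof.
move=> a x y; rewrite /damped_derive !(linearP (T t)) !(linearP (A' t)).
rewrite (_ : a *: A' t x + A' t y - _ =
  a *: (A' t x - omega *: T t x) + (A' t y - omega *: T t y)).
  by rewrite scalerDr !scalerA mulrC.
by rewrite scalerDr opprD addrACA scalerBr !scalerA (mulrC a).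
Qed.

Lemma damped_quotient_cvg (t : R) (x : X) : 0 < t ->
  h^-1 *: (damped (h + t) x - damped t x) @[h --> 0^'] --> damped_derive t x.
Proof.
move=> t_gt0; pose e (t : R) := expR (- (omega * t)).
have de : is_derive t 1 e (- omega * e t).
  have d2 : is_derive t 1 (fun r : R => - (omega * r)) (- omega).
    have -> : (fun r : R => - (omega * r)) = - (omega *: (id : R -> R)) by [].
    by apply: is_derive_eq; rewrite /GRing.scale /= mulr1.
  by rewrite mulrC; exact: (is_derive1_comp (is_derive_expR _) d2).
have qe : h^-1 *: (e (h + t) - e t) @[h --> 0^'] --> - omega * e t.
  have [dv <-] := de; move: dv => /cvg_ex[l dl].
  have := dl; rewrite /derive; move/cvg_lim => ->//.
  by apply: cvg_trans dl; apply: near_eq_cvg; near=> h; rewrite /= [h%:A]mulr1.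
have ce : e (h + t) @[h --> 0^'] --> e t.
  suff : - (omega * (h + t)) @[h --> 0^'] --> - (omega * t).
    by move=> c; apply: (cvg_comp _ _ c); exact: continuous_expR.
  apply: cvgN; apply: cvgMr; rewrite -[X in _ --> X]add0r.
  by apply: cvgD; [exact: nbhs_dnbhs|exact: cvg_cst].
rewrite /damped_derive scalerBr.
have -> : e t *: A' t x - e t *: (omega *: T t x) = e t *: A' t x + (- omega * e t) *: T t x.
  by rewrite scalerA mulNr scaleNr mulrC.
have c2 : (h^-1 *: (e (h + t) - e t)) *: T t x @[h --> 0^'] --> (- omega * e t) *: T t x.
  by apply: cvgZ => //; exact: cvg_cst.
have c1 : e (h + t) *: (h^-1 *: (T (h + t) x - T t x)) @[h --> 0^'] --> e t *: A' t x.
  by apply: cvgZ => //; exact: dT.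
apply: cvg_trans (cvgD c1 c2); apply: near_eq_cvg; near=> h.
rewrite -[LHS]/(e (h + t) *: (h^-1 *: (T (h + t) x - T t x)) +
  (h^-1 * (e (h + t) - e t)) *: T t x) /damped -/(e t) -/(e (h + t)).
by rewrite scalerA (mulrC (e _)) -!scalerA -scalerDr scalerBr scalerBl addrA subrK.
Unshelve. all: end_near. Qed.

Lemma damped_derive_add (s t : R) (x : X) : 0 <= s -> 0 < t ->
  damped_derive (s + t) x = damped s (damped_derive t x).
Proof.
move=> s0 t_gt0; have st0 : 0 < s + t by rewrite ltr_wpDl.
have l1 := @damped_quotient_cvg _ x st0.
have [cT _ _ _] := hT.
have cS : continuous (linear_pack (damped_linear s)).
  apply: (@linear_le_continuous _ _ _ _ (M0 * expR (- ((omega - w0) * s)))) => y.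
  exact: norm_damped.
have l2 : damped s (h^-1 *: (damped (h + t) x - damped t x)) @[h --> 0^'] -->
    damped s (damped_derive t x).
  by apply: continuous_cvg; [exact: cS|exact: damped_quotient_cvg].
apply: (cvg_unique _ l1 _) => //.
apply: cvg_trans l2; apply: near_eq_cvg; near=> h.
have ht : 0 <= h + t.
  have : `|h| < t by near: h; exact: dnbhs0_lt.
  by rewrite ltr_norml => /andP[]; lra.
rewrite addrCA (damped_add x s0 ht) (damped_add x s0 (ltW t_gt0)).
by rewrite -[damped s]/(linear_pack (damped_linear s) : X -> X) linearZZ linearB.
Unshelve. all: end_near. Qed.

Lemma damped_derive_commutes (s t : R) (x : X) : 0 <= s -> 0 < t ->
  damped_derive t (T s x) = T s (damped_derive t x).
Proof.
move=> s0 t_gt0; have [cT _ Tadd _] := hT.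
apply: (cvg_unique _ (@damped_quotient_cvg t (T s x) t_gt0) _) => //.
have l2 : T s (h^-1 *: (damped (h + t) x - damped t x)) @[h --> 0^'] -->
    T s (damped_derive t x).
  by apply: continuous_cvg; [exact: cT|exact: damped_quotient_cvg].
apply: cvg_trans l2; apply: near_eq_cvg; near=> h.
have ht : 0 <= h + t.
  have : `|h| < t by near: h; exact: dnbhs0_lt.
  by rewrite ltr_norml => /andP[]; lra.
rewrite [T s (_ *: _)]linearZZ [T s (_ - _)]linearB /damped.
rewrite 2![T s (_ *: _)]linearZZ -!Tadd ?(ltW t_gt0)//.
by rewrite (addrC s t) (addrC s (h + t)).
Unshelve. all: end_near. Qed.

(** The analytic bound covers t < t0. For larger t, [damped_derive t] is [damped (t - h0)] applied
    after the derivative at h0, and the exponential decay is dominated by 1 / t. *)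
Lemma damped_derive_bound : exists2 C' : R, 0 < C' &
  forall t x, 0 < t -> `|damped_derive t x| <= C' / t * `|x|.
Proof.
have [K K0 KP] := exp_bounded_itv t0 hb.
have [k k0] : exists2 k : R, 0 < k & k = omega - w0 by eexists; [|reflexivity]; rewrite subr_gt0.
move=> kE.
pose C1 := expR (`|omega| * t0) * (C + `|omega| * K * t0).
have C10 : 0 < C1.
  by rewrite mulr_gt0 ?expR_gt0// ltr_wpDr// mulr_ge0 ?mulr_ge0 ?(ltW K0) ?(ltW t0_gt0).
have near0 t x : 0 < t -> t < t0 -> `|damped_derive t x| <= C1 / t * `|x|.
  move=> t_gt0 tt0; rewrite normrZ ger0_norm ?expR_ge0//.
  have -> : C1 / t * `|x| = expR (`|omega| * t0) * ((C / t + `|omega| * K * t0 / t) * `|x|).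
    by rewrite /C1; field; rewrite gt_eqF.
  apply: ler_pM; rewrite ?expR_ge0//.
    rewrite ler_expR; apply: (@le_trans _ _ (`|omega| * t)).
      by rewrite -mulNr; apply: ler_wpM2r; [exact: ltW|rewrite -normrN ler_norm].
    by apply: ler_wpM2l => //; exact: ltW.
  apply: (le_trans (ler_normB _ _)); rewrite mulrDl; apply: lerD.
    by apply: bA'; rewrite t_gt0.
  rewrite normrZ -!mulrA; apply: ler_wpM2l => //.
  apply: (le_trans (KP t x _)); first by rewrite (ltW t_gt0) ltW.
  apply: ler_wpM2l; first exact: ltW.
  by rewrite mulrA ler_peMl// ler_pdivlMr// mul1r ltW.
pose h0 := t0 / 2.
have h00 : 0 < h0 by rewrite divr_gt0.
have ht0 : h0 < t0 by rewrite /h0 ltr_pdivrMr// ltr_pMr// ltr1n.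
(* Obtained from e^(- k t) <= 1 / (k t); the derivative at h0 contributes C1 / h0. *)
pose C2 := `|M0| * expR (k * h0) / k * (C1 / h0).
have C20 : 0 <= C2.
  rewrite /C2; apply: mulr_ge0; last by apply: divr_ge0; exact: ltW.
  by apply: divr_ge0; [rewrite mulr_ge0 ?expR_ge0|exact: ltW].
exists (C1 + C2) => [|t x t_gt0]; first exact: ltr_wpDr.
have [tt0|t0t] := ltP t t0.
  apply: (le_trans (near0 t x t_gt0 tt0)); apply: ler_wpM2r => //.
  by apply: ler_wpM2r; [rewrite invr_ge0 ltW|rewrite lerDl].
apply: (@le_trans _ _ (C2 / t * `|x|)); last first.
  apply: ler_wpM2r => //.
  by apply: ler_wpM2r; [rewrite invr_ge0 ltW|rewrite lerDr ltW].
have th : 0 <= t - h0 by rewrite subr_ge0 ltW// (lt_le_trans ht0).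
rewrite -[in leLHS](subrK h0 t) damped_derive_add//.
apply: (le_trans (norm_damped _ th)).
rewrite -kE; apply: (@le_trans _ _ (`|M0| * expR (- (k * (t - h0))) * (C1 / h0 * `|x|))).
  apply: (@le_trans _ _ (`|M0| * expR (- (k * (t - h0))) * `|damped_derive h0 x|)).
    by apply: ler_wpM2r => //; apply: ler_wpM2r; rewrite ?expR_ge0// ler_norm.
  by apply: ler_wpM2l; [rewrite mulr_ge0 ?expR_ge0|exact: near0].
rewrite mulrA; apply: ler_wpM2r => //.
have -> : C2 / t = `|M0| * (expR (k * h0) / (k * t)) * (C1 / h0).
  by rewrite /C2; field; rewrite !gt_eqF.
apply: ler_wpM2r; first by rewrite divr_ge0// ltW.
apply: ler_wpM2l => //.
rewrite mulrBr opprB expRD; apply: ler_wpM2l; first exact: expR_ge0.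
have kt : 0 < k * t by rewrite mulr_gt0.
rewrite expRN lef_pV2 ?posrE ?expR_gt0//.
by apply: (le_trans _ (expR_ge1Dx _)); rewrite lerDr.
Qed.

Lemma damped_derive_continuous (t : R) : 0 < t -> continuous (damped_derive t).
Proof.
have [C' C'0 CP] := damped_derive_bound; move=> t_gt0.
apply: (@linear_le_continuous _ _ _ (linear_pack (damped_derive_linear t)) (C' / t)) => x.
exact: CP.
Qed.

(** The integrand is the derivative in s of damped (s + t) x, which decays to 0 at infinity, so its
    integral is minus the value at s = 0. *)
Lemma neg_power1_derive (t : R) (x : X) : 0 < t ->
  Gamma 1 *: neg_power T omega 1 (damped_derive t x) = - damped t x.
Proof.
move=> t_gt0; pose k := omega - w0; have k0 : 0 < k by rewrite subr_gt0.
apply: norming_eq => phi bd; have bd1 y : `|phi y| <= 1 * `|y| by rewrite mul1r.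
have -> : phi (Gamma 1 *: neg_power T omega 1 (damped_derive t x)) =
   Gamma 1 * phi (neg_power T omega 1 (damped_derive t x)) by exact: (linearZZ phi).
rewrite (@neg_power_functional 1 1 _ phi ltr01 (lexx 1) bd1) linearN.
have -> : - phi (damped t x) = - phi (damped (0 + t) x) by rewrite add0r.
transitivity (\int[mu]_(s in D) phi (damped_derive (s + t) x)).
  apply: eq_Rintegral => s; rewrite inE/= in_itv/= andbT => s0.
  by rewrite subrr powRr0 mul1r damped_derive_add// ltW.
apply: (@integral_derive_decay R (fun s => phi (damped (s + t) x))
  (fun s => phi (damped_derive (s + t) x))
  (M0 * `|damped t x| + M0 * `|damped_derive t x|) k k0).
- move=> s s0; apply: is_derive_cvg.
  have st : 0 < s + t by rewrite ltr_wpDl.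
  have : phi (h^-1 *: (damped (h + (s + t)) x - damped (s + t) x)) @[h --> 0^'] -->
      phi (damped_derive (s + t) x).
    apply: continuous_cvg; first exact: (linear_le_continuous bd1).
    exact: damped_quotient_cvg.
  apply: cvg_trans; apply: near_eq_cvg; near=> h.
  by rewrite linearZ linearB /= addrA.
- move=> s s0.
  (* Splitting off the time t / 2 exhibits the derivative as an orbit of the damped semigroup
     through a fixed vector, hence as a continuous function of s. *)
  have t2 : 0 < t / 2 by rewrite divr_gt0.
  have eqn r : 0 <= r + t / 2 -> phi (damped_derive (r + t) x) =
      phi (damped (r + t / 2) (damped_derive (t / 2) x)).
    by move=> r0; rewrite -damped_derive_add// -addrA -splitr.
  have nr : \forall r \near s, 0 <= r + t / 2.
    near=> r; rewrite -lerBlDr sub0r ltW//; near: r; apply: lt_nbhsr.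
    by rewrite (lt_le_trans _ s0)// oppr_lt0.
  rewrite /prop_for /continuous_at eqn ?addr_ge0 ?(ltW t2)//.
  have : phi (damped (r + t / 2) (damped_derive (t / 2) x)) @[r --> s] -->
      phi (damped (s + t / 2) (damped_derive (t / 2) x)).
    apply: continuous_cvg; first exact: (linear_le_continuous bd1).
    apply: damped_cvg => //; first by rewrite addr_ge0// ltW.
    by apply: cvgD; [exact: cvg_id|exact: cvg_cst].
  by apply: cvg_trans; apply: near_eq_cvg; apply: filterS nr => r r0;
  exact: esym (eqn r r0).
- move=> s s0; apply: (le_trans (bd _)).
  rewrite damped_add ?(ltW t_gt0)//; apply: (le_trans (norm_damped _ s0)).
  rewrite mulrAC; apply: ler_wpM2r; rewrite ?expR_ge0// lerDl; exact: norm_bound_ge0.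
- move=> s s0; apply: (le_trans (bd _)).
  rewrite damped_derive_add//; apply: (le_trans (norm_damped _ s0)).
  rewrite mulrAC; apply: ler_wpM2r; rewrite ?expR_ge0// lerDr; exact: norm_bound_ge0.
Unshelve. all: end_near. Qed.

(** For a = 1, the inverse commutes with [damped_derive], so S^(-1) x = 0 makes damped t x vanish
    for all t > 0, and t tends to 0. For a < 1, S^(-(1-a)) S^(-a) is a positive multiple of
    S^(-1). *)
Lemma neg_power_injective (a : R) : 0 < a -> a <= 1 -> injective (neg_power T omega a).
Proof.
move=> a0 a1.
have inj1 x : neg_power T omega 1 x = 0 -> x = 0.
  move=> J0.
  have S0 t : 0 < t -> damped t x = 0.
    move=> t_gt0; apply/eqP; rewrite -oppr_eq0 -neg_power1_derive//.
    have cd := damped_derive_continuous t_gt0.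
    have := @neg_power_commutes 1 (linear_pack (damped_derive_linear t)) x ltr01 (lexx 1) cd.
    rewrite J0 linear0 => -> //; first by rewrite scaler0.
    by move=> s y s0; apply: damped_derive_commutes => //; exact: ltW.
  have c0 : damped t x @[t --> 0^'+] --> damped 0 x.
    apply: damped_cvg => //; last by apply: cvg_at_right_filter; exact: cvg_id.
    by near=> t; apply: ltW; near: t; exact: nbhs_right_gt.
  have [_ T0 _ _] := hT.
  have <- : damped 0 x = x by rewrite /damped mulr0 oppr0 expR0 scale1r T0.
  apply: (cvg_unique _ c0) => //.
  have c : (fun=> 0 : X) t @[t --> (0 : R)^'+] --> (0 : X) by exact: cvg_cst.
  apply: cvg_trans c; apply: near_eq_cvg; near=> t.
  by rewrite S0//; near: t; exact: nbhs_right_gt.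
pose J := linear_pack (neg_power_linear a0 a1).
have J0 x : neg_power T omega a x = 0 -> x = 0.
  move=> Jx; have := a1; rewrite le_eqVlt => /predU1P[aE|a_lt1].
    by apply: inj1; rewrite -aE.
  have b0 : 0 < 1 - a by rewrite subr_gt0.
  have [|c c0 cP] := neg_power_mul b0 a0; first by rewrite subrK.
  apply: inj1; move: (cP x); rewrite subrK Jx.
  have b1 : 1 - a <= 1 by rewrite gerBl ltW.
  have -> : neg_power T omega (1 - a) 0 = 0.
    exact: (linear0 (linear_pack (neg_power_linear b0 b1))).
  by move=> e; apply: (scalerI (lt0r_neq0 c0)); apply: etrans (esym e) (esym (scaler0 _ _)).
move=> x y xy; have Jxy : J (x - y) = 0.
  by rewrite linearB; apply/eqP; rewrite subr_eq0; apply/eqP; exact: xy.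
by apply/eqP; rewrite -subr_eq0; apply/eqP; exact: J0 Jxy.
Unshelve. all: end_near. Qed.

(** The dilation by 1 / t brings the integrand to a Beta kernel whose two parameters add up to 1. *)
Lemma integral_shifted_inverse (a t : R) : 0 < a -> a < 1 -> 0 < t ->
  (\int[mu]_(s in D) (s `^ (a - 1) / (s + t))%:E)%E = (t `^ (a - 1) * beta_const (1 - a) a)%:E.
Proof.
move=> a0 a1 t_gt0; have b0 : 0 < 1 - a by rewrite subr_gt0.
have mk : measurable_fun D (EFin \o beta_kernel (1 - a) a : R -> \bar R).
  by apply/measurable_EFinP; exact: measurable_beta_kernel.
have k0 (s : R) : 0 <= beta_kernel (1 - a) a s by rewrite /beta_kernel mulr_ge0 ?powR_ge0.
have t2 : t `^ (a - 2) * t = t `^ (a - 1).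
  rewrite -[X in _ * X](powRr1 (ltW t_gt0)) -powRD; first by congr (_ `^ _); ring.
  by apply/implyP => _; rewrite gt_eqF.
have ti : 0 < t^-1 by rewrite invr_gt0.
transitivity (\int[mu]_(s in D) ((t `^ (a - 2))%:E * (EFin \o beta_kernel (1 - a) a) (t^-1 * s)%R))%E.
  apply: eq_integral => s; rewrite inE/= in_itv/= andbT => s0 /=.
  rewrite -EFinM; congr EFin; rewrite /beta_kernel subrK.
  rewrite powRM ?invr_ge0 ?(ltW s0) ?(ltW t_gt0)// powR_inv1 ?addr_ge0 ?mulr_ge0 ?invr_ge0 ?ler01 ?ltW//.
  have -> : t^-1 `^ (a - 1) = (t `^ (a - 1))^-1.
    apply: (mulIf (lt0r_neq0 (powR_gt0 (a - 1) t_gt0))).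
    by rewrite mulVf ?gt_eqF ?powR_gt0// -powRM ?invr_ge0 ?ltW// mulVf ?gt_eqF// powR1.
  rewrite -t2; have := powR_gt0 (a - 2) t_gt0; move: (t `^ (a - 2)) => p p0.
  by field; rewrite !gt_eqF ?addr_gt0.
rewrite ge0_integralZl//; last 3 first.
- exact: integral_scale_measurable.
- by move=> s _; rewrite lee_fin k0.
- by rewrite lee_fin powR_ge0.
rewrite (integral_scale ti)//; last by move=> x _; rewrite lee_fin k0.
rewrite (beta_constE b0 a0) invrK -!EFinM; congr EFin.
by rewrite mulrA t2.
Qed.

(** The bound C' / (s + t) on [damped_derive (s + t)] is integrated against s^(a-1), which trades
    the singularity 1 / t for t^(a-1). *)
Lemma neg_power_derive_bound (a : R) : 0 < a -> a < 1 -> exists2 C' : R, 0 < C' &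
  forall t x, 0 < t -> `|neg_power T omega a (damped_derive t x)| <= C' * t `^ (a - 1) * `|x|.
Proof.
move=> a0 a1; have [C' C'0 CP] := damped_derive_bound.
have b0 : 0 < 1 - a by rewrite subr_gt0.
have G0 := Gamma_gt0 a0 (ltW a1).
have B0 := beta_const_gt0 b0 a0 (ltW a1).
exists (C' * beta_const (1 - a) a / Gamma a) => [|t x t_gt0].
  by rewrite divr_gt0// mulr_gt0.
have st (s : R) : 0 < s -> 0 < s + t by move=> s0; rewrite addr_gt0.
have key : Gamma a * `|neg_power T omega a (damped_derive t x)| <=
    C' * `|x| * (t `^ (a - 1) * beta_const (1 - a) a).
  apply: (@neg_power_norm_le a _ (fun s => C' * `|x| * `|s + t|^-1)) => //.
  - exact: ltW.
  - apply: measurable_funM => //.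
    apply: open_continuous_measurable_fun => // s; rewrite inE/= in_itv/= andbT => s0.
    apply: cvgV; first by rewrite normr_eq0 gt_eqF// st.
    by apply: cvg_norm; apply: cvgD; [exact: cvg_id|exact: cvg_cst].
  - move=> s s0; rewrite -damped_derive_add ?(ltW s0)//.
    by rewrite gtr0_norm ?st// mulrAC; exact: CP (st s s0).
  - rewrite EFinM -integral_shifted_inverse// -ge0_integralZl//.
    + rewrite le_eqVlt; apply/orP; left; apply/eqP; apply: eq_integral => s.
      rewrite inE/= in_itv/= andbT => s0; rewrite -EFinM gtr0_norm ?st//.
      by congr EFin; ring.
    + apply/measurable_EFinP; apply: measurable_funM; first exact: measurable_powRW.
      apply: open_continuous_measurable_fun => // s; rewrite inE/= in_itv/= andbT => s0.
      apply: cvgV; first by rewrite gt_eqF// st.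
      by apply: cvgD; [exact: cvg_id|exact: cvg_cst].
    + move=> s; rewrite /= in_itv/= andbT => s0.
      by rewrite lee_fin divr_ge0 ?powR_ge0 ?ltW ?st.
    + by rewrite lee_fin mulr_ge0// ltW.
rewrite -(ler_pM2l G0); apply: (le_trans key).
move: (Gamma a) G0 => g g0; rewrite le_eqVlt; apply/orP; left; apply/eqP.
by field; rewrite gt_eqF.
Qed.

End NegPowerDerivative.
End NegPower.

(** * Kernels with values in the domain of the fractional power *)

Section SmoothingKernels.
Context {R : realType} {X : completeNormedModType R}.

(** Extension by continuity at a single point. The approximating sequence is returned as well, so
    that identities and finer bounds can be carried to the limit where the lemma is used. *)
Lemma dense_extension (E Y : completeNormedModType R) (jE : {linear X -> E}) (L : {linear X -> Y})
    (K : R) (e : E) : 0 < K -> dense (range jE) -> (forall x, `|L x| <= K * `|jE x|) ->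
  exists y (x_ : nat -> X), [/\ jE (x_ n) @[n --> \oo] --> e, L (x_ n) @[n --> \oo] --> y &
    `|y| <= K * `|e|].
Proof.
move=> K0 dE LK.
have ex (n : nat) : exists x, `|e - jE x| < n.+1%:R^-1.
  have n0 : 0 < n.+1%:R^-1 :> R by rewrite invr_gt0.
  have [|y [/= be [x _ xy]]] := dE (ball e n.+1%:R^-1) _ (ball_open _ _).
    by exists e; exact: ballxx.
  by exists x; move: be; rewrite xy -ball_normE.
have [x_ x_e] := choice ex.
have cx : jE (x_ n) @[n --> \oo] --> e.
  apply/cvgrPdist_lt => d d0; near=> n; apply: (lt_trans (x_e n)).
  by near: n; exact: near_infty_natSinv_lt (PosNum d0).
have cL : cvgn (fun n => L (x_ n)).
  apply: cauchy_seq_cvg => d d0.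
  have dK : 0 < d / 2 / K by rewrite !divr_gt0.
  move/cvgrPdist_lt : cx => /(_ _ dK)[N _ hN]; exists N => n m Nn Nm.
  rewrite -linearB; apply: (le_lt_trans (LK _)); rewrite mulrC -ltr_pdivlMr// linearB.
  rewrite -[jE (x_ n) - _](subrKA e) (le_lt_trans (ler_normD _ _))//.
  rewrite (splitr d) mulrDl ltrD//; last exact: hN.
  by rewrite distrC; exact: hN.
exists (limn (fun n => L (x_ n))), x_; split => //.
have c2 : K * `|jE (x_ n)| @[n --> \oo] --> K * `|e| by apply: cvgMr; exact: cvg_norm.
by apply: (ler_cvg_to (cvg_norm cL) c2); apply: nearW => n.
Unshelve. all: end_near. Qed.

Lemma smoothing_kernels (T : R -> {linear X -> X}) (omega : R) : analytic_semigroup T ->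
  (growth_bound T < omega%:E)%E ->
  forall (Xm1 : completeNormedModType R) (j : {linear X -> Xm1}),
  is_extrapolation_space T omega 1 j ->
  forall Tm1 : R -> {linear Xm1 -> Xm1}, C0_semigroup Tm1 ->
  (forall t, 0 <= t -> forall x, Tm1 t (j x) = j (T t x)) ->
  forall alpha : R, 0 < alpha < 1 -> forall eps : R, 0 < eps -> alpha + eps < 1 ->
  forall (E : completeNormedModType R) (jE : {linear X -> E}),
  is_extrapolation_space T omega (1 - alpha - eps) jE ->
  forall iota : {linear E -> Xm1}, continuous iota -> (forall x, iota (jE x) = j x) ->
  exists (J : {linear X -> X}) (W : R -> {linear X -> X}) (Z : R -> {linear E -> X}) (C : R),
  [/\ [/\ forall x, neg_power T omega alpha x = J x, continuous J, injective J,
        continuous j & injective j],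
      forall t x, 0 <= t -> J (T t x) = T t (J x),
      0 < C,
      forall t x, 0 < t -> J (W t x) = T t x /\
        (t <= 1 -> `|W t x| <= C * t `^ (- alpha) * `|x|) &
      forall t e, 0 < t -> j (J (Z t e)) = Tm1 t (iota e) /\
        (t <= 1 -> `|Z t e| <= C * t `^ (- (1 - eps)) * `|e|)].
Proof.
move=> hT; have [A' [t0 [CA [t0_gt0 CA_gt0 dT bA']]]] := semigroup_derivative hT.
have [hC0 _] := hT => /ereal_inf_lt[_ [w0 [M0 hb] <-]]; rewrite lte_fin => w0_lt.
move=> Xm1 j [jn _] Tm1 hTm1 TjT alpha /andP[a0 a1] eps eps0 aeps E jE [jEn dE] iota ciota iotaj.
have b0 : 0 < 1 - alpha by rewrite subr_gt0.
have b1 : 1 - alpha < 1 by rewrite gtrBl.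
have d0 : 0 < 1 - alpha - eps by lra.
have d1 : 1 - alpha - eps <= 1 by lra.
have eps1 : eps < 1 by lra.
pose S' t := linear_pack (damped_derive_linear T omega A' t).
pose Jp a (h0 : 0 < a) (h1 : a <= 1) := linear_pack (neg_power_linear hC0 hb w0_lt h0 h1).
pose J := Jp alpha a0 (ltW a1); pose J1 := Jp 1 ltr01 (lexx 1).
pose Jb := Jp (1 - alpha) b0 (ltW b1); pose Je := Jp eps eps0 (ltW eps1).
pose Jd := Jp (1 - alpha - eps) d0 d1.
have JT a (h0 : 0 < a) (h1 : a <= 1) t x : 0 <= t -> Jp a h0 h1 (T t x) = T t (Jp a h0 h1 x).
  have [cT _ Tadd _] := hC0 => t_ge0.
  apply: (neg_power_commutes hC0 hb w0_lt x h0 h1 (cT t t_ge0)) => s y /ltW s0.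
  by rewrite -!Tadd// addrC.
have S'J a (h0 : 0 < a) (h1 : a <= 1) t x : 0 < t -> Jp a h0 h1 (S' t x) = S' t (Jp a h0 h1 x).
  move=> t_gt0; apply: (neg_power_commutes hC0 hb w0_lt x h0 h1 (L := S' t)).
    exact: (damped_derive_continuous hC0 hb w0_lt t0_gt0 CA_gt0 dT bA').
  by move=> s y /ltW s0; exact: (damped_derive_commutes omega hC0 dT y s0 t_gt0).
have Jc : continuous J by exact: (neg_power_continuous hC0 hb w0_lt a0 (ltW a1)).
have Ji : injective J.
  exact: (neg_power_injective hC0 hb w0_lt t0_gt0 CA_gt0 dT bA' a0 (ltW a1)).
have J1i : injective J1.
  exact: (neg_power_injective hC0 hb w0_lt t0_gt0 CA_gt0 dT bA' ltr01 (lexx 1)).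
have jc : continuous j.
  have [K K0 KP] := neg_power_bounded hC0 hb w0_lt ltr01 (lexx 1).
  by apply: (linear_le_continuous (C := K)) => x; rewrite jn.
(* The norm of j x is that of S^(-1) x, so injectivity of j is that of S^(-1). *)
have ji : injective j.
  move=> x y xy; apply/eqP; rewrite -subr_eq0; apply/eqP; apply: J1i; rewrite linear0.
  by apply/eqP; rewrite -normr_eq0 -[J1 _]/(neg_power T omega 1 _) -jn linearB xy subrr normr0.
have [|c c0 cP] := neg_power_mul hC0 hb w0_lt a0 b0; first by rewrite subrKC.
have [|c' c'0 c'P] := neg_power_mul hC0 hb w0_lt eps0 d0; first by lra.
have G0 : 0 < Gamma (1 : R) by exact: Gamma_gt0.
(* [q t] undoes the three scalars met on the way: c from the product law, - Gamma 1 from S^(-1)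
   composed with the derivative, and the damping e^(- omega t). *)
pose q t : R := expR (omega * t) * (- Gamma 1) / c.
have linW t : linear (fun x => q t *: Jb (S' t x)).
  by move=> a x y; rewrite !linearP /= !scalerA mulrC.
pose W t := linear_pack (linW t).
have WP t x : 0 < t -> J (W t x) = T t x.
  move=> t_gt0; rewrite -[W t x]/(q t *: Jb (S' t x)) linearZZ.
  rewrite -[J (Jb _)]/(neg_power T omega alpha (neg_power T omega (1 - alpha) _)) cP subrKC.
  have := neg_power1_derive hC0 hb w0_lt dT x t_gt0.
  rewrite -[damped_derive _ _ _ _ _]/(S' t x) => eq1.
  rewrite scalerA /q divfK ?gt_eqF// -scalerA scaleNr eq1 opprK /damped scalerA -expRD.
  by rewrite mulrC subrr expR0 scale1r.
have [K1 K10 K1P] := neg_power_derive_bound hC0 hb w0_lt t0_gt0 CA_gt0 dT bA' b0 b1.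
have [K2 K20 K2P] := neg_power_derive_bound hC0 hb w0_lt t0_gt0 CA_gt0 dT bA' eps0 eps1.
pose q1 : R := expR `|omega| * Gamma 1 / c.
have q10 : 0 < q1 by rewrite divr_gt0// mulr_gt0// expR_gt0.
have qq1 t : 0 < t <= 1 -> `|q t| <= q1.
  move=> /andP[t_gt0 t1]; rewrite /q /q1 !normrM normfV normrN (gtr0_norm G0) (gtr0_norm c0) (gtr0_norm (expR_gt0 _)).
  rewrite -!mulrA; apply: ler_wpM2r; first by rewrite divr_ge0 ?ltW.
  rewrite ler_expR; apply: (@le_trans _ _ (`|omega| * t)).
    by apply: ler_wpM2r; [exact: ltW|exact: ler_norm].
  by rewrite ler_piMr.
have Wb t x : 0 < t <= 1 -> `|W t x| <= q1 * K1 * t `^ (- alpha) * `|x|.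
  move=> tt; have /andP[t_gt0 t1] := tt.
  have -> : q1 * K1 * t `^ (- alpha) * `|x| = q1 * (K1 * t `^ (- alpha) * `|x|) by rewrite !mulrA.
  have -> : `|W t x| = `|q t| * `|Jb (S' t x)| by rewrite -[W t x]/(q t *: Jb (S' t x)) normrZ.
  apply: (ler_pM (normr_ge0 _) (normr_ge0 _) (qq1 t tt)).
  by have := K1P t x t_gt0; rewrite (_ : 1 - alpha - 1 = - alpha)//; ring.
have Wb2 t x : 0 < t -> `|W t x| <= `|q t| * (c'^-1 * K2 * t `^ (eps - 1)) * `|jE x|.
  move=> t_gt0.
  have -> : `|q t| * (c'^-1 * K2 * t `^ (eps - 1)) * `|jE x| =
    `|q t| * (c'^-1 * (K2 * t `^ (eps - 1) * `|jE x|)) by rewrite !mulrA.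
  have -> : `|W t x| = `|q t| * `|Jb (S' t x)| by rewrite -[W t x]/(q t *: Jb (S' t x)) normrZ.
  apply: ler_wpM2l => //.
  (* S^(-(1-alpha)) is split, up to c', as S^(-eps) S^(-(1-alpha-eps)). The second factor commutes
     with S' t and reproduces the norm of E; the first gives t^(eps-1). *)
  have -> : Jb (S' t x) = c'^-1 *: Je (S' t (Jd x)).
    rewrite /Jd -S'J//.
    rewrite -[Je _]/(neg_power T omega eps (neg_power T omega (1 - alpha - eps) _)) c'P.
    by rewrite scalerA mulVf ?gt_eqF// scale1r subrKC.
  rewrite normrZ gtr0_norm ?invr_gt0//; apply: ler_wpM2l; first by rewrite invr_ge0 ltW.
  by rewrite jEn; exact: K2P.
have JE x : neg_power T omega alpha x = J x by [].
have JT1 t x : 0 <= t -> J (T t x) = T t (J x) by exact: JT.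
clearbody W J q q1.
have ZE t e : exists y, 0 < t -> [/\ j (J y) = Tm1 t (iota e) &
    (t <= 1 -> `|y| <= q1 * (c'^-1 * K2) * t `^ (- (1 - eps)) * `|e|)].
  have [t_gt0|t_le0] := ltP 0 t; last by exists 0.
  have [cTm1 _ _ _] := hTm1.
  (* Adding 1 makes the constant strictly positive. The bound with [q1] is recovered below by
     passing to the limit along x_n. *)
  have K0 : 0 < (`|q t| + 1) * (c'^-1 * K2 * t `^ (eps - 1)).
    by rewrite mulr_gt0 ?ltr_wpDl// !mulr_gt0 ?invr_gt0 ?powR_gt0.
  have Wt x : `|W t x| <= (`|q t| + 1) * (c'^-1 * K2 * t `^ (eps - 1)) * `|jE x|.
    apply: (le_trans (Wb2 t x t_gt0)); apply: ler_wpM2r => //.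
    apply: ler_wpM2r; last by rewrite lerDl.
    by rewrite !mulr_ge0 ?invr_ge0 ?powR_ge0 ?ltW.
  have [y [x_ [cx cW _]]] := dense_extension e K0 dE Wt.
  exists y => _; split => [|t1].
    have c1 : j (J (W t (x_ n))) @[n --> \oo] --> j (J y).
      by apply: continuous_cvg; [exact: jc|apply: continuous_cvg; [exact: Jc|exact: cW]].
    have c2 : Tm1 t (iota (jE (x_ n))) @[n --> \oo] --> Tm1 t (iota e).
      by apply: continuous_cvg; [exact: cTm1 _ (ltW t_gt0) _|apply: continuous_cvg; [exact: ciota|]].
    apply: (cvg_unique _ c1) => //; apply: cvg_trans c2; apply: near_eq_cvg.
    by apply: nearW => n; rewrite iotaj TjT ?(ltW t_gt0)// WP.
  have c2 : q1 * (c'^-1 * K2) * t `^ (- (1 - eps)) * `|jE (x_ n)| @[n --> \oo] -->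
      q1 * (c'^-1 * K2) * t `^ (- (1 - eps)) * `|e| by apply: cvgMr; exact: cvg_norm.
  apply: (ler_cvg_to (cvg_norm cW) c2).
  apply: nearW => n; apply: (le_trans (Wb2 t _ t_gt0)); apply: ler_wpM2r => //.
  rewrite opprB -[leRHS]mulrA; apply: ler_wpM2r; last by apply: qq1; rewrite t_gt0.
  by rewrite !mulr_ge0 ?invr_ge0 ?powR_ge0 ?ltW.
have [Z0 Z0P] := choice (fun p : R * E => ZE p.1 p.2).
(* The value 0 for t <= 0 makes [Z1 t] linear for every t. For t > 0 linearity is that of Tm1 t o
   iota, transported back through the injective maps j and J. *)
pose Z1 t e : X := if 0 < t then Z0 (t, e) else 0.
have linZ t : linear (Z1 t).
  move=> a e e'; rewrite /Z1; have [t_gt0|_] := ltP 0 t; last by rewrite scaler0 addr0.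
  have ZP e0 : j (J (Z0 (t, e0))) = Tm1 t (iota e0) := (Z0P (t, e0) t_gt0).1.
  apply: Ji; apply: ji.
  by rewrite ZP (linearP J) (linearP j) !ZP (linearP iota) (linearP (Tm1 t)).
exists J, W, (fun t => linear_pack (linZ t)), (q1 * K1 + q1 * (c'^-1 * K2)).
split; [by []|exact: JT1|..].
- by rewrite addr_gt0// !mulr_gt0// invr_gt0.
- move=> t x t_gt0; split; first exact: WP.
  move=> t1; apply: (@le_trans _ _ (q1 * K1 * t `^ (- alpha) * `|x|)); first by apply: Wb; rewrite t_gt0.
  apply: ler_wpM2r => //; apply: ler_wpM2r; first exact: powR_ge0.
  by rewrite lerDl !mulr_ge0 ?invr_ge0 ?ltW.
- move=> t e t_gt0; rewrite /= /Z1 t_gt0; have [eq1 le1] := Z0P (t, e) t_gt0.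
  split => // t1; apply: (le_trans (le1 t1)).
  apply: ler_wpM2r => //; apply: ler_wpM2r; first exact: powR_ge0.
  by rewrite lerDr mulr_ge0 ?ltW.
Qed.

End SmoothingKernels.

Lemma bochner_integral_point {R : realType} {Y : completeNormedModType R} (g : R -> Y) (a : R) :
  bochner_integrable `[a, a] g -> bochner_integral `[a, a] g = 0.
Proof.
move=> /bochner_integralP b; apply/eqP; rewrite -normr_le0.
apply: is_bochner_integral_norm_le (b _) _ => //.
by rewrite set_itv1 integral_set1.
Qed.

Lemma powR_small {R : realType} (k a e : R) : 0 < a -> 0 <= k -> 0 < e ->
  exists2 d : R, 0 < d & forall r, 0 <= r < d -> k * r `^ a < e.
Proof.
move=> a0 k0 e0; have k1 : 0 < k + 1 by rewrite ltr_wpDl.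
have ek : 0 < e / (k + 1) by rewrite divr_gt0.
exists ((e / (k + 1)) `^ a^-1) => [|r /andP[r0 rd]]; first exact: powR_gt0.
apply: (@le_lt_trans _ _ ((k + 1) * r `^ a)).
  by apply: ler_wpM2r; [exact: powR_ge0|rewrite lerDl].
rewrite mulrC -ltr_pdivlMr//.
have -> : e / (k + 1) = ((e / (k + 1)) `^ a^-1) `^ a.
  by rewrite -powRrM mulVf ?gt_eqF// powRr1// ltW.
by apply: gt0_ltr_powR => //; rewrite nnegrE ?powR_ge0.
Qed.

(** * Convolutions with singular kernels *)

Section KernelWeight.
Context {R : realType}.
Local Notation mu := (@lebesgue_measure R).
Implicit Types a s t gamma : R.

Lemma ae_neq a : {ae mu, forall s, s != a}.
Proof.
exists [set a]; split => //; first exact: lebesgue_measure_set1.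
by move=> s /= /negP; rewrite negbK => /eqP.
Qed.

Lemma kernel_weight_measurable gamma (A : set R) t :
  measurable_fun A (fun s : R => (t - s) `^ (- gamma)).
Proof.
apply: (@measurable_funS _ _ _ _ setT) => //.
apply: (@measurableT_comp _ _ _ _ _ _ (@powR R ^~ (- gamma)) _ (fun s : R => t - s)).
  exact: measurable_powRW.
by apply: measurable_funB => //; exact: measurable_cst.
Qed.

Lemma kernel_weight_integral gamma a t : gamma < 1 -> a <= t ->
  (\int[mu]_(s in `]a, t]) ((t - s) `^ (- gamma))%R%:E = ((t - a) `^ (1 - gamma) / (1 - gamma))%:E)%E.
Proof.
move=> gamma_lt1; rewrite le_eqVlt => /predU1P[<-|a_lt].
  by rewrite set_itv_ge ?bnd_simp ?ltxx// integral_set0 subrr powR0 ?mul0r// subr_eq0 gt_eqF.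
rewrite -integral_itv_bndo_bndc; first exact: integral_powR_kernel.
by apply/measurable_EFinP; exact: kernel_weight_measurable.
Qed.

Lemma kernel_weight_lty gamma t : gamma < 1 -> 0 <= t ->
  (\int[mu]_(s in `[0%R, t]) ((t - s) `^ (- gamma))%R%:E < +oo)%E.
Proof.
move=> gamma_lt1 t0; rewrite -integral_itv_obnd_cbnd ?kernel_weight_integral ?ltry//.
by apply/measurable_EFinP; exact: kernel_weight_measurable.
Qed.

End KernelWeight.

Section SingularConvolution.
Context {R : realType} {V X : completeNormedModType R}.
Local Notation mu := (@lebesgue_measure R).
Context (T : R -> {linear X -> X}) (M lambda : R).
Context (hT : C0_semigroup T) (hb : exp_bounded T M lambda).
Context (K : R -> {linear V -> X}) (C gamma : R) (C_gt0 : 0 < C) (gamma_lt1 : gamma < 1).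
Context (KC : forall t v, 0 < t <= 1 -> `|K t v| <= C * t `^ (- gamma) * `|v|).
Context (KT : forall s t v, 0 <= s -> 0 < t -> K (s + t) v = T s (K t v)).
Implicit Types (h : R -> V) (a s t H : R).

(** Continuity in time comes from the covariance [KT]: for a_n <= s one has K(t - a_n) = T(s - a_n)
    K(t - s), so it is inherited from T on the side from which [step] approaches s. *)
Lemma kernel_cvg t (a_ : nat -> R) (y_ : nat -> V) s (y : V) : 0 <= s < t -> t <= 1 ->
  (forall n, 0 <= a_ n <= s) -> a_ n @[n --> \oo] --> s -> y_ n @[n --> \oo] --> y ->
  K (t - a_ n) (y_ n) @[n --> \oo] --> K (t - s) y.
Proof.
move=> /andP[s0 st] t1 as_ ca cy; have ts0 : 0 < t - s by rewrite subr_gt0.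
have cK : continuous (K (t - s)).
  apply: (linear_le_continuous (C := C * (t - s) `^ (- gamma))) => v.
  by apply: KC; rewrite ts0/=; lra.
have [_ T0 _ _] := hT.
have -> : (fun n => K (t - a_ n) (y_ n)) = fun n => T (s - a_ n) (K (t - s) (y_ n)).
  apply/funext => n; have /andP[_ ans] := as_ n.
  by rewrite -KT ?subr_ge0//; congr (K _ _); ring.
rewrite -[X in _ --> X]T0; apply: (semigroup_cvg hT hb) => //.
- by apply: nearW => n; have /andP[_ ans] := as_ n; rewrite subr_ge0.
- by rewrite -[X in _ --> X](subrr s); apply: cvgB => //; exact: cvg_cst.
- by apply: continuous_cvg => //; exact: cK.
Qed.

Lemma convolution_measurable (D : set R) h t : 0 <= t <= 1 -> measurable D -> D `<=` `[0, t] ->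
  strongly_measurable D h -> strongly_measurable D (fun s => K (t - s) (h s)).
Proof.
move=> /andP[t0 t1] mD Dt mh.
apply: (strongly_measurable_comp (G := fun s v => K (t - s) v)) => //.
  by move=> s /Dt /=; rewrite !in_itv/= andbT => /andP[].
apply: ae_sub (ae_neq t) => s st /Dt /=; rewrite in_itv/= => /andP[s0 s_le] a_ y_ *.
by apply: kernel_cvg => //; rewrite s0 lt_neqAle st.
Qed.

Lemma convolution_weight_le (D : set R) h H t : 0 <= t <= 1 -> D `<=` `[0, t] ->
  {ae mu, forall s, D s -> `|h s| <= H} ->
  {ae mu, forall s, D s -> `|K (t - s) (h s)| <= C * H * (t - s) `^ (- gamma)}.
Proof.
move=> /andP[t0 t1] Dt hH; apply: ae_sub2 (ae_neq t) hH => s st hs Ds.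
have := Dt _ Ds; rewrite /= in_itv/= => /andP[s0 s_le].
have s_lt : s < t by rewrite lt_neqAle st.
apply: (le_trans (KC _ _)); first by rewrite subr_gt0 s_lt/=; lra.
rewrite -mulrA -[leRHS]mulrA; apply: ler_wpM2l; first exact: ltW.
by rewrite mulrC; apply: ler_wpM2r; [exact: powR_ge0|exact: hs].
Qed.

Lemma convolution_norm_le h H a t (v : X) : 0 <= a <= t -> t <= 1 -> 0 <= H ->
  strongly_measurable `]a, t] h -> {ae mu, forall s, s \in `]a, t] -> `|h s| <= H} ->
  is_bochner_integral `]a, t] (fun s => K (t - s) (h s)) v ->
  `|v| <= C * H * ((t - a) `^ (1 - gamma) / (1 - gamma)).
Proof.
move=> /andP[a0 at_] t1 H0 mh hH bv.
have sub : `]a, t]%classic `<=` `[0, t]%classic.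
  by move=> s /=; rewrite !in_itv/= => /andP[/(le_lt_trans a0)/ltW -> ->].
have tt : 0 <= t <= 1 by rewrite (le_trans a0 at_).
apply: is_bochner_integral_norm_le bv _ => //.
rewrite EFinM -(kernel_weight_integral gamma_lt1 at_) -ge0_integralZl//; last 3 first.
- by apply/measurable_EFinP; exact: kernel_weight_measurable.
- by move=> s _; rewrite lee_fin powR_ge0.
- by rewrite lee_fin mulr_ge0// ltW.
apply: norm_integral_le => //.
- exact: convolution_measurable.
- by apply: measurable_funM => //; exact: kernel_weight_measurable.
- exact: convolution_weight_le.
Qed.

Lemma convolution_integrable h H t : 0 <= t <= 1 -> 0 <= H ->
  strongly_measurable `[0, t] h -> {ae mu, forall s, s \in `[0, t] -> `|h s| <= H} ->
  bochner_integrable `[0, t] (fun s => K (t - s) (h s)).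
Proof.
move=> tt H0 mh hH; have /andP[t0 t1] := tt.
apply: (bochner_integrable_le (h := fun s => C * H * (t - s) `^ (- gamma))) => //.
- exact: convolution_measurable.
- by apply: measurable_funM => //; exact: kernel_weight_measurable.
- exact: convolution_weight_le.
- under eq_integral do rewrite EFinM.
  rewrite ge0_integralZl//; last 3 first.
  + by apply/measurable_EFinP; exact: kernel_weight_measurable.
  + by move=> s _; rewrite lee_fin powR_ge0.
  + by rewrite lee_fin mulr_ge0// ltW.
  by rewrite lte_mul_pinfty ?kernel_weight_lty// lee_fin mulr_ge0// ltW.
Qed.

(** By [KT], K(t - s) = T(t - a) K(a - s) for s < a: the past up to a enters through T(t - a), and
    what remains is an integral over ]a, t]. *)
Lemma convolution_split h a t (v : X) : 0 <= a <= t -> t <= 1 ->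
  is_bochner_integral `[0, t] (fun s => K (t - s) (h s)) v ->
  bochner_integrable `[0, a] (fun s => K (a - s) (h s)) ->
  exists2 w : X, is_bochner_integral `]a, t] (fun s => K (t - s) (h s)) w &
    v = T (t - a) (bochner_integral `[0, a] (fun s => K (a - s) (h s))) + w.
Proof.
move=> /andP[a0 at_] t1 bv /bochner_integralP ba.
have [cT _ _ _] := hT.
have UE : `[0, a]%classic `|` `]a, t]%classic = `[0, t]%classic :> set R.
  apply/seteqP; split=> s /=; rewrite !in_itv/=.
    by case=> /andP[s0 sa]; [rewrite s0 (le_trans sa)|rewrite (le_trans a0 (ltW s0))].
  by move=> /andP[s0 st]; case: (leP s a) => sa; [left; rewrite s0|right].
have [w bw] : bochner_integrable `]a, t] (fun s => K (t - s) (h s)).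
  apply: (bochner_integrableS (D := `[0, t])) => //; last by exists v.
  by rewrite -UE; exact: subsetUr.
exists w => //.
rewrite -UE in bv; apply: is_bochner_integralU bv => //.
  rewrite disj_set2E; apply/eqP; rewrite -subset0 => s /=; rewrite !in_itv/=.
  by move=> [/andP[_ sa] /andP[/lt_le_trans/(_ sa)]]; rewrite ltxx.
have cTa : continuous (T (t - a)) by apply: cT; rewrite subr_ge0.
have := is_bochner_integral_linear _ cTa (ba _).
move=> /(_ (measurable_itv _) (measurable_itv _)); apply: is_bochner_integral_ae => //.
apply: ae_sub (ae_neq a) => s sa /=; rewrite in_itv/= => /andP[s0 s_le].
by rewrite -KT ?subr_ge0 ?subr_gt0 ?lt_neqAle ?sa//; congr (K _ _); ring.
Qed.

Lemma convolution_bound h H t (v : X) : 0 <= t <= 1 -> 0 <= H ->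
  strongly_measurable `[0, t] h -> {ae mu, forall s, s \in `[0, t] -> `|h s| <= H} ->
  is_bochner_integral `[0, t] (fun s => K (t - s) (h s)) v ->
  `|v| <= C * H * (t `^ (1 - gamma) / (1 - gamma)).
Proof.
move=> tt H0 mh hH bv; have /andP[t0 t1] := tt.
have sub : `]0, t]%classic `<=` `[0, t]%classic.
  by move=> s /=; rewrite !in_itv/= => /andP[/ltW -> ->].
have sub0 : `[0, 0]%classic `<=` `[0, t]%classic.
  by move=> s /=; rewrite !in_itv/= => /andP[-> /le_trans ->].
have i0 : bochner_integrable `[0, 0] (fun s => K (0 - s) (h s)).
  apply: (convolution_integrable (H := H)); rewrite ?lexx ?ler01//.
    exact: strongly_measurableS mh.
  by apply: ae_sub hH => s h1 /sub0; exact: h1.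
have [|w bw ->] := convolution_split (a := 0) _ t1 bv i0; first by rewrite lexx.
rewrite (bochner_integral_point i0) linear0 add0r.
rewrite -[in leRHS](subr0 t); apply: convolution_norm_le bw => //; rewrite ?lexx//.
  exact: strongly_measurableS mh.
by apply: ae_sub hH => s h1 /sub; exact: h1.
Qed.

(** Near t0 the integral is compared with T(t - a) psi(a) for a fixed a slightly to the left of t0:
    this orbit is continuous in t, and the remainder over ]a, t] is of order (t - a)^(1 - gamma). *)
Lemma convolution_continuous h H (tau : R) : tau <= 1 -> 0 <= H ->
  strongly_measurable `[0, tau] h -> {ae mu, forall s, s \in `[0, tau] -> `|h s| <= H} ->
  {within `[0, tau], continuous (fun t => bochner_integral `[0, t] (fun s => K (t - s) (h s)))}.
Proof.
move=> tau1 H0 mh hH; pose psi t := bochner_integral `[0, t] (fun s => K (t - s) (h s)).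
have sub t : t <= tau -> `[0, t]%classic `<=` `[0, tau]%classic.
  by move=> tt s /=; rewrite !in_itv/= => /andP[-> /le_trans ->].
have mht t : t <= tau -> strongly_measurable `[0, t] h 
  by move=> /sub tt; exact: strongly_measurableS mh.
have hHt t : t <= tau -> {ae mu, forall s, s \in `[0, t] -> `|h s| <= H}.
  by move=> tt; apply: ae_sub hH => s h1 /(sub _ tt); exact: h1.
have it t : 0 <= t <= tau -> bochner_integrable `[0, t] (fun s => K (t - s) (h s)).
  move=> /andP[t0 tt]; apply: (convolution_integrable (H := H)); [by rewrite t0 (le_trans tt)| | |]; auto.
have tail a t : 0 <= a <= t -> t <= tau ->
    `|psi t - T (t - a) (psi a)| <= C * H * ((t - a) `^ (1 - gamma) / (1 - gamma)).
  move=> att tt; have /andP[a0 at_] := att.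
  have [||w bw e] := convolution_split (v := psi t) (h := h) att (le_trans tt tau1).
  - by apply: bochner_integralP => //; apply: it; rewrite (le_trans a0).
  - by apply: it; rewrite a0 (le_trans at_).
  rewrite e addrAC subrr add0r; apply: convolution_norm_le bw => //.
  - exact: le_trans tau1.
  - apply: strongly_measurableS mh => s /=; rewrite !in_itv/= => /andP[/ltW/(le_trans a0) -> /le_trans]; exact.
  - by apply: ae_sub hH => s h1; rewrite in_itv/= => /andP[/ltW/(le_trans a0) s0 /le_trans st];
      apply: h1; rewrite in_itv/= s0 st.
apply/subspace_continuousP => t0; rewrite /= in_itv/= => /andP[t00 t0tau].
apply/cvgrPdist_lt => e e0.
have g0 : 0 < 1 - gamma by rewrite subr_gt0.
have k0 : 0 <= C * H / (1 - gamma) by rewrite divr_ge0 ?mulr_ge0// ltW.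
have [d d0 dP] := powR_small g0 k0 (divr_gt0 e0 (ltr0Sn _ 2)).
have {}dP r : 0 <= r < d -> C * H * (r `^ (1 - gamma) / (1 - gamma)) < e / 3.
  by move=> /dP; rewrite mulrAC mulrA.
(* The choice max(0, t0 - d / 2) includes the case t0 = 0; every t of the interval close enough to
   t0 then satisfies a <= t and t - a < d. *)
have [a a0 [at0 ad2 aE]] : exists2 a : R, 0 <= a & [/\ a <= t0, t0 - d / 2 <= a &
    forall t, 0 <= t -> t0 - d / 2 < t -> a <= t].
  exists (Num.max 0 (t0 - d / 2)); rewrite ?le_max ?lexx//; split; first by rewrite ge_max t00; lra.
    by rewrite orbT.
  by move=> t t_ge0 t_gt; rewrite ge_max t_ge0 ltW.
pose F := within `[0, tau]%classic (nbhs t0).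
have nt : \forall t \near F, 0 <= t <= tau.
  by rewrite near_withinE; apply: nearW => t; rewrite /= in_itv.
have na : \forall t \near F, a <= t.
  rewrite near_withinE; near=> t => /=; rewrite in_itv/= => /andP[t_ge0 _]; apply: aE => //.
  by near: t; apply: lt_nbhsr; lra.
have nd : \forall t \near F, t - a < d.
  rewrite near_withinE; near=> t => _; rewrite ltrBlDr (@lt_le_trans _ _ (t0 + d / 2))//; last by lra.
  by near: t; apply: lt_nbhsl; lra.
have c1 : T (t - a) (psi a) @[t --> F] --> T (t0 - a) (psi a).
  apply: (semigroup_cvg hT hb); first by rewrite subr_ge0.
  - by apply: filterS na => t; rewrite subr_ge0.
  - by apply: cvgB; [exact: cvg_within|exact: cvg_cst].
  - exact: cvg_cst.
near=> t.
have tt : 0 <= t <= tau by near: t.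
have at_ : a <= t by near: t.
have ad : t - a < d by near: t.
have c1t : `|T (t0 - a) (psi a) - T (t - a) (psi a)| < e / 3.
  by near: t; move/cvgrPdist_lt : c1; apply; rewrite divr_gt0.
rewrite -/(psi t) -/(psi t0).
have -> : psi t0 - psi t = (psi t0 - T (t0 - a) (psi a)) + (T (t0 - a) (psi a) - T (t - a) (psi a))
   - (psi t - T (t - a) (psi a)) by rewrite addrA subrK opprB addrA subrK.
rewrite (_ : e = e / 3 + e / 3 + e / 3); last by field.
apply: (le_lt_trans (ler_normB _ _)); apply: ltrD.
  apply: (le_lt_trans (ler_normD _ _)); apply: ltrD => //.
  apply: (le_lt_trans (tail _ _ _ _)) => //; first by rewrite a0.
  by apply: dP; rewrite subr_ge0 at0/=; lra.
apply: (le_lt_trans (tail _ _ _ _)) => //; first by rewrite a0.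
  by have /andP[] := tt.
by apply: dP; rewrite subr_ge0 at_.
Unshelve. all: end_near. Qed.

(** Once d vanishes on [0, a], only ]a, r] contributes to d r. For r <= a + eta the kernel there has
    mass at most 1 / 2 after multiplication by L, so the bound S / 2^m improves to S / 2^(m+1) for
    every m, and d vanishes up to a + eta. *)
Lemma volterra_zero (k : R -> V) (d : R -> X) (L S tau : R) : tau <= 1 -> 0 <= L -> 0 <= S ->
  strongly_measurable `[0, tau] k ->
  {ae mu, forall s, s \in `[0, tau] -> `|k s| <= L * `|d s|} ->
  (forall t, 0 <= t <= tau -> is_bochner_integral `[0, t] (fun s => K (t - s) (k s)) (d t)) ->
  (forall t, 0 <= t <= tau -> `|d t| <= S) ->
  forall t, 0 <= t <= tau -> d t = 0.
Proof.
move=> tau1 L0 S0 mk kd bd dS.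
have g0 : 0 < 1 - gamma by rewrite subr_gt0.
have k0 : 0 <= C * L / (1 - gamma) by rewrite divr_ge0 ?mulr_ge0// ltW.
have [e e0 eP] := powR_small g0 k0 (divr_gt0 (@ltr01 R) (ltr0Sn _ 1)).
have dE t : 0 <= t <= tau -> bochner_integral `[0, t] (fun s => K (t - s) (k s)) = d t.
  by move=> /bd; exact: is_bochner_integralE.
pose eta := e / 2; have eta0 : 0 < eta by rewrite divr_gt0.
have claim n : forall t, 0 <= t <= tau -> t <= n%:R * eta -> d t = 0.
  elim: n => [t tt|n IH t tt tn].
    rewrite mul0r => t0; have {}t0 : t = 0 by apply/eqP; rewrite eq_le t0; case/andP: tt.
    by subst t; rewrite -dE// bochner_integral_point//; exists (d 0); exact: bd.
  pose a := n%:R * eta; have a0 : 0 <= a by rewrite mulr_ge0// ltW.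
  have half m : forall t, 0 <= t <= tau -> t <= a + eta -> `|d t| <= S / 2 ^+ m.
    elim: m => [r rr _|m IHm r rr ra]; first by rewrite expr0 divr1 dS.
    have q0 : 0 <= S / 2 ^+ m by rewrite divr_ge0 ?exprn_ge0.
    rewrite exprSr invfM mulrA.
    have [ra'|ar] := leP r a; first by rewrite IH// normr0 mulr_ge0.
    have /andP[r0 rtau] := rr.
    have aa : 0 <= a <= tau by rewrite a0 (le_trans (ltW ar)).
    have ar' : 0 <= a <= r by rewrite a0 ltW.
    have [|w bw ->] := convolution_split ar' (le_trans rtau tau1) (bd r rr).
      by exists (d a); exact: bd.
    rewrite dE// (IH a aa (lexx _)) linear0 add0r.
    have sub : `]a, r]%classic `<=` `[0, tau]%classic.
      by move=> s /=; rewrite !in_itv/= => /andP[/ltW/(le_trans a0) -> /le_trans]; exact.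
    have := @convolution_norm_le k (L * (S / 2 ^+ m)) a r w ar' (le_trans rtau tau1).
    rewrite mulr_ge0// => /(_ isT (strongly_measurableS sub mk)) h.
    apply: le_trans (h _ bw) _.
      apply: ae_sub kd => s kd sar; apply: (le_trans (kd (sub _ sar))).
      move: sar; rewrite in_itv/= => /andP[as_ sr]; apply: ler_wpM2l => //; apply: IHm.
        by rewrite (le_trans a0 (ltW as_)) (le_trans sr).
      exact: le_trans ra.
    have := eP (r - a); rewrite subr_ge0 (ltW ar) /= => /(_ _)/ltW h2.
    rewrite (_ : C * _ * _ = (S / 2 ^+ m) * (C * L / (1 - gamma) * (r - a) `^ (1 - gamma))).
      apply: ler_wpM2l => //; rewrite -[2^-1]mul1r; apply: h2.
      by rewrite /eta in ra; lra.
    by field; rewrite gt_eqF// expf_neq0.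
  have tn' : t <= a + eta by move: tn; rewrite -natr1 mulrDl mul1r.
  apply/eqP; rewrite -normr_le0; apply/ler_addgt0Pl => r r0; rewrite addr0.
  have S1 : 0 < S + 1 by rewrite ltr_wpDl.
  have [m _ /(_ m (leqnn m))] := near_infty_natSinv_expn_lt (PosNum (divr_gt0 r0 S1)).
  rewrite /= mul1r => hm; apply: (le_trans (half m t tt tn')).
  apply: (@le_trans _ _ ((S + 1) / 2 ^+ m)).
    by apply: ler_wpM2r; rewrite ?invr_ge0 ?exprn_ge0// lerDl.
  by rewrite mulrC -ler_pdivlMr// ltW.
move=> t tt; apply: (claim (Num.bound (t / eta)) t tt).
by rewrite -ler_pdivrMr//; apply: ltW; apply: archi_boundP; rewrite divr_ge0 ?(ltW eta0)//; case/andP: tt.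
Qed.

(** Young's inequality bounds the product of the weight and |h s| by (t - s)^(- gamma q) + |h s|^p,
    with q conjugate to p. The first term is integrable because p > 1 / (1 - gamma) means gamma q <
    1. *)
Lemma convolution_Lp (h : R -> V) (p tau : R) : 0 <= gamma -> 0 <= tau -> tau <= 1 ->
  (1 - gamma)^-1 < p -> memLp p `[0, tau] h ->
  exists S : R, forall t, 0 <= t <= tau ->
    exists2 v, is_bochner_integral `[0, t] (fun s => K (t - s) (h s)) v & `|v| <= S.
Proof.
move=> gamma0 tau0 tau1 gp [mh fh].
have g0 : 0 < 1 - gamma by rewrite subr_gt0.
have p1 : 1 < p.
  by apply: le_lt_trans gp; rewrite invf_ge1//; lra.
have p0 : 0 < p by lra.
have pg : p^-1 < 1 - gamma.
  by rewrite -[1 - gamma]invrK ltf_pV2 ?posrE ?invr_gt0.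
have p1i : p^-1 < 1 by rewrite invf_lt1.
pose q := (1 - p^-1)^-1.
have q0 : 0 < q by rewrite invr_gt0; lra.
have q1 : 1 <= q by rewrite invf_ge1 ?subr_gt0// gerBl invr_ge0 ltW.
have gq : gamma * q < 1 by rewrite ltr_pdivrMr ?subr_gt0// mul1r; lra.
have pq : q^-1 + p^-1 = 1 by rewrite invrK subrK.
have [N [mN N0 pN _]] := strongly_measurable_pointwise mh (aeW mu (fun t => Logic.I)).
have mD : measurable (`[0, tau]%classic `\` N) by exact: measurableD.
(* [k] is a measurable copy of the norm of h: equal to it almost everywhere on [0, tau], and zero
   elsewhere. *)
pose k := (fun s => `|h s|) \_ (`[0, tau]%classic `\` N).
have mk : measurable_fun setT k.
  by apply/(measurable_restrictT _ mD); exact: pointwise_measurable_norm.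
have k0 s : 0 <= k s by rewrite /k patchE; case: ifP.
have kE : {ae mu, forall s, s \in `[0, tau] -> `|h s| = k s}.
  have aN : {ae mu, forall s, ~ N s} by exists N; split => // s /= /contrapT.
  by apply: ae_sub aN => s Ns sI; rewrite /k patchE mem_set.
have mkp : measurable_fun setT (fun s => k s `^ p).
  by apply: (measurableT_comp (f := @powR R ^~ p)) => //; exact: measurable_powRW.
pose I := (\int[mu]_(s in `[0%R, tau]) (k s `^ p)%:E)%E.
have Ify : (I < +oo)%E.
  rewrite /I (ae_integral_eq (g := fun s => (`|h s| `^ p)%:E))//.
  by apply: ae_sub kE => s h1 sI; rewrite h1.
have I0 : (0 <= I)%E by apply: integral_ge0 => s _; rewrite lee_fin powR_ge0.
have fI : I \is a fin_num by rewrite ge0_fin_numE.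
exists (C * (1 / (1 - gamma * q) + fine I)) => t /andP[t0 tt].
have sub : `[0, t]%classic `<=` `[0, tau]%classic.
  by move=> s /=; rewrite !in_itv/= => /andP[-> /le_trans ->].
have t1 : 0 <= t <= 1 by rewrite t0 (le_trans tt).
have mhK := convolution_measurable t1 (measurable_itv _) (@subset_refl _ _) (strongly_measurableS sub mh).
pose b s := C * ((t - s) `^ (- (gamma * q)) + k s `^ p).
have mb : measurable_fun `[0, t] b.
  apply: measurable_funM => //; apply: measurable_funD; first exact: kernel_weight_measurable.
  exact: measurable_funS mkp.
have hb_ : {ae mu, forall s, s \in `[0, t] -> `|K (t - s) (h s)| <= b s}.
  apply: ae_sub2 (ae_neq t) kE => s st hs sI; have := sI; rewrite in_itv/= => /andP[s0 s_le].
  have s_lt : s < t by rewrite lt_neqAle st.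
  have ts0 : 0 < t - s by rewrite subr_gt0.
  apply: (le_trans (KC _ _)); first by rewrite ts0/=; lra.
  rewrite hs; last exact: sub.
  rewrite -mulrA; apply: ler_wpM2l; first exact: ltW.
  apply: (le_trans (conjugate_powR (powR_ge0 _ _) (k0 s) q0 p0 pq)); rewrite -powRrM mulNr.
  by apply: lerD; rewrite ler_piMr ?powR_ge0// invf_le1//; lra.
have ib : (\int[mu]_(s in `[0%R, t]) (b s)%:E <= (C * (1 / (1 - gamma * q) + fine I))%:E)%E.
  under eq_integral do rewrite EFinM.
  rewrite ge0_integralZl//; last 3 first.
  - apply/measurable_EFinP; apply: measurable_funD; first exact: kernel_weight_measurable.
    exact: measurable_funS mkp.
  - by move=> s _; rewrite lee_fin addr_ge0 ?powR_ge0.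
  - by rewrite lee_fin ltW.
  rewrite EFinM lee_pmul2l//.
  under eq_integral do rewrite EFinD.
  rewrite ge0_integralD//; last 4 first.
  - by move=> s _; rewrite lee_fin powR_ge0.
  - by apply/measurable_EFinP; exact: kernel_weight_measurable.
  - by move=> s _; rewrite lee_fin powR_ge0.
  - by apply/measurable_EFinP; exact: measurable_funS mkp.
  rewrite EFinD; apply: leeD.
    rewrite -integral_itv_obnd_cbnd; last by apply/measurable_EFinP; exact: kernel_weight_measurable.
    rewrite kernel_weight_integral// lee_fin subr0; apply: ler_wpM2r; first by rewrite invr_ge0; lra.
    apply: (@le_trans _ _ (1 `^ (1 - gamma * q))); last by rewrite powR1.
    apply: ge0_ler_powR; rewrite ?nnegrE//; first by lra.
    by case/andP: t1.
  rewrite fineK//; apply: ge0_subset_integral => //.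
  - by apply/measurable_EFinP; exact: measurable_funS mkp.
  - by move=> s _; rewrite lee_fin powR_ge0.
have [v bv] : bochner_integrable `[0, t] (fun s => K (t - s) (h s)).
  by apply: (bochner_integrable_le (h := b)) => //; exact: le_lt_trans ib (ltry _).
exists v => //; apply: is_bochner_integral_norm_le bv _ => //.
by apply: le_trans ib; exact: norm_integral_le.
Qed.

End SingularConvolution.

(** Functions live on all of R but are compared on [0, tau]; the contraction principle is therefore
    run on the pointwise limit of the iterates, with an explicit uniform rate that transmits
    continuity. *)
Lemma contraction_fixed_point {R : realType} {X : completeNormedModType R} (tau rho : R) (w : X)
    (Phi : (R -> X) -> R -> X) : 0 <= rho ->
  let adm := [set v : R -> X | {within `[0, tau], continuous v} /\
    forall t, 0 <= t <= tau -> `|v t - w| <= rho] in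
  (forall v, adm v -> adm (Phi v)) ->
  (forall v v' (d : R), adm v -> adm v' ->
    (forall t, 0 <= t <= tau -> `|v t - v' t| <= d) ->
    forall t, 0 <= t <= tau -> `|Phi v t - Phi v' t| <= d / 2) ->
  exists v, adm v /\ forall t, 0 <= t <= tau -> Phi v t = v t.
Proof.
move=> rho0 adm admPhi contr.
pose V n := iter n Phi (fun=> w).
have admV n : adm (V n).
  elim: n => [|n IH]; last exact: admPhi.
  split; first by apply: continuous_subspaceT; exact: cst_continuous.
  by move=> t _; rewrite subrr normr0.
(* [q n] bounds the distance from the n-th iterate to all later ones: the first increment is at most
   rho = q 0 / 2, and the increments halve. *)
pose q n : R := 2 * rho / 2 ^+ n.
have qS n : q n.+1 = q n / 2 by rewrite /q exprSr invfM; ring.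
have q0 n : 0 <= q n by rewrite /q divr_ge0// ?mulr_ge0// exprn_ge0.
have VS n t : 0 <= t <= tau -> `|V n.+1 t - V n t| <= q n / 2.
  elim: n t => [t tt|n IH t tt].
    have := (admV 1).2 t tt; rewrite /q expr0 divr1 mulrC mulrA mulVf ?mul1r//.
  by rewrite qS; apply: (contr _ _ _ (admV n.+1) (admV n)).
have Vk n k t : 0 <= t <= tau -> `|V (n + k)%N t - V n t| <= q n - q (n + k)%N.
  move=> tt; elim: k => [|k IH]; first by rewrite addn0 !subrr normr0.
  rewrite addnS -(subrKA (V (n + k)%N t)) (le_trans (ler_normD _ _))//.
  rewrite (_ : q n - _ = q (n + k)%N / 2 + (q n - q (n + k)%N)) ?lerD//; first exact: VS.
  by rewrite qS; lra.
have Vm n m t : 0 <= t <= tau -> (n <= m)%N -> `|V m t - V n t| <= q n.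
  by move=> tt /subnKC <-; rewrite (le_trans (Vk _ _ _ tt))// lerBlDr lerDl.
have qlt (e : R) : 0 < e -> exists n, q n < e.
  move=> e0; have r1 : 0 < 2 * rho + 1 by rewrite ltr_wpDl// mulr_ge0.
  have [n _ /(_ n (leqnn n))] := near_infty_natSinv_expn_lt (PosNum (divr_gt0 e0 r1)).
  rewrite /= mul1r => h; exists n; apply: (@le_lt_trans _ _ ((2 * rho + 1) / 2 ^+ n)).
    by rewrite /q; apply: ler_wpM2r; rewrite ?invr_ge0 ?exprn_ge0// lerDl.
  by rewrite mulrC -ltr_pdivlMr.
pose v t := limn (fun n => V n t).
have cV t : 0 <= t <= tau -> V n t @[n --> \oo] --> v t.
  move=> tt; apply: cauchy_seq_cvg => e e0; have [N qN] := qlt (e / 2) (divr_gt0 e0 (ltr0Sn _ 1)).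
  exists N => n m Nn Nm; rewrite -(subrKA (V N t)) (le_lt_trans (ler_normD _ _))//.
  by rewrite (splitr e) ltrD// ?[`|V N t - _|]distrC (le_lt_trans (Vm _ _ _ tt _)).
have Vv n t : 0 <= t <= tau -> `|v t - V n t| <= q n.
  move=> tt.
  have c : `|V m t - V n t| @[m --> \oo] --> `|v t - V n t|.
    by apply: cvg_norm; apply: cvgB; [exact: cV|exact: cvg_cst].
  apply: (ler_cvg_to c (cvg_cst (q n))).
  by exists n => // m nm; exact: Vm.
have admv : adm v.
  split.
    apply/subspace_continuousP => t0; rewrite /= in_itv/= => tt0.
    apply/cvgrPdist_lt => e e0; have [n qn] := qlt (e / 3) (divr_gt0 e0 (ltr0Sn _ 2)).
    have /subspace_continuousP/(_ t0) := (admV n).1; rewrite /= in_itv/= => /(_ tt0).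
    move=> /cvgrPdist_lt/(_ _ (divr_gt0 e0 (ltr0Sn _ 2))) nV.
    have nt : \forall t \near within `[0, tau]%classic (nbhs t0), 0 <= t <= tau.
      by rewrite near_withinE; apply: nearW => t; rewrite /= in_itv.
    near=> t; have tt : 0 <= t <= tau by near: t.
    have h : `|V n t0 - V n t| < e / 3 by near: t.
    have -> : from_subspace `[0, tau]%classic v t0 - from_subspace `[0, tau]%classic v t = (v t0 - V n t0) + (V n t0 - V n t) - (v t - V n t).
      by rewrite /from_subspace addrA subrK opprB addrA subrK.
    rewrite (_ : e = e / 3 + e / 3 + e / 3); last by field.
    apply: (le_lt_trans (ler_normB _ _)); apply: ltrD; last exact: le_lt_trans (Vv _ _ tt) qn.
    by apply: (le_lt_trans (ler_normD _ _)); apply: ltrD => //; exact: le_lt_trans (Vv _ _ tt0) qn.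
  move=> t tt; have c : `|V m t - w| @[m --> \oo] --> `|v t - w|.
    by apply: cvg_norm; apply: cvgB; [exact: cV|exact: cvg_cst].
  by apply: (ler_cvg_to c (cvg_cst rho)); apply: nearW => n; exact: (admV n).2.
exists v; split => // t tt; apply/eqP; rewrite -subr_eq0 -normr_le0; apply/ler_addgt0Pl => e e0.
rewrite addr0; have [n qn] := qlt e e0; apply: (le_trans _ (ltW qn)).
rewrite -(subrKA (V n.+1 t)) (le_trans (ler_normD _ _))// [leRHS]splitr -qS lerD//.
  by rewrite qS; apply: (contr v (V n)) => // s; exact: Vv.
by rewrite distrC; exact: Vv.
Unshelve. all: end_near. Qed.

(** For one w this is strong continuity at 0. The local bound on T lets the same time serve a
    neighbourhood of w, and compactness makes it common to all of P. *)
Lemma uniform_orbit {R : realType} {X : normedModType R} (T : R -> {linear X -> X}) (M lambda : R)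
    (P : set X) (e : R) : C0_semigroup T -> exp_bounded T M lambda -> compact P -> 0 < e ->
  \forall t \near 0^'+, forall s, 0 <= s <= t -> forall w, P w -> `|T s w - w| <= e.
Proof.
move=> hT hb /compact_near_coveringP cP e0.
have [C C0 CP] := exp_bounded_itv 1 hb.
suff : \forall t \near (0 : R)^'+, P `<=` (fun w => forall s, 0 <= s <= t -> `|T s w - w| <= e).
  by apply: filterS => t h s st w Pw; exact: h.
apply: cP => w Pw.
have e3 : 0 < e / 3 by rewrite divr_gt0.
have eC : 0 < e / 3 / C by rewrite divr_gt0.
have [d d0 dP] := semigroup_near0 hT w e3.
have nw1 : \forall w' \near w, `|w - w'| < e / 3 / C by apply: cvgr_dist_lt => //; exact: cvg_id.
have nw2 : \forall w' \near w, `|w - w'| < e / 3 by apply: cvgr_dist_lt => //; exact: cvg_id.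
have nt1 : \forall t \near (0 : R)^'+, t < d by exact: nbhs_right_lt.
have nt2 : \forall t \near (0 : R)^'+, t < 1 by exact: nbhs_right_lt.
near=> w' t => /= s /andP[s0 st].
have sd : s < d by apply: (le_lt_trans st); near: t.
have s1 : s <= 1 by apply: (le_trans st); apply: ltW; near: t.
have -> : T s w' - w' = (T s w - w) - T s (w - w') + (w - w').
  by rewrite (linearB (T s)) opprB [X in _ = X + _]addrC !subrKA.
rewrite (_ : e = e / 3 + e / 3 + e / 3); last by field.
apply: (le_trans (ler_normD _ _)); apply: lerD; last by apply: ltW; near: w'.
apply: (le_trans (ler_normB _ _)); apply: lerD; first by apply: ltW; apply: dP; rewrite s0.
apply: (le_trans (CP _ _ _)); first by rewrite s0.
rewrite mulrC -ler_pdivlMr//; by apply: ltW; near: w'.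
Unshelve. all: end_near. Qed.

(** * Mild solutions *)

Section Nonlinearity.
Context {R : realType} {X U : completeNormedModType R}.
Context (T : R -> {linear X -> X}) (omega alpha : R) (J : {linear X -> X}).
Context (JE : forall x, neg_power T omega alpha x = J x) (Ji : injective J).

Lemma powerK (v : X) : power T omega alpha (J v) = v.
Proof.
rewrite /power; apply: xget_unique; first by rewrite /= JE.
by move=> y /=; rewrite JE => /Ji.
Qed.

Lemma XpowP (x : X) : Xpow T omega alpha x -> J (power T omega alpha x) = x.
Proof. by move=> [v _ <-]; rewrite JE powerK. Qed.

Lemma Xpow_neg_power (v : X) : Xpow T omega alpha (J v).
Proof. by exists v. Qed.

Lemma neg_power_cvg (v_ : nat -> X) (v : X) : v_ n @[n --> \oo] --> v ->
  J (v_ n) @[n --> \oo] --> (J v : Xpow_top T omega alpha).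
Proof.
move=> c A /= [_ [[B Bop <-] Bv sBA]].
have nB : nbhs v B by apply: open_nbhs_nbhs; split => //; move: Bv; rewrite /= powerK.
have := c _ nB; rewrite /nbhs /=; apply: filterS => n Bn.
by apply: sBA; rewrite /= powerK.
Qed.

(** Turns continuity of f for the topology of X_alpha into sequential continuity of (v, u) |-> f (J
    v) u for the norm of X, which is the form used by the measurability of compositions. *)
Lemma nonlinearity_cvg (f : X -> U -> X) (v_ : nat -> X) (u_ : nat -> U) (v : X) (u : U) :
  {within (Xpow T omega alpha `*` setT : set (Xpow_top T omega alpha * U)%type),
     continuous ((fun z => f z.1 z.2) : (Xpow_top T omega alpha * U)%type -> X)} ->
  v_ n @[n --> \oo] --> v -> u_ n @[n --> \oo] --> u ->
  f (J (v_ n)) (u_ n) @[n --> \oo] --> f (J v) u.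
Proof.
move=> /subspace_continuousP hf cv cu.
have := hf (J v, u); move=> /(_ (conj (Xpow_neg_power v) I)) c.
apply: cvg_trans c => A /= cA.
have [[/= P1 P2] [/= n1 n2] P12] : nbhs ((J v, u) : Xpow_top T omega alpha * U)
   [set z | (Xpow T omega alpha `*` setT) z -> A (f z.1 z.2)] by exact: cA.
have m1 : \forall n \near \oo, P1 (J (v_ n)) by exact: neg_power_cvg cv _ n1.
have m2 : \forall n \near \oo, P2 (u_ n) by exact: cu _ n2.
have : \forall n \near \oo, A (f (J (v_ n)) (u_ n)); last by [].
apply: filterS (filterI m1 m2) => n [h1 h2]; apply: (P12 (J (v_ n), u_ n)) => //.
by split => //; exact: Xpow_neg_power.
Qed.

End Nonlinearity.

Lemma strongly_measurable_extend {R : realType} {Y : normedModType R} (A D : set R) (g : R -> Y) :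
  measurable A -> strongly_measurable A g -> strongly_measurable D (fun s => \1_A s *: g s).
Proof.
move=> mA [s [ss sg]].
exists (fun n => [seq (q.1 `&` A, q.2) | q <- s n]); split.
  move=> n q /mapP[p /ss[mp fp] ->]; split => /=; first exact: measurableI.
  by apply: le_lt_trans fp; apply: lebesgue_measureS => //; exact: measurableI.
apply: ae_sub sg => t h _.
have -> : (fun n => simple_fun [seq (q.1 `&` A, q.2) | q <- s n] t) =
    fun n => \1_A t *: simple_fun (s n) t.
  apply/funext => n; rewrite /simple_fun big_map scaler_sumr; apply: eq_bigr => q _ /=.
  by rewrite indicI scalerA mulrC.
have [At|nAt] := pselect (A t); first by apply: cvgZr; exact: h.
rewrite indicE memNset// scale0r.
rewrite (_ : (fun n => _) = fun=> 0); first exact: cvg_cst.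
by apply/funext => n; rewrite scale0r.
Qed.

(** * The fixed-point problem for v *)

Section Picard.
Context {R : realType} {X U E : completeNormedModType R}.
Local Notation mu := (@lebesgue_measure R).
Context (T : R -> {linear X -> X}) (M lambda : R).
Context (hT : C0_semigroup T) (hb : exp_bounded T M lambda).
Context (W : R -> {linear X -> X}) (Z : R -> {linear E -> X}) (C alpha beta : R).
Context (C_gt0 : 0 < C) (alpha_lt1 : alpha < 1) (beta_lt1 : beta < 1).
Context (WC : forall t v, 0 < t <= 1 -> `|W t v| <= C * t `^ (- alpha) * `|v|).
Context (ZC : forall t e, 0 < t <= 1 -> `|Z t e| <= C * t `^ (- beta) * `|e|).
Context (WT : forall s t v, 0 <= s -> 0 < t -> W (s + t) v = T s (W t v)).
Context (ZT : forall s t e, 0 <= s -> 0 < t -> Z (s + t) e = T s (Z t e)).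
Context (g : X -> U -> X) (B : {linear U -> E}) (cB : continuous B).
Context (gc : forall (v_ : nat -> X) (u_ : nat -> U) v u,
  v_ n @[n --> \oo] --> v -> u_ n @[n --> \oo] --> u -> g (v_ n) (u_ n) @[n --> \oo] --> g v u).

Lemma superposition_measurable (tau : R) (v : R -> X) (u : R -> U) :
  {within `[0, tau], continuous v} -> strongly_measurable `[0, tau] u ->
  strongly_measurable `[0, tau] (fun s => g (v s) (u s)).
Proof.
move=> /subspace_continuousP cv mu_.
apply: (strongly_measurable_comp (G := fun s y => g (v s) y)) => //.
  by move=> s /=; rewrite !in_itv/= andbT => /andP[].
apply: aeW => s /= sI a y as_ ca cy; apply: gc => //.
have cvs := cv s sI; apply: cvg_trans cvs => A /= nA.
have : \forall x \near s, `[0, tau]%classic x -> A (v x) by exact: nA.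
move=> /ca; rewrite /nbhs /=; apply: filterS => n; apply.
by have := as_ n; move: sI; rewrite /= !in_itv/= => /andP[_ st] /andP[-> /le_trans ->].
Qed.

Lemma linear_measurable (tau : R) (u : R -> U) :
  strongly_measurable `[0, tau] u -> strongly_measurable `[0, tau] (fun s => B (u s)).
Proof.
move=> mu_; apply: (strongly_measurable_comp (G := fun s y => B y)) => //.
  by move=> s /=; rewrite !in_itv/= andbT => /andP[].
by apply: aeW => s _ a y _ _ cy; apply: continuous_cvg => //; exact: cB.
Qed.

Definition duhamel (v0 : X) (u : R -> U) (v : R -> X) (t : R) : X :=
  T t v0 + bochner_integral `[0, t] (fun s => W (t - s) (g (v s) (u s)))
         + bochner_integral `[0, t] (fun s => Z (t - s) (B (u s))).

Context (bU R0 H L HB : R) (H_ge0 : 0 <= H) (L_ge0 : 0 <= L) (HB_ge0 : 0 <= HB).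
Context (gH : forall v y, `|v| <= R0 -> `|y| <= bU -> `|g v y| <= H).
Context (gL : forall v v' y, `|v| <= R0 -> `|v'| <= R0 -> `|y| <= bU ->
  `|g v y - g v' y| <= L * `|v - v'|).
Context (BH : forall y, `|y| <= bU -> `|B y| <= HB).

(** The free orbit leaves a margin eta inside the ball of radius rho, which the two convolution
    bounds fill; the last hypothesis makes the nonlinear convolution a contraction of ratio 1 / 2.
    [R0] confines the arguments of g to the region of [gH] and [gL]. *)
Lemma duhamel_fixed_point (tau rho eta : R) (w v0 : X) (u : R -> U) :
  0 <= tau -> tau <= 1 -> 0 <= rho -> `|w| + rho <= R0 ->
  strongly_measurable `[0, tau] u -> {ae mu, forall s, s \in `[0, tau] -> `|u s| <= bU} ->
  (forall t, 0 <= t <= tau -> `|T t v0 - w| <= rho - eta) ->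
  C * H * (tau `^ (1 - alpha) / (1 - alpha)) + C * HB * (tau `^ (1 - beta) / (1 - beta)) <= eta ->
  C * L * (tau `^ (1 - alpha) / (1 - alpha)) <= 2^-1 ->
  exists v, [/\ {within `[0, tau], continuous v},
    forall t, 0 <= t <= tau -> `|v t - w| <= rho &
    forall t, 0 <= t <= tau -> [/\ v t = duhamel v0 u v t,
      bochner_integrable `[0, t] (fun s => W (t - s) (g (v s) (u s))) &
      bochner_integrable `[0, t] (fun s => Z (t - s) (B (u s)))]].
Proof.
move=> tau0 tau1 rho0 wR mu_ uU base small contr.
have a0 : 0 < 1 - alpha by rewrite subr_gt0.
have b0 : 0 < 1 - beta by rewrite subr_gt0.
have sub t : t <= tau -> `[0, t]%classic `<=` `[0, tau]%classic.
  by move=> tt s /=; rewrite !in_itv/= => /andP[-> /le_trans ->].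
have inR v : (forall t, 0 <= t <= tau -> `|v t - w| <= rho) ->
    forall t, 0 <= t <= tau -> `|v t| <= R0.
  move=> vw t tt; apply: le_trans wR; rewrite -(subrK w (v t)) addrC.
  by apply: (le_trans (ler_normD _ _)); rewrite lerD2l vw.
have gm v : {within `[0, tau], continuous v} -> (forall t, 0 <= t <= tau -> `|v t - w| <= rho) ->
    strongly_measurable `[0, tau] (fun s => g (v s) (u s)) /\
    {ae mu, forall s, s \in `[0, tau] -> `|g (v s) (u s)| <= H}.
  move=> cv vw; split; first exact: superposition_measurable.
  apply: ae_sub uU => s us sI; apply: gH; last exact: us.
  by apply: (inR v) => //; move: sI; rewrite in_itv.
have Bm := linear_measurable mu_.
have BuH : {ae mu, forall s, s \in `[0, tau] -> `|B (u s)| <= HB}.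
  by apply: ae_sub uU => s us sI; apply: BH; exact: us.
have resm (V : normedModType R) (h : R -> V) t : t <= tau ->
  strongly_measurable `[0, tau] h -> strongly_measurable `[0, t] h.
  by move=> /sub; exact: strongly_measurableS.
have resH (V : normedModType R) (h : R -> V) (k t : R) : t <= tau ->
    {ae mu, forall s, s \in `[0, tau] -> `|h s| <= k} -> {ae mu, forall s, s \in `[0, t] -> `|h s| <= k}.
  by move=> /sub s0; apply: ae_sub => s hs /s0; exact: hs.
have convW v t : {within `[0, tau], continuous v} ->
    (forall t, 0 <= t <= tau -> `|v t - w| <= rho) -> 0 <= t <= tau ->
    is_bochner_integral `[0, t] (fun s => W (t - s) (g (v s) (u s)))
     (bochner_integral `[0, t] (fun s => W (t - s) (g (v s) (u s)))).
  move=> cv vw /andP[t0 tt]; have [m b] := gm v cv vw; apply: bochner_integralP => //.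
  apply: (convolution_integrable hT hb C_gt0 alpha_lt1 WC WT (H := H)) => //.
  - by rewrite t0 (le_trans tt).
  - exact: resm m.
  - exact: resH b.
have intZ t : 0 <= t <= tau -> bochner_integrable `[0, t] (fun s => Z (t - s) (B (u s))).
  move=> /andP[t0 tt]; apply: (convolution_integrable hT hb C_gt0 beta_lt1 ZC ZT (H := HB)) => //.
  - by rewrite t0 (le_trans tt).
  - exact: resm Bm.
  - exact: resH BuH.
have mono (p k : R) t : 0 <= k -> 0 < p -> 0 <= t <= tau ->
    C * k * (t `^ p / p) <= C * k * (tau `^ p / p).
  move=> k0 p0 /andP[t0 tt]; apply: ler_wpM2l; first by rewrite mulr_ge0// ltW.
  apply: ler_wpM2r; first by rewrite invr_ge0 ltW.
  by apply: ge0_ler_powR => //; rewrite ?nnegrE// ltW.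
suff [v [[cv vw] fv]] : exists v, ({within `[0, tau], continuous v} /\
    forall t, 0 <= t <= tau -> `|v t - w| <= rho) /\
    forall t, 0 <= t <= tau -> duhamel v0 u v t = v t.
  exists v; split=> // t tt; split; [by rewrite fv|by eexists; exact: convW|exact: intZ].
apply: contraction_fixed_point => //.
- move=> v [cv vw]; have [m b] := gm v cv vw; split.
    have c1 : {within `[0, tau], continuous (fun t => T t v0)}.
      apply/subspace_continuousP => t; rewrite /= in_itv/= => /andP[t0 _].
      apply: (semigroup_cvg hT hb) => //; last exact: cvg_cst.
        by rewrite near_withinE; apply: nearW => s; rewrite /= in_itv/= => /andP[].
      exact: cvg_within.
    have c2 := convolution_continuous hT hb C_gt0 alpha_lt1 WC WT tau1 H_ge0 m b.
    have c3 := convolution_continuous hT hb C_gt0 beta_lt1 ZC ZT tau1 HB_ge0 Bm BuH.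
    move=> t; apply: cvgD; last exact: c3.
    by apply: cvgD; [exact: c1|exact: c2].
  move=> t tt; have /andP[t0 ttau] := tt; have t1 : 0 <= t <= 1 by rewrite t0 (le_trans ttau).
  rewrite /duhamel [_ + _ - w]addrAC [_ + _ - w]addrAC -addrA.
  apply: (le_trans (ler_normD _ _)); rewrite -[leRHS](subrK eta rho).
  apply: lerD; first exact: base.
  apply: le_trans small; apply: (le_trans (ler_normD _ _)); apply: lerD.
    apply: (le_trans _ (mono _ _ _ H_ge0 a0 tt)).
    apply: (convolution_bound hT hb C_gt0 alpha_lt1 WC WT t1 H_ge0 (resm _ _ _ ttau m) (resH _ _ _ _ ttau b)).
    exact: convW.
  apply: (le_trans _ (mono _ _ _ HB_ge0 b0 tt)).
  apply: (convolution_bound hT hb C_gt0 beta_lt1 ZC ZT t1 HB_ge0 (resm _ _ _ ttau Bm) (resH _ _ _ _ ttau BuH)).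
  by apply: bochner_integralP => //; exact: intZ.
- move=> v v' d [cv vw] [cv' vw'] vd t tt.
  have d0 : 0 <= d by apply: le_trans (vd 0 _); rewrite // lexx.
  have /andP[t0 ttau] := tt; have t1 : 0 <= t <= 1 by rewrite t0 (le_trans ttau).
  have [m b] := gm v cv vw; have [m' b'] := gm v' cv' vw'.
  have alg (p q q' r : X) : p + q + r - (p + q' + r) = q - q'.
    by rewrite opprD addrACA subrr addr0 opprD addrACA subrr add0r.
  rewrite /duhamel alg.
  have bi := is_bochner_integral_lin (-1) (measurable_itv _ : measurable (`[0, t]%classic : set (measurableTypeR R)))
    (convW v' t cv' vw' tt) (convW v t cv vw tt).
  rewrite scaleN1r addrC in bi.
  have bi' : is_bochner_integral `[0, t] (fun s => W (t - s) (g (v s) (u s) - g (v' s) (u s)))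
     (bochner_integral `[0, t] (fun s => W (t - s) (g (v s) (u s)))
    - bochner_integral `[0, t] (fun s => W (t - s) (g (v' s) (u s)))).
    apply: is_bochner_integral_ae bi => //.
    by apply: aeW => s _; rewrite scaleN1r addrC linearB.
  have mm : strongly_measurable `[0, t] (fun s => g (v s) (u s) - g (v' s) (u s)).
    have := strongly_measurable_lin (-1) (resm _ _ _ ttau m') (resm _ _ _ ttau m).
    by apply: strongly_measurable_ae; apply: aeW => s _; rewrite scaleN1r addrC.
  have bb : {ae mu, forall s, s \in `[0, t] -> `|g (v s) (u s) - g (v' s) (u s)| <= L * d}.
    apply: ae_sub uU => s us /(sub _ ttau) sI.
    have ss : 0 <= s <= tau by move: sI; rewrite /= in_itv.
    apply: (le_trans (gL _ _ (us sI))); [exact: (inR v)|exact: (inR v')|].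
    by apply: ler_wpM2l => //; exact: vd.
  apply: (le_trans (convolution_bound hT hb C_gt0 alpha_lt1 WC WT t1 (mulr_ge0 L_ge0 d0) mm bb bi')).
  apply: (le_trans (mono _ _ _ (mulr_ge0 L_ge0 d0) a0 tt)).
  rewrite (_ : _ * _ = d * (C * L * (tau `^ (1 - alpha) / (1 - alpha)))); last by ring.
  exact: ler_wpM2l.
Qed.

End Picard.

(** * From the equation for v to mild solutions, and uniqueness *)

Section MildSolutions.
Context {R : realType} {X U E Xm1 : completeNormedModType R}.
Local Notation mu := (@lebesgue_measure R).
Context (T : R -> {linear X -> X}) (M lambda omega alpha beta : R).
Context (hT : C0_semigroup T) (hb : exp_bounded T M lambda).
Context (Tm1 : R -> {linear Xm1 -> Xm1}) (j : {linear X -> Xm1}) (iota : {linear E -> Xm1}).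
Context (J : {linear X -> X}) (W : R -> {linear X -> X}) (Z : R -> {linear E -> X}) (C : R).
Context (JE : forall x, neg_power T omega alpha x = J x) (cJ : continuous J) (Ji : injective J).
Context (cj : continuous j) (ji : injective j).
Context (JT : forall t x, 0 <= t -> J (T t x) = T t (J x)).
Context (JW : forall t x, 0 < t -> J (W t x) = T t x).
Context (JZ : forall t e, 0 < t -> j (J (Z t e)) = Tm1 t (iota e)).
Context (C_gt0 : 0 < C) (alpha_gt0 : 0 < alpha) (alpha_lt1 : alpha < 1) (beta_lt1 : beta < 1).
Context (WC : forall t v, 0 < t <= 1 -> `|W t v| <= C * t `^ (- alpha) * `|v|).
Context (ZC : forall t e, 0 < t <= 1 -> `|Z t e| <= C * t `^ (- beta) * `|e|).
Context (WT : forall s t v, 0 <= s -> 0 < t -> W (s + t) v = T s (W t v)).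
Context (ZT : forall s t e, 0 <= s -> 0 < t -> Z (s + t) e = T s (Z t e)).
Context (f : X -> U -> X) (B : {linear U -> E}) (cB : continuous B).
Let g (v : X) (y : U) := f (J v) y.
Context (gc : forall (v_ : nat -> X) (u_ : nat -> U) v u,
  v_ n @[n --> \oo] --> v -> u_ n @[n --> \oo] --> u -> g (v_ n) (u_ n) @[n --> \oo] --> g v u).

Let expand (a b c : X) : j (J (a + b + c)) = j (J a + J b) + j (J c).
Proof. by rewrite (linearD J) (linearD j) (linearD J). Qed.

Lemma integral_range (t : R) (h : R -> X) (a : X) :
  is_bochner_integral `[0, t] (fun s => W (t - s) (h s)) a ->
  is_bochner_integral `[0, t] (fun s => T (t - s) (h s)) (J a).
Proof.
move=> bv; have := is_bochner_integral_linear _ cJ bv.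
move=> /(_ (measurable_itv _)); apply: is_bochner_integral_ae => //.
apply: ae_sub (ae_neq t) => s st /=; rewrite in_itv/= => /andP[s0 s_le].
by rewrite JW// subr_gt0 lt_neqAle st.
Qed.

Lemma integral_range_extrapolated (t : R) (h : R -> E) (b : X) :
  is_bochner_integral `[0, t] (fun s => Z (t - s) (h s)) b ->
  is_bochner_integral `[0, t] (fun s => Tm1 (t - s) (iota (h s))) (j (J b)).
Proof.
move=> bv; have mI : measurable (`[0, t]%classic : set (measurableTypeR R)) by [].
have := is_bochner_integral_linear mI cj (is_bochner_integral_linear mI cJ bv).
apply: is_bochner_integral_ae => //.
apply: ae_sub (ae_neq t) => s st /=; rewrite in_itv/= => /andP[s0 s_le].
by rewrite JZ// subr_gt0 lt_neqAle st.
Qed.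

Lemma duhamel_mild (v0 : X) (u : R -> U) (v : R -> X) (tau : R) :
  {within `[0, tau], continuous v} ->
  (forall t, 0 <= t <= tau -> [/\ v t = duhamel T W Z g B v0 u v t,
    bochner_integrable `[0, t] (fun s => W (t - s) (g (v s) (u s))) &
    bochner_integrable `[0, t] (fun s => Z (t - s) (B (u s)))]) ->
  mild_solution T omega alpha j Tm1 (iota \o B) f (J v0) u tau (J \o v).
Proof.
move=> cv vE; split.
- apply/subspace_continuousP => t tI; have /subspace_continuousP/(_ t tI) c := cv.
  by apply: continuous_cvg; [exact: cJ|exact: c].
- by move=> s _; exists (v s); rewrite //= JE.
- move=> t tt /=; have [e iW iZ] := vE t tt; have /andP[t0 _] := tt.
  have bF := integral_range (bochner_integralP (measurable_itv _) iW).
  have bG := integral_range_extrapolated (bochner_integralP (measurable_itv _) iZ).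
  split; [by eexists; exact: bF|by eexists; exact: bG|].
  rewrite (is_bochner_integralE _ bF)// (is_bochner_integralE _ bG)//.
  by rewrite {1}e /duhamel expand JT.
Qed.

Context (gLip : forall r : R, 0 < r -> exists2 L : R, 0 < L & forall v v' y,
  `|v| < r -> `|v'| < r -> `|y| < r -> `|g v y - g v' y| <= L * `|v - v'|).
Context (hfLp : forall (u : R -> U) (x : R -> X),
  memLinfty `[0, +oo[ u -> {within `[0, +oo[, continuous x} ->
  (forall s, 0 < s -> Xpow T omega alpha (x s)) ->
  exists2 p : R, (1 - alpha)^-1 < p & memLp_loc p (fun s => f (x s) (u s))).

(** The integrability hypothesis on f concerns functions on the whole half-line: y is frozen after
    tau and u is cut off to 0, which leaves both unchanged on [0, tau]. *)
Lemma mild_memLp (tau bU : R) (u : R -> U) (y : R -> X) : 0 < tau ->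
  strongly_measurable `[0, tau] u -> {ae mu, forall s, s \in `[0, tau] -> `|u s| <= bU} ->
  {within `[0, tau], continuous y} -> (forall s, 0 < s <= tau -> Xpow T omega alpha (y s)) ->
  exists2 p : R, (1 - alpha)^-1 < p & memLp p `[0, tau] (fun s => f (y s) (u s)).
Proof.
move=> tau0 mu_ uU cy yX.
have [|||p pa hp] := @hfLp (fun s => \1_`[0, tau]%classic s *: u s) (fun s => y (Num.min s tau)).
- split; first exact: strongly_measurable_extend.
  exists `|bU|; apply: ae_sub uU => s us _; rewrite indicE.
  have [sI|sI] := pselect (`[0, tau]%classic s).
    by rewrite mem_set// scale1r; apply: (le_trans (us sI)); exact: ler_norm.
  by rewrite memNset// scale0r normr0.
- apply/subspace_continuousP => s; rewrite /= in_itv/= andbT => s0.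
  have mI : `[0, tau]%classic (Num.min s tau).
    by rewrite /= in_itv/= le_min s0 (ltW tau0) ge_min lexx orbT.
  have /subspace_continuousP/(_ _ mI) c := cy.
  apply: cvg_trans c => A /= nA.
  have nA' : \forall r \near Num.min s tau, `[0, tau]%classic r -> A (y r) by exact: nA.
  have cm : Num.min r tau @[r --> s] --> Num.min s tau.
    by apply: (@continuous_min _ R (fun r : R => r) (cst tau)); [exact: cvg_id|exact: cvg_cst].
  have : \forall r \near s, `[0, tau]%classic (Num.min r tau) -> A (y (Num.min r tau)) by exact: cm _ nA'.
  rewrite /nbhs /=; apply: filterS => r h; rewrite /= in_itv/= andbT => r0; apply: h.
  by rewrite /= in_itv/= le_min r0 (ltW tau0) ge_min lexx orbT.
- by move=> s s0; apply: yX; rewrite lt_min s0 tau0 ge_min lexx orbT.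
exists p => //; have [mh fh] := hp tau (ltW tau0).
have eqI s : s \in `[0, tau] -> f (y (Num.min s tau)) (\1_`[0, tau]%classic s *: u s) = f (y s) (u s).
  move=> sI; rewrite indicE mem_set// scale1r; congr (f (y _) _); apply/min_idPl.
  by move: sI; rewrite in_itv/= => /andP[].
split.
  by apply: strongly_measurable_ae mh; apply: aeW => s sI; exact: eqI.
apply: le_lt_trans fh; rewrite le_eqVlt; apply/orP; left; apply/eqP.
by apply: eq_integral => s; rewrite inE => sI; rewrite eqI.
Qed.

Lemma mild_unique (tau bU R0 : R) (u : R -> U) (v0 : X) (v y : R -> X) : 0 < tau -> tau <= 1 ->
  strongly_measurable `[0, tau] u -> {ae mu, forall s, s \in `[0, tau] -> `|u s| <= bU} ->
  {within `[0, tau], continuous v} -> (forall t, 0 <= t <= tau -> `|v t| <= R0) ->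
  (forall t, 0 <= t <= tau -> [/\ v t = duhamel T W Z g B v0 u v t,
    bochner_integrable `[0, t] (fun s => W (t - s) (g (v s) (u s))) &
    bochner_integrable `[0, t] (fun s => Z (t - s) (B (u s)))]) ->
  mild_solution T omega alpha j Tm1 (iota \o B) f (J v0) u tau y ->
  forall t, 0 <= t <= tau -> y t = J (v t).
Proof.
move=> tau0 tau1 mu_ uU cv vR vE [cy yX yE].
have [p pa hLp] := mild_memLp tau0 mu_ uU cy yX.
pose h s := f (y s) (u s).
have [S SP] := convolution_Lp hT hb C_gt0 alpha_lt1 WC WT (ltW alpha_gt0) (ltW tau0) tau1 pa hLp.
have iW t : 0 <= t <= tau -> bochner_integrable `[0, t] (fun s => W (t - s) (h s)).
  by move=> /SP[a ba _]; exists a.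
(* [vy] will be S^alpha y. It is defined by the integrals rather than by inverting J, so that a
   bound can be read off term by term. *)
pose vy t := T t v0 + bochner_integral `[0, t] (fun s => W (t - s) (h s))
         + bochner_integral `[0, t] (fun s => Z (t - s) (B (u s))).
have yJ t : 0 <= t <= tau -> y t = J (vy t).
  move=> tt; have [_ _ iZ] := vE t tt; have [_ _ e] := yE t tt; have /andP[t0 _] := tt.
  have bF := integral_range (bochner_integralP (measurable_itv _) (iW t tt)).
  have bG := integral_range_extrapolated (bochner_integralP (measurable_itv _) iZ).
  apply: ji; rewrite e (is_bochner_integralE _ bF)// (is_bochner_integralE _ bG)//.
  by rewrite /vy expand JT.
pose d t := vy t - v t.
have mI (t : R) : measurable (`[0, t]%classic : set (measurableTypeR R)) by [].
have bd t : 0 <= t <= tau ->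
    is_bochner_integral `[0, t] (fun s => W (t - s) (h s - g (v s) (u s))) (d t).
  move=> tt; have [e iWv iZ] := vE t tt.
  have -> : d t = -1 *: bochner_integral `[0, t] (fun s => W (t - s) (g (v s) (u s)))
      + bochner_integral `[0, t] (fun s => W (t - s) (h s)).
    have alg (p0 q q' r : X) : p0 + q + r - (p0 + q' + r) = - 1 *: q' + q.
      by rewrite opprD addrACA subrr addr0 opprD addrACA subrr add0r scaleN1r addrC.
    by apply: etrans (congr1 (fun z => vy t - z) e) _; exact: alg.
  have := is_bochner_integral_lin (-1) (mI t) (bochner_integralP (mI t) iWv) (bochner_integralP (mI t) (iW t tt)).
  apply: is_bochner_integral_ae => //.
  by apply: aeW => s _; rewrite scaleN1r addrC linearB.
have [KT KT0 KTP] := exp_bounded_itv tau hb.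
have b0 : 0 < 1 - beta by rewrite subr_gt0.
have [CB CB0 CBP] := continuous_linear_le cB.
pose HB := CB * `|bU|; have HB0 : 0 <= HB by rewrite mulr_ge0// ltW.
pose K2 := C * HB * (1 / (1 - beta)).
have K2P t : 0 <= t <= tau -> `|bochner_integral `[0, t] (fun s => Z (t - s) (B (u s)))| <= K2.
  move=> tt; have [_ _ iZ] := vE t tt; have /andP[t0 t_tau] := tt.
  have sub : `[0, t]%classic `<=` `[0, tau]%classic.
    by move=> s /=; rewrite !in_itv/= => /andP[-> /le_trans ->].
  have t1 : 0 <= t <= 1 by rewrite t0 (le_trans t_tau).
  have mB := strongly_measurableS sub (linear_measurable cB mu_).
  have BH : {ae mu, forall s, s \in `[0, t] -> `|B (u s)| <= HB}.
    apply: ae_sub uU => s us /sub sI; apply: (le_trans (CBP _)); apply: ler_wpM2l; first exact: ltW.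
    by apply: (le_trans (us sI)); exact: ler_norm.
  apply: (le_trans (convolution_bound hT hb C_gt0 beta_lt1 ZC ZT t1 HB0 mB BH (bochner_integralP (mI t) iZ))).
  apply: ler_wpM2l; first by rewrite mulr_ge0// ltW.
  apply: ler_wpM2r; first by rewrite invr_ge0 ltW.
  apply: (@le_trans _ _ (1 `^ (1 - beta))); last by rewrite powR1.
  by apply: ge0_ler_powR; rewrite ?nnegrE//; [exact: ltW|case/andP: t1].
pose Sy := KT * `|v0| + S + K2.
have vyS t : 0 <= t <= tau -> `|vy t| <= Sy.
  move=> tt; apply: (le_trans (ler_normD _ _)); apply: lerD; last exact: K2P.
  apply: (le_trans (ler_normD _ _)); apply: lerD; first exact: KTP.
  by have [a ba aS] := SP t tt; rewrite (is_bochner_integralE _ ba).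
(* One radius above the bounds of vy, v and u; the added 1 supplies the strict inequalities of
   [gLip]. *)
pose r := Num.max (Num.max `|Sy| `|R0|) `|bU| + 1.
have [|L L0 LP] := gLip (r := r); first by rewrite ltr_wpDl// !le_max normr_ge0.
have rS (z : X) : `|z| <= Sy -> `|z| < r.
  move=> zS; rewrite (le_lt_trans zS)// (le_lt_trans (ler_norm _))//.
  by rewrite (@le_lt_trans _ _ (Num.max (Num.max `|Sy| `|R0|) `|bU|)) ?ltrDl// !le_max lexx.
have rR (z : X) : `|z| <= R0 -> `|z| < r.
  move=> zS; rewrite (le_lt_trans zS)// (le_lt_trans (ler_norm _))//.
  by rewrite (@le_lt_trans _ _ (Num.max (Num.max `|Sy| `|R0|) `|bU|)) ?ltrDl// !le_max lexx orbT.
have rU (z : U) : `|z| <= bU -> `|z| < r.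
  move=> zS; rewrite (le_lt_trans zS)// (le_lt_trans (ler_norm _))//.
  by rewrite (@le_lt_trans _ _ (Num.max (Num.max `|Sy| `|R0|) `|bU|)) ?ltrDl// !le_max lexx !orbT.
have S0 : 0 <= Sy + `|R0|.
  have := vyS 0; rewrite lexx (ltW tau0) => /(_ isT)/(le_trans (normr_ge0 _)) S0.
  by rewrite addr_ge0.
have mk : strongly_measurable `[0, tau] (fun s => h s - g (v s) (u s)).
  have := strongly_measurable_lin (-1) (superposition_measurable gc cv mu_) hLp.1.
  by apply: strongly_measurable_ae; apply: aeW => s _; rewrite scaleN1r addrC.
have kd : {ae mu, forall s, s \in `[0, tau] -> `|h s - g (v s) (u s)| <= L * `|d s|}.
  apply: ae_sub uU => s us sI; have st : 0 <= s <= tau by move: sI; rewrite in_itv.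
  rewrite /h yJ//; apply: LP; [exact/rS/vyS|exact/rR/vR|exact/rU/us].
have dS t : 0 <= t <= tau -> `|d t| <= Sy + `|R0|.
  move=> tt; apply: (le_trans (ler_normB _ _)); apply: lerD; first exact: vyS.
  by apply: (le_trans (vR t tt)); exact: ler_norm.
move=> t tt; rewrite yJ//; congr (J _); apply/eqP; rewrite -subr_eq0; apply/eqP.
exact: (volterra_zero hT hb C_gt0 alpha_lt1 WC WT tau1 (ltW L0) S0 mk kd bd dS).
Qed.

End MildSolutions.

(** * A common existence time for all data *)

Theorem theorem4p6 (R : realType) (X U : completeNormedModType R)
  (T : R -> {linear X -> X}) (DA : set X) (A : X -> X) (M lambda : R)
  (hT : analytic_semigroup T) (hA : is_generator T DA A)
  (hM : 1 <= M) (hlambda : 0 < lambda) (hMT : exp_bounded T M lambda)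
  (omega : R) (homega : (growth_bound T < omega%:E)%E)
  (* Xm1 and Tm1 are X_(-1) and T_(-1) *)
  (Xm1 : completeNormedModType R) (j : {linear X -> Xm1})
  (hXm1 : is_extrapolation_space T omega 1 j)
  (Tm1 : R -> {linear Xm1 -> Xm1}) (hTm1 : C0_semigroup Tm1)
  (hTm1T : forall t, 0 <= t -> forall x, Tm1 t (j x) = j (T t x))
  (alpha : R) (halpha : 0 < alpha < 1)
  (* E is X_(-1+alpha+eps), iota its inclusion into X_(-1) *)
  (eps : R) (heps : 0 < eps) (halphaeps : alpha + eps < 1)
  (E : completeNormedModType R) (jE : {linear X -> E})
  (hE : is_extrapolation_space T omega (1 - alpha - eps) jE)
  (iota : {linear E -> Xm1}) (hiota : continuous iota)
  (hiotaj : forall x, iota (jE x) = j x)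
  (B : {linear U -> E}) (hB : continuous B)
  (f : X -> U -> X)
  (hf : {within (Xpow T omega alpha `*` setT : set (Xpow_top T omega alpha * U)%type),
           continuous ((fun z => f z.1 z.2) : (Xpow_top T omega alpha * U)%type -> X)})
  (hfLip : forall r : R, 0 < r -> exists2 L : R, 0 < L &
     forall x1 x2 u, Xpow T omega alpha x1 -> Xpow T omega alpha x2 ->
       Xpow_norm T omega alpha x1 < r -> Xpow_norm T omega alpha x2 < r ->
       `|u| < r ->
       `|f x1 u - f x2 u| <= L * Xpow_norm T omega alpha (x1 - x2))
  (hfLp : forall (u : R -> U) (x : R -> X),
     memLinfty `[0, +oo[ u ->
     {within `[0, +oo[, continuous x} ->
     (forall s, 0 < s -> Xpow T omega alpha (x s)) ->
     exists2 p : R, (1 - alpha)^-1 < p & memLp_loc p (fun s => f (x s) (u s)))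
  (sigma : R -> R) (c : R) (hsigma : Kinfty sigma) (hc : 0 < c)
  (hf0 : forall u, `|f 0 u| <= sigma `|u| + c) :
  forall (Q : set X) (r : R) (S : set U) (delta : R),
    Q `<=` Xpow T omega alpha ->
    @compact (Xpow_top T omega alpha) Q ->
    0 < r -> bounded_set S -> 0 < delta ->
    exists2 t1 : R, 0 < t1 &
      forall w x0 (u : R -> U),
        Q w -> Xpow_ball T omega alpha w r x0 ->
        memLinfty_loc u ->
        {ae (@lebesgue_measure R), forall t, 0 <= t -> S (u t)} ->
        let mild := mild_solution T omega alpha j Tm1 (iota \o B) f x0 u t1 in
        exists x : R -> X,
          [/\ mild x,
              forall y, mild y -> forall t, 0 <= t <= t1 -> y t = x t &
              forall t, 0 <= t <= t1 ->
                Xpow_ball T omega alpha w (M * r + delta) (x t)].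

Proof.
move=> Q r S delta QX Qc r0 Sb delta0.
have [J [W [Z [C [[JE cJ Ji cj ji] JT C0 WP ZP]]]]] := smoothing_kernels hT homega hXm1 hTm1 hTm1T
  halpha heps halphaeps hE hiota hiotaj.
have [hC0 _] := hT; have /andP[alpha0 alpha1] := halpha.
have [_ _ Tadd _] := hC0; have [cTm1 _ Tm1add _] := hTm1.
have beta1 : 1 - eps < 1 by rewrite gtrBl.
have a0 : 0 < 1 - alpha by rewrite subr_gt0.
have b0 : 0 < 1 - (1 - eps) by rewrite subKr.
have WC t v : 0 < t <= 1 -> `|W t v| <= C * t `^ (- alpha) * `|v|.
  by move=> /andP[t0 t1]; exact: (WP t v t0).2.
have ZC t e : 0 < t <= 1 -> `|Z t e| <= C * t `^ (- (1 - eps)) * `|e|.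
  by move=> /andP[t0 t1]; exact: (ZP t e t0).2.
have JW t x : 0 < t -> J (W t x) = T t x by move=> t0; exact: (WP t x t0).1.
have JZ t e : 0 < t -> j (J (Z t e)) = Tm1 t (iota e) by move=> t0; exact: (ZP t e t0).1.
have WT s t v : 0 <= s -> 0 < t -> W (s + t) v = T s (W t v).
  move=> s0 t0; apply: Ji; rewrite JT// !JW ?ltr_wpDl//.
  exact: Tadd s0 (ltW t0) v.
have ZT s t e : 0 <= s -> 0 < t -> Z (s + t) e = T s (Z t e).
  move=> s0 t0; apply: Ji; apply: ji; rewrite JT// JZ ?ltr_wpDl// -hTm1T// JZ//.
  exact: Tm1add s0 (ltW t0) _.
pose g (v : X) (y : U) := f (J v) y.
have gc (v_ : nat -> X) (u_ : nat -> U) v u : v_ n @[n --> \oo] --> v ->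
    u_ n @[n --> \oo] --> u -> g (v_ n) (u_ n) @[n --> \oo] --> g v u.
  exact: (nonlinearity_cvg JE Ji hf).
have powerJ := powerK JE Ji; have Jpower := XpowP JE Ji.
have normJ v v' : Xpow_norm T omega alpha (J v - J v') = `|v - v'|.
  by rewrite /Xpow_norm -(linearB J) powerJ.
have gLip (k : R) : 0 < k -> exists2 L : R, 0 < L & forall v v' y,
    `|v| < k -> `|v'| < k -> `|y| < k -> `|g v y - g v' y| <= L * `|v - v'|.
  move=> k0; have [L L0 LP] := hfLip k k0; exists L => // v v' y vk vk' yk.
  rewrite -[`|v - v'|]normJ; apply: LP => //; try exact: (Xpow_neg_power JE).
    by rewrite /Xpow_norm powerJ.
  by rewrite /Xpow_norm powerJ.
(* By construction of the initial topology, [power] is continuous from [Xpow_top] to X, so P is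
   compact for the norm of X. *)
pose P := power T omega alpha @` Q.
have cP : compact P.
  apply: (@continuous_compact (Xpow_top T omega alpha) X (power T omega alpha)) => //.
  by apply: continuous_subspaceT; exact: initial_continuous.
have [Rb Rb0 RbP] : exists2 Rb : R, 0 < Rb & forall v, P v -> `|v| <= Rb.
  by have [k k0 kP] := pinfty_ex_gt0 (compact_bounded cP); exists k.
have [bS bS0 bSP] : exists2 bS : R, 0 < bS & forall y, S y -> `|y| <= bS.
  by have [k k0 kP] := pinfty_ex_gt0 Sb; exists k.
have M0 : 0 < M by exact: lt_le_trans hM.
(* Budget for delta: one eighth for the growth of e^(lambda t), one eighth for the orbits of P, one
   quarter for each convolution; the remaining quarter makes the final inequality strict. *)
pose rho := M * r + delta * (3 / 4); pose R0 := Rb + rho.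
have rho0 : 0 < rho by rewrite addr_gt0// mulr_gt0// divr_gt0.
have R00 : 0 < R0 by rewrite addr_gt0.
have [|L L0 LP] := gLip (R0 + bS + 1); first by clear -R00 bS0; lra.
(* g v y is compared with g 0 y = f 0 y, bounded by sigma bS + c because sigma is increasing; the
   Lipschitz condition adds L R0. *)
pose H := `|sigma bS + c| + L * R0.
have H0 : 0 <= H by rewrite addr_ge0// mulr_ge0// ltW.
have [CB CB0 CBP] := continuous_linear_le hB.
have HB0 : 0 <= CB * bS by rewrite mulr_ge0// ltW.
have gL v v' y : `|v| <= R0 -> `|v'| <= R0 -> `|y| <= bS -> `|g v y - g v' y| <= L * `|v - v'|.
  by move=> vR vR' yb; apply: LP; clear -vR vR' yb R00 bS0; lra.
have gH v y : `|v| <= R0 -> `|y| <= bS -> `|g v y| <= H.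
  move=> vR yb; rewrite -(subrK (g 0 y) (g v y)) addrC; apply: (le_trans (ler_normD _ _)).
  apply: lerD.
    rewrite /g linear0; apply: (le_trans (hf0 y)); apply: le_trans (ler_norm _); rewrite lerD2r.
    have [_ smono _ _] := hsigma; move: yb; rewrite le_eqVlt => /predU1P[->//|yb].
    by apply: ltW; apply: (smono _ _ _ _ yb); rewrite in_itv/= andbT// ltW.
  apply: (le_trans (gL _ _ _ vR _ yb)); first by rewrite normr0 ltW.
  by rewrite subr0; apply: ler_wpM2l => //; exact: ltW.
have BH y : `|y| <= bS -> `|B y| <= CB * bS.
  by move=> yb; apply: (le_trans (CBP y)); apply: ler_wpM2l => //; exact: ltW.
have near_small (k a e : R) : 0 < a -> 0 <= k -> 0 < e ->
    \forall t \near (0 : R)^'+, k * (t `^ a / a) < e.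
  move=> a_gt0 k0 e0; have [|d d0 dP] := powR_small a_gt0 _ e0 (k := k / a).
    by rewrite divr_ge0// ltW.
  have nd : \forall t \near (0 : R)^'+, t < d by exact: nbhs_right_lt.
  near=> t; have -> : k * (t `^ a / a) = k / a * t `^ a by ring.
  by apply: dP; rewrite ltW//=; near: t => //; exact: nbhs_right_gt.
have d4 : 0 < delta / 4 by rewrite divr_gt0.
have d8 : 0 < delta / 8 by rewrite divr_gt0.
have n1 := uniform_orbit hC0 hMT cP d8.
have n2 : \forall t \near (0 : R)^'+, M * expR (lambda * t) * r <= M * r + delta / 8.
  have c2 : M * expR (lambda * t) * r @[t --> (0 : R)^'+] --> M * expR (lambda * 0) * r.
    apply: cvg_at_right_filter; apply: cvgMl; apply: cvgMr.
    by apply: continuous_comp; [apply: cvgMr; exact: cvg_id|exact: continuous_expR].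
  rewrite mulr0 expR0 mulr1 in c2; move/cvgrPdist_le : c2 => /(_ _ d8) c2.
  near=> t; rewrite -lerBlDl; apply: (le_trans (ler_norm _)); rewrite distrC; near: t; exact: c2.
have n3 := near_small (C * H) _ _ a0 (mulr_ge0 (ltW C0) H0) d4.
have n4 := near_small (C * (CB * bS)) _ _ b0 (mulr_ge0 (ltW C0) HB0) d4.
have n5 := near_small (C * L) _ _ a0 (mulr_ge0 (ltW C0) (ltW L0)) (divr_gt0 (@ltr01 R) (ltr0Sn _ 1)).
have n6 : \forall t \near (0 : R)^'+, 0 < t < 1.
  near=> t; apply/andP; split; near: t; [exact: nbhs_right_gt|exact: nbhs_right_lt].
(* The smallness conditions involve the data only through Q, r, S and delta, so [t1] is fixed before
   [w], [x0] and [u]. *)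
have [t1 [[[s1 s2] [s3 s4]] [s5 /andP[t10 t11]]]] :=
  filter_ex (filterI (filterI (filterI n1 n2) (filterI n3 n4)) (filterI n5 n6)).
exists t1 => // w x0 u Qw [Xx0 x0w] uL uS mild.
pose wh := power T omega alpha w; pose v0 := power T omega alpha x0.
have Jw : J wh = w by apply: Jpower; exact: QX.
have Jv0 : J v0 = x0 by exact: Jpower.
have Pw : P wh by exists w.
have v0w : `|v0 - wh| < r by rewrite -normJ Jv0 Jw.
have [mu_ _] := uL t1 (ltW t10).
have uU : {ae (@lebesgue_measure R), forall s, s \in `[0, t1] -> `|u s| <= bS}.
  by apply: ae_sub uS => s Su; rewrite in_itv/= => /andP[s0 _]; apply: bSP; exact: Su.
have base t : 0 <= t <= t1 -> `|T t v0 - wh| <= rho - delta / 2.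
  move=> tt; have /andP[t0 tt1] := tt.
  have -> : T t v0 - wh = T t (v0 - wh) + (T t wh - wh) by rewrite (linearB (T t)) addrA subrK.
  rewrite (_ : rho - delta / 2 = M * r + delta / 8 + delta / 8); last by rewrite /rho; field.
  apply: (le_trans (ler_normD _ _)); apply: lerD; last exact: s1.
  apply: (le_trans (hMT t t0 _)); apply: le_trans s2.
  apply: ler_pM => //; [by rewrite mulr_ge0 ?expR_ge0 ?ltW| |exact: ltW].
  by apply: ler_wpM2l; [exact: ltW|rewrite ler_expR; apply: ler_wpM2l => //; exact: ltW].
have [v [cv vw vE]] : exists v, [/\ {within `[0, t1], continuous v},
    forall t, 0 <= t <= t1 -> `|v t - wh| <= rho &
    forall t, 0 <= t <= t1 -> [/\ v t = duhamel T W Z g B v0 u v t,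
      bochner_integrable `[0, t] (fun s => W (t - s) (g (v s) (u s))) &
      bochner_integrable `[0, t] (fun s => Z (t - s) (B (u s)))]].
  apply: (duhamel_fixed_point hC0 hMT C0 alpha1 beta1 WC ZC WT ZT hB gc H0 (ltW L0) HB0 gH gL BH
    (ltW t10) (ltW t11) (ltW rho0) _ mu_ uU base); first by rewrite lerD2r RbP.
    by rewrite [leRHS](_ : _ = delta / 4 + delta / 4); [apply: lerD; exact: ltW|field].
  by rewrite -[leRHS]mul1r; exact: ltW.
have vR t : 0 <= t <= t1 -> `|v t| <= R0.
  move=> tt; rewrite -(subrK wh (v t)) addrC; apply: (le_trans (ler_normD _ _)).
  by apply: lerD; [exact: RbP|exact: vw].
exists (J \o v); split.
- rewrite /mild -Jv0.
  exact: (duhamel_mild JE cJ cj JT JW JZ cv vE).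
- move=> y; rewrite /mild -Jv0 => my t tt.
  exact: (mild_unique hC0 hMT cJ cj ji JT JW JZ C0 alpha0 alpha1 beta1 WC ZC WT ZT hB gc gLip hfLp
    t10 (ltW t11) mu_ uU cv vR vE my tt).
- move=> t tt; split; first exact: (Xpow_neg_power JE).
  rewrite /= -Jw normJ; apply: (le_lt_trans (vw t tt)).
  by rewrite /rho ltrD2l gtr_pMr// ltr_pdivrMr// mul1r ltr_nat.
Unshelve. all: end_near. Qed.
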